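(* Let $\mathscr{C}$ be a rigid monoidal category and let $H\colon\mathscr{C}\to\mathscr{C}$ be a Hopf monad that admits a double $D(H)$ and an anti-double $Q(H)$. The following statements are equivalent: (i) the monoidal unit $1\in\mathscr{C}$ lifts to a module over $Q(H)$; (ii) $D(H)$ and $Q(H)$ are isomorphic as comodule monads (over $D(H)$); (iii) $D(H)$ and $Q(H)$ are isomorphic as monads. Additionally, if $\mathscr{C}$ is pivotal with pivotal structure $\phi\colon\mathrm{Id}_{\mathscr{C}}\Rightarrow{}^{\vee\vee}(-)$, any of the statements (i), (ii), (iii) holds if and only if $H$ and $\phi$ admit a pair in involution.
   Context: Associators and unitors are suppressed; ${}^\vee x$ is the left dual of $x$, with ${}^\vee x\otimes x\to1$, $1\to x\otimes{}^\vee x$. Bimonads and Hopf monads. A bimonad on $\mathscr{C}$ is a monad $(H,\mu,\eta)$ with an oplax monoidal structure $H_2\colon H(x\otimes y)\to Hx\otimes Hy$, $H_0\colon H1\to1$ for which $\mu,\eta$ are oplax monoidal transformations. It is a Hopf monad if the fusion operators $(\mu_x\otimes Hy)\circ H_{2;Hx,y}\colon H(Hx\otimes y)\to Hx\otimes Hy$ and $(Hx\otimes\mu_y)\circ H_{2;x,Hy}\colon H(x\otimes Hy)\to Hx\otimes Hy$ are invertible. Then the Eilenberg–Moore category $\mathscr{C}^H$ (objects: $H$-modules) is rigid monoidal, with strict monoidal forgetful functor $U^H$ and free functor $F^H$ (oplax monoidal). Comodule monads. A comodule monad over a bimonad $B$ on $\mathscr{C}$ (here $\mathscr{C}$ acts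 on itself by $\otimes$) is a monad $(T,\mu,\eta)$ on $\mathscr{C}$ with a natural coaction $T_{\mathsf a;x,y}\colon T(x\otimes y)\to Tx\otimes By$ that is coassociative and counital with respect to $B_2,B_0$, and such that $T_{\mathsf a}\circ\mu_{x\otimes y}=(\mu_x\otimes\mu_y)\circ T_{\mathsf a;Tx,By}\circ T(T_{\mathsf a;x,y})$ and $T_{\mathsf a}\circ\eta_{x\otimes y}=\eta_x\otimes\eta_y$. A morphism of comodule monads is a morphism of monads $f$ with $G_{\mathsf a;x,y}\circ f_{x\otimes y}=(f_x\otimes By)\circ T_{\mathsf a;x,y}$. A bimonad is a comodule monad over itself via its comultiplication. Centralisers. An endofunctor $T$ of a rigid category $\mathscr{A}$ is centralisable if $Z_T(x)=\int^{y\in\mathscr{A}}{}^\vee(Ty)\otimes x\otimes y$ exists for all $x$; the coend structure maps yield a universal coaction $\chi_{x,y}\colon x\otimes y\to Ty\otimes Z_Tx$, natural in $x,y$. It has the property that natural transformations out of iterated $Z_T$'s are determined uniquely by (and can be defined by prescribing) their composites with iterated universal coactions. If $T$ is oplax monoidal, $Z_T$ is a monad with unit $(T_0\otimes Z_Tx)\circ\chi_{x,1}$ and multiplication $\mu_x\colon Z_T^2x\to Z_Tx$ uniquely determined by $(Ty\otimes Tz\otimes\mu_x)\circ(Ty\otimes\chi_{Z_Tx,z})\circ(\chi_{x,y}\otimes z)=(T_{2;y,z}\otimes Z_Tx)\circ\chi_{x,y\otimes z}$. Let $\mathscr{A}$ be rigid with $\mathrm{Id}_{\mathscr{A}}$ and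 ${}^{\vee\vee}(-)$ centralisable, with centralisers $(\mathfrak{D},\chi)$, $\chi_{x,y}\colon x\otimes y\to y\otimes\mathfrak{D}x$, and $(\mathfrak{Q},\xi)$, $\xi_{x,y}\colon x\otimes y\to{}^{\vee\vee}y\otimes\mathfrak{Q}x$. Then $\mathfrak{D}$ is a bimonad with $(z\otimes\mathfrak{D}_{2;x,y})\circ\chi_{x\otimes y,z}=(\chi_{x,z}\otimes\mathfrak{D}y)\circ(x\otimes\chi_{y,z})$ and $(z\otimes\mathfrak{D}_0)\circ\chi_{1,z}=\mathrm{id}_z$, and $\mathfrak{Q}$ is a comodule monad over $\mathfrak{D}$ with coaction determined by $({}^{\vee\vee}z\otimes\mathfrak{Q}_{\mathsf a;x,y})\circ\xi_{x\otimes y,z}=(\xi_{x,z}\otimes\mathfrak{D}y)\circ(x\otimes\chi_{y,z})$. Double and anti-double. ''$H$ admits a double and anti-double'' means that the endofunctors $H$ and $U^H\circ{}^{\vee\vee}(-)\circ F^H$ of $\mathscr{C}$ are centralisable. In this case $\mathrm{Id}$ and ${}^{\vee\vee}(-)$ on $\mathscr{A}=\mathscr{C}^H$ are centralisable; taking $\mathfrak{D}$ to be the centraliser of $\mathrm{Id}_{\mathscr{C}^H}$ with its bimonad structure, and $\mathfrak{Q}$ to be the centraliser of ${}^{\vee\vee}(-)\colon\mathscr{C}^H\to\mathscr{C}^H$ with its structure of a comodule monad over $\mathfrak{D}$ (both structures being determined by the universal coactions $\chi$ and $\xi$ for $\mathscr{A}=\mathscr{C}^H$), one sets $D(H)=U^H\mathfrak{D}F^H$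 and $Q(H)=U^H\mathfrak{Q}F^H$. These are monads via $U^H\mu F^H\circ U^HT\varepsilon TF^H$ and $U^H\eta^{T}F^H\circ\eta$ (for $T=\mathfrak{D},\mathfrak{Q}$, with $\eta,\varepsilon$ the unit and counit of $F^H\dashv U^H$); $D(H)$ is a bimonad with comultiplication $U^H\mathfrak{D}_2\circ U^H\mathfrak{D}(F^H_2)$ and counit $U^H\mathfrak{D}_0\circ U^H\mathfrak{D}(F^H_0)$, and $Q(H)$ is a comodule monad over $D(H)$ with coaction $U^H\mathfrak{Q}_{\mathsf a}\circ U^H\mathfrak{Q}(F^H_2)$. ''$1$ lifts to a module over $Q(H)$'' means there is a $Q(H)$-module with underlying object $1$. Pairs in involution. A pivotal structure is a monoidal natural isomorphism $\phi\colon\mathrm{Id}\Rightarrow{}^{\vee\vee}(-)$. A character of $H$ is an $H$-module $\beta=(1,\nabla_\beta)$ with underlying object $1$. A group-like of $H$ is a natural transformation $g\colon\mathrm{Id}_{\mathscr{C}}\Rightarrow H$ with $H_{2;x,y}\circ g_{x\otimes y}=g_x\otimes g_y$, $H_0\circ g_1=\mathrm{id}_1$; group-likes form a group with unit $\eta$ under $(g,h)\mapsto(\mu_x\circ g_{Hx}\circ h_x)_x$. Put $L_{g,x}=\mu_x\circ g_{Hx}$, $R_{g,x}=\mu_x\circ H(g_x)$, $\mathrm{Ad}_g=L_g\circ R_{g^{-1}}$, and $\mathrm{Ad}_{\beta,x}=(\nabla_\beta\otimes Hx\otimes\nabla_{{}^\vee\beta})\circ H_{3;1,x,1}\colon Hx\to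 Hx$, with $H_3$ the iterated comultiplication and ${}^\vee\beta$ the left dual of $\beta$ in $\mathscr{C}^H$. The left antipode is the natural transformation $s^l_x\colon H({}^\vee Hx)\to{}^\vee x$ such that the left dual of $(x,\nabla_x)$ in $\mathscr{C}^H$ is $({}^\vee x,s^l_x\circ H({}^\vee\nabla_x))$. The square of the antipode is $S^2_x=\phi^{-1}_{Hx}\circ s^l_{{}^\vee Hx}\circ H({}^\vee s^l_x)\circ H(\phi_x)\colon Hx\to Hx$. A pair in involution of $H$ and $\phi$ is a pair $(g,\beta)$ of a group-like and a character with $\mathrm{Ad}_{g,x}=\mathrm{Ad}_{\beta,x}\circ S^2_x$ for all $x\in\mathscr{C}$. *)

(* Defs.v *)
From Stdlib Require Import ssreflect.
From Stdlib Require Import ProofIrrelevance.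

Local Notation esym := eq_sym.
Local Notation erefl := eq_refl.
Local Notation etrans := eq_trans.

Set Implicit Arguments.
Unset Strict Implicit.
Unset Printing Implicit Defensive.

Record Category := {
  Obj :> Type;
  Hom : Obj -> Obj -> Type;
  id : forall x, Hom x x;
  comp : forall x y z, Hom y z -> Hom x y -> Hom x z;
  comp_idl : forall x y (f : Hom x y), comp (id y) f = f;
  comp_idr : forall x y (f : Hom x y), comp f (id x) = f;
  compA : forall w x y z (h : Hom y z) (g : Hom x y) (f : Hom w x),
    comp h (comp g f) = comp (comp h g) f
}.
Arguments Hom {_} _ _.
Arguments id {_} _.
Arguments comp {_ _ _ _} _ _.

Declare Scope cat_scope.
Delimit Scope cat_scope with cat.
Open Scope cat_scope.
Notation "x ~> y" := (Hom x y) (at level 70, no associativity) : cat_scope.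
Notation "g ∘ f" := (comp g f) (at level 40, left associativity) : cat_scope.

(** Inverses are unique, so [IsIso f] is a property of [f]; it is given in
    [Type] so that the inverse can be used in definitions. *)
Record IsIso (C : Category) (x y : C) (f : x ~> y) := {
  iso_inv : y ~> x;
  iso_invK : iso_inv ∘ f = id x;
  iso_Kinv : f ∘ iso_inv = id y
}.

Record Functor (C D : Category) := {
  fobj :> C -> D;
  fmap : forall x y, x ~> y -> fobj x ~> fobj y;
  fmap_id : forall x, fmap (id x) = id (fobj x);
  fmap_comp : forall x y z (g : y ~> z) (f : x ~> y),
    fmap (g ∘ f) = fmap g ∘ fmap f
}.
Arguments fmap {_ _} _ {_ _} _.

Definition is_natural (C D : Category) (F G : Functor C D)
    (a : forall x, F x ~> G x) :=
  forall x y (f : x ~> y), a y ∘ fmap F f = fmap G f ∘ a x.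

Record NatTrans (C D : Category) (F G : Functor C D) := {
  nt :> forall x, F x ~> G x;
  nt_natural : is_natural nt
}.

Definition IdFunctor (C : Category) : Functor C C :=
  {| fobj := fun x => x; fmap := fun x y f => f;
     fmap_id := fun x => eq_refl; fmap_comp := fun x y z g f => eq_refl |}.

Definition CompFunctor (C D E : Category) (G : Functor D E) (F : Functor C D) :
  Functor C E.
Proof.
refine {| fobj := fun x => G (F x); fmap := fun x y f => fmap G (fmap F f) |}.
- by move=> x; rewrite !fmap_id.
- by move=> x y z g f; rewrite !fmap_comp.
Defined.

(** Rewriting inside right-associated composites. *)
Lemma post2 (C : Category) (x y z : C) (f : y ~> z) (g : x ~> y) (h : x ~> z) :
  f ∘ g = h -> forall w (k : w ~> x), f ∘ (g ∘ k) = h ∘ k.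
Proof. by move=> E w k; rewrite compA E. Qed.

Lemma post3 (C : Category) (x y z t : C) (f : z ~> t) (g : y ~> z) (e : x ~> y)
    (h : x ~> t) :
  f ∘ (g ∘ e) = h -> forall w (k : w ~> x), f ∘ (g ∘ (e ∘ k)) = h ∘ k.
Proof. by move=> E w k; rewrite -E -!compA. Qed.

Record MonCat := {
  mcat :> Category;
  tens : mcat -> mcat -> mcat;
  tensm : forall x x' y y', x ~> x' -> y ~> y' -> tens x y ~> tens x' y';
  munit : mcat;
  tensm_id : forall x y, tensm (id x) (id y) = id (tens x y);
  tensm_comp : forall x x' x'' y y' y'' (f' : x' ~> x'') (f : x ~> x')
      (g' : y' ~> y'') (g : y ~> y'),
    tensm (f' ∘ f) (g' ∘ g) = tensm f' g' ∘ tensm f g;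
  asc : forall x y z, tens (tens x y) z ~> tens x (tens y z);
  asci : forall x y z, tens x (tens y z) ~> tens (tens x y) z;
  asciK : forall x y z, asci x y z ∘ asc x y z = id _;
  ascKi : forall x y z, asc x y z ∘ asci x y z = id _;
  asc_nat : forall x x' y y' z z' (f : x ~> x') (g : y ~> y') (h : z ~> z'),
    asc x' y' z' ∘ tensm (tensm f g) h = tensm f (tensm g h) ∘ asc x y z;
  lun : forall x, tens munit x ~> x;
  luni : forall x, x ~> tens munit x;
  luniK : forall x, luni x ∘ lun x = id _;
  lunKi : forall x, lun x ∘ luni x = id _;
  lun_nat : forall x y (f : x ~> y), lun y ∘ tensm (id munit) f = f ∘ lun x;
  run : forall x, tens x munit ~> x;
  runi : forall x, x ~> tens x munit;
  runiK : forall x, runi x ∘ run x = id _;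
  runKi : forall x, run x ∘ runi x = id _;
  run_nat : forall x y (f : x ~> y), run y ∘ tensm f (id munit) = f ∘ run x;
  pentagon : forall w x y z,
    asc w x (tens y z) ∘ asc (tens w x) y z
    = tensm (id w) (asc x y z) ∘ (asc w (tens x y) z ∘ tensm (asc w x y) (id z));
  triangle : forall x y,
    tensm (id x) (lun y) ∘ asc x munit y = tensm (run x) (id y)
}.
Arguments tens {_} _ _.
Arguments tensm {_ _ _ _ _} _ _.
Arguments munit {_}.
Arguments asc {_} _ _ _.
Arguments asci {_} _ _ _.
Arguments lun {_} _.
Arguments luni {_} _.
Arguments run {_} _.
Arguments runi {_} _.

Notation "x ⊗ y" := (tens x y) (at level 34, left associativity) : cat_scope.
Notation "f ⊠ g" := (tensm f g) (at level 34, left associativity) : cat_scope.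
Notation "𝟙" := munit : cat_scope.

Section MonoidalLemmas.
Context {C : MonCat}.
Implicit Types x y z w : C.

Lemma tl_comp x y z w (g : y ~> z) (f : x ~> y) :
  (g ∘ f) ⊠ id w = (g ⊠ id w) ∘ (f ⊠ id w).
Proof. by rewrite -tensm_comp comp_idl. Qed.

Lemma tr_comp x y z w (g : y ~> z) (f : x ~> y) :
  id w ⊠ (g ∘ f) = (id w ⊠ g) ∘ (id w ⊠ f).
Proof. by rewrite -tensm_comp comp_idl. Qed.

Lemma tlr x x' y y' (f : x ~> x') (g : y ~> y') :
  (f ⊠ id y') ∘ (id x ⊠ g) = f ⊠ g.
Proof. by rewrite -tensm_comp comp_idl comp_idr. Qed.

Lemma trl x x' y y' (f : x ~> x') (g : y ~> y') :
  (id x' ⊠ g) ∘ (f ⊠ id y) = f ⊠ g.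
Proof. by rewrite -tensm_comp comp_idl comp_idr. Qed.

Lemma asci_nat x x' y y' z z' (f : x ~> x') (g : y ~> y') (h : z ~> z') :
  asci x' y' z' ∘ (f ⊠ (g ⊠ h)) = ((f ⊠ g) ⊠ h) ∘ asci x y z.
Proof.
rewrite -[LHS]comp_idr -(ascKi x y z) -!compA (post2 (esym (asc_nat _ _ _))).
by rewrite -!compA (post2 (asciK _ _ _)) comp_idl.
Qed.

Lemma luni_nat x y (f : x ~> y) : (id 𝟙 ⊠ f) ∘ luni x = luni y ∘ f.
Proof.
by rewrite -[LHS]comp_idl -(luniK y) -!compA (post2 (lun_nat _)) -!compA lunKi comp_idr.
Qed.

Lemma runi_nat x y (f : x ~> y) : (f ⊠ id 𝟙) ∘ runi x = runi y ∘ f.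
Proof.
by rewrite -[LHS]comp_idl -(runiK y) -!compA (post2 (run_nat _)) -!compA runKi comp_idr.
Qed.

Lemma tl1_inj x y (f g : x ~> y) : f ⊠ id 𝟙 = g ⊠ id 𝟙 -> f = g.
Proof.
move=> E; rewrite -[f]comp_idr -[g]comp_idr -(runKi x) !compA.
by rewrite -!run_nat E.
Qed.

Lemma t1r_inj x y (f g : x ~> y) : id 𝟙 ⊠ f = id 𝟙 ⊠ g -> f = g.
Proof.
move=> E; rewrite -[f]comp_idr -[g]comp_idr -(lunKi x) !compA.
by rewrite -!lun_nat E.
Qed.

Lemma epi_asc x y z w (f g : x ⊗ (y ⊗ z) ~> w) :
  f ∘ asc x y z = g ∘ asc x y z -> f = g.
Proof.
by move=> E; rewrite -[f]comp_idr -[g]comp_idr -(ascKi x y z) !compA E.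
Qed.

Lemma mono_asc x y z w (f g : w ~> (x ⊗ y) ⊗ z) :
  asc x y z ∘ f = asc x y z ∘ g -> f = g.
Proof.
by move=> E; rewrite -[f]comp_idl -[g]comp_idl -(asciK x y z) -!compA E.
Qed.

(** Kelly's redundant unit coherences. *)
Lemma lun_tens x y : lun (x ⊗ y) ∘ asc 𝟙 x y = lun x ⊠ id y.
Proof.
apply: t1r_inj.
have e : forall f g : (𝟙 ⊗ ((𝟙 ⊗ x) ⊗ y)) ~> (𝟙 ⊗ (x ⊗ y)),
    f ∘ (asc _ _ _ ∘ (asc 𝟙 𝟙 x ⊠ id y)) = g ∘ (asc _ _ _ ∘ (asc 𝟙 𝟙 x ⊠ id y)) ->
    f = g.
  move=> f g E; apply: epi_asc.
  rewrite -[LHS]comp_idr -[RHS]comp_idr -tensm_id -(ascKi 𝟙 𝟙 x) tl_comp.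
  by rewrite !compA -!(compA _ (asc _ _ _)) E.
apply: e.
rewrite tr_comp -!compA -pentagon.
rewrite (post2 (triangle _ _)) -tensm_id -asc_nat.
rewrite (post2 (esym (asc_nat _ _ _))) -compA; congr (_ ∘ _).
by rewrite -tl_comp triangle.
Qed.

Lemma run_tens x y : (id x ⊠ run y) ∘ asc x y 𝟙 = run (x ⊗ y).
Proof.
apply: tl1_inj.
apply: mono_asc.
rewrite -[in RHS]triangle -tensm_id tl_comp [LHS]compA asc_nat.
rewrite -(triangle y 𝟙) tr_comp -!compA -pentagon.
by rewrite (post2 (asc_nat _ _ _)) -compA.
Qed.

Lemma lun1_run1 : lun (𝟙 : C) = run 𝟙.
Proof.
apply: tl1_inj.
rewrite -lun_tens -triangle; congr (_ ∘ _).
rewrite -[LHS]comp_idl -(luniK 𝟙) -compA.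
by rewrite -lun_nat compA luniK comp_idl.
Qed.

End MonoidalLemmas.

Record RigidCat := {
  rmon :> MonCat;
  ldual : rmon -> rmon;
  lev : forall x, ldual x ⊗ x ~> 𝟙;
  lcoev : forall x, 𝟙 ~> x ⊗ ldual x;
  lzig : forall x,
    run x ∘ (id x ⊠ lev x) ∘ asc _ _ _ ∘ (lcoev x ⊠ id x) ∘ luni x = id x;
  lzag : forall x,
    lun (ldual x) ∘ (lev x ⊠ id (ldual x)) ∘ asci _ _ _
      ∘ (id (ldual x) ⊠ lcoev x) ∘ runi (ldual x) = id (ldual x);
  rdual : rmon -> rmon;
  rev : forall x, x ⊗ rdual x ~> 𝟙;
  rcoev : forall x, 𝟙 ~> rdual x ⊗ x;
  rzig : forall x,
    lun x ∘ (rev x ⊠ id x) ∘ asci _ _ _ ∘ (id x ⊠ rcoev x) ∘ runi x = id x;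
  rzag : forall x,
    run (rdual x) ∘ (id (rdual x) ⊠ rev x) ∘ asc _ _ _
      ∘ (rcoev x ⊠ id (rdual x)) ∘ luni (rdual x) = id (rdual x)
}.
Arguments ldual {_} _.
Arguments lev {_} _.
Arguments lcoev {_} _.
Arguments rdual {_} _.
Arguments rev {_} _.
Arguments rcoev {_} _.

(** The transposition lemmas are proved for an arbitrary dual pair, so that
    they apply to left duals (right factor) and to right duals (left factor). *)
Section Duality.
Context {C : MonCat}.
Implicit Types x y d w : C.

Section DualPair.
Variables (x d : C) (ev : d ⊗ x ~> 𝟙) (coev : 𝟙 ~> x ⊗ d).
Hypothesis zig :
  run x ∘ (id x ⊠ ev) ∘ asc _ _ _ ∘ (coev ⊠ id x) ∘ luni x = id x.
Hypothesis zag :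
  lun d ∘ (ev ⊠ id d) ∘ asci _ _ _ ∘ (id d ⊠ coev) ∘ runi d = id d.

Lemma runi_tens y z : asc y z 𝟙 ∘ runi (y ⊗ z) = id y ⊠ runi z.
Proof.
rewrite -[RHS]comp_idr -(runKi (y ⊗ z)) -run_tens -!compA.
by rewrite (post2 (esym (tr_comp _ _ _))) runiK tensm_id comp_idl.
Qed.

Lemma luni_tens y z : asci 𝟙 y z ∘ luni (y ⊗ z) = luni y ⊠ id z.
Proof.
apply: mono_asc; rewrite compA ascKi comp_idl.
rewrite -[RHS]comp_idl -(luniK (y ⊗ z)) -!compA (post2 (lun_tens _ _)).
by rewrite -tl_comp lunKi tensm_id comp_idr.
Qed.

Lemma triangle_i y z : asc y 𝟙 z ∘ (runi y ⊠ id z) = id y ⊠ luni z.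
Proof.
rewrite -[LHS]comp_idl -tensm_id -(luniK z) tr_comp -compA (post2 (triangle _ _)).
by rewrite -tl_comp runKi tensm_id comp_idr.
Qed.

Lemma triangle_i' y z : asci y 𝟙 z ∘ (id y ⊠ luni z) = runi y ⊠ id z.
Proof. by rewrite -triangle_i compA asciK comp_idl. Qed.

Lemma run_asci y z : run (y ⊗ z) ∘ asci y z 𝟙 = id y ⊠ run z.
Proof. by rewrite -run_tens -compA ascKi comp_idr. Qed.

Lemma triangle_asci y z : (run y ⊠ id z) ∘ asci y 𝟙 z = id y ⊠ lun z.
Proof. by rewrite -triangle -compA ascKi comp_idr. Qed.

Definition rtrans_of (a w : C) (u : a ~> w ⊗ d) : a ⊗ x ~> w :=
  run w ∘ (id w ⊠ ev) ∘ asc w d x ∘ (u ⊠ id x).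

Definition rtrans (a w : C) (e : a ⊗ x ~> w) : a ~> w ⊗ d :=
  (e ⊠ id d) ∘ asci a x d ∘ (id a ⊠ coev) ∘ runi a.

Lemma rtransK a w (e : a ⊗ x ~> w) : rtrans_of (rtrans e) = e.
Proof.
rewrite /rtrans_of /rtrans !tl_comp -!compA.
rewrite (post2 (asc_nat _ _ _)) tensm_id -!compA.
rewrite (post2 (trl _ _)) -(tlr e ev) -!compA.
rewrite (post2 (run_nat _)) -!compA.
rewrite -[RHS]comp_idr; congr (_ ∘ _).
have P : asc (a ⊗ x) d x ∘ (asci a x d ⊠ id x)
   = asci a x (d ⊗ x) ∘ ((id a ⊠ asc x d x) ∘ asc a (x ⊗ d) x).
  apply: mono_asc; rewrite compA pentagon -!compA -tl_comp ascKi tensm_id comp_idr.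
  by rewrite (post2 (ascKi _ _ _)) comp_idl.
rewrite (post2 P) -!compA -tensm_id (post2 (esym (asci_nat _ _ _))) -!compA.
rewrite (post2 (asc_nat _ _ _)) (post2 (run_asci _ _)) -!compA triangle_i.
by rewrite -!tr_comp !compA zig !tensm_id.
Qed.

Lemma rtrans_ofK a w (u : a ~> w ⊗ d) : rtrans (rtrans_of u) = u.
Proof.
rewrite /rtrans_of /rtrans !tl_comp -!compA.
rewrite (post2 (esym (asci_nat _ _ _))) tensm_id -!compA.
rewrite (post2 (tlr _ _)) -(trl u coev) -!compA.
rewrite runi_nat.
rewrite !compA -[RHS]comp_idl; congr (_ ∘ _); rewrite -!compA.
have P : (asc w d x ⊠ id d) ∘ asci (w ⊗ d) x d
   = asci w (d ⊗ x) d ∘ ((id w ⊠ asci d x d) ∘ asc w d (x ⊗ d)).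
  apply: mono_asc.
  rewrite -[LHS]comp_idl -tensm_id -(asciK d x d) tr_comp -!compA.
  rewrite (post3 (esym (pentagon _ _ _ _))) -!compA ascKi comp_idr.
  by rewrite (post2 (ascKi _ _ _)) comp_idl.
rewrite (post2 P) -!compA -tensm_id (post2 (asc_nat _ _ _)) -!compA runi_tens.
rewrite (post2 (esym (asci_nat _ _ _))) -!compA (post2 (triangle_asci _ _)).
by rewrite -!tr_comp !compA zag !tensm_id.
Qed.

Lemma rtrans_inj a w (u v : a ~> w ⊗ d) : rtrans_of u = rtrans_of v -> u = v.
Proof. by move=> E; rewrite -[u]rtrans_ofK E rtrans_ofK. Qed.

Definition ltrans_of (a w : C) (u : a ~> x ⊗ w) : d ⊗ a ~> w :=
  lun w ∘ (ev ⊠ id w) ∘ asci d x w ∘ (id d ⊠ u).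

Definition ltrans (a w : C) (e : d ⊗ a ~> w) : a ~> x ⊗ w :=
  (id x ⊠ e) ∘ asc x d a ∘ (coev ⊠ id a) ∘ luni a.

Lemma ltransK a w (e : d ⊗ a ~> w) : ltrans_of (ltrans e) = e.
Proof.
rewrite /ltrans_of /ltrans !tr_comp -!compA.
rewrite (post2 (asci_nat _ _ _)) tensm_id -!compA.
rewrite (post2 (tlr _ _)) -(trl ev e) -!compA.
rewrite (post2 (lun_nat _)) -!compA.
rewrite -[RHS]comp_idr; congr (_ ∘ _).
have P : asci d x (d ⊗ a) ∘ (id d ⊠ asc x d a)
   = asc (d ⊗ x) d a ∘ ((asci d x d ⊠ id a) ∘ asci d (x ⊗ d) a).
  rewrite -[LHS]comp_idr -(ascKi d (x ⊗ d) a).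
  rewrite -[asc d _ a]comp_idr -tensm_id -(ascKi d x d) tl_comp -!compA.
  by rewrite (post3 (esym (pentagon _ _ _ _))) -!compA (post2 (asciK _ _ _)) comp_idl.
rewrite (post2 P) -!compA -tensm_id (post2 (esym (asc_nat _ _ _))) -!compA.
rewrite (post2 (asci_nat _ _ _)) (post2 (lun_tens _ _)) -!compA triangle_i'.
by rewrite -!tl_comp !compA zag !tensm_id.
Qed.

Lemma ltrans_ofK a w (u : a ~> x ⊗ w) : ltrans (ltrans_of u) = u.
Proof.
rewrite /ltrans_of /ltrans !tr_comp -!compA.
rewrite (post2 (esym (asc_nat _ _ _))) tensm_id -!compA.
rewrite (post2 (trl _ _)) -(tlr coev u) -!compA.
rewrite luni_nat.
rewrite !compA -[RHS]comp_idl; congr (_ ∘ _); rewrite -!compA.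
have P : (id x ⊠ asci d x w) ∘ asc x d (x ⊗ w)
   = asc x (d ⊗ x) w ∘ ((asc x d x ⊠ id w) ∘ asci (x ⊗ d) x w).
  rewrite -[LHS]comp_idr -(ascKi (x ⊗ d) x w) -!compA.
  rewrite (post2 (pentagon _ _ _ _)) -!compA.
  by rewrite (post2 (esym (tr_comp _ _ _))) asciK tensm_id comp_idl.
rewrite (post2 P) -!compA -tensm_id (post2 (asci_nat _ _ _)) -!compA luni_tens.
rewrite (post2 (esym (asc_nat _ _ _))) -!compA (post2 (triangle _ _)).
by rewrite -!tl_comp !compA zig !tensm_id.
Qed.

Lemma ltrans_inj a w (u v : a ~> x ⊗ w) : ltrans_of u = ltrans_of v -> u = v.
Proof. by move=> E; rewrite -[u]ltrans_ofK E ltrans_ofK. Qed.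

Definition lmate (a : C) (e : a ⊗ x ~> 𝟙) : a ~> d := lun d ∘ rtrans e.
Definition rmate (a : C) (e : d ⊗ a ~> 𝟙) : a ~> x := run x ∘ ltrans e.

Lemma lmateE a (u : a ~> d) : ev ∘ (u ⊠ id x) = rtrans_of (luni d ∘ u).
Proof.
rewrite /rtrans_of tl_comp -luni_tens -!compA (post2 (ascKi _ _ _)) comp_idl.
rewrite -lun1_run1 (post2 (luni_nat _)).
by rewrite -!compA (post2 (lunKi _)) comp_idl.
Qed.

Lemma rmateE a (u : a ~> x) : ev ∘ (id d ⊠ u) = ltrans_of (runi x ∘ u).
Proof.
rewrite /ltrans_of tr_comp -runi_tens -!compA (post2 (asciK _ _ _)) comp_idl.
rewrite lun1_run1 (post2 (runi_nat _)).
by rewrite -!compA (post2 (runKi _)) comp_idl.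
Qed.

Lemma lmateK a (e : a ⊗ x ~> 𝟙) : ev ∘ (lmate e ⊠ id x) = e.
Proof. by rewrite lmateE /lmate compA luniK comp_idl rtransK. Qed.

Lemma rmateK a (e : d ⊗ a ~> 𝟙) : ev ∘ (id d ⊠ rmate e) = e.
Proof. by rewrite rmateE /rmate compA runiK comp_idl ltransK. Qed.

Lemma lmate_inj a (u v : a ~> d) : ev ∘ (u ⊠ id x) = ev ∘ (v ⊠ id x) -> u = v.
Proof.
rewrite !lmateE => /rtrans_inj E.
by rewrite -[u]comp_idl -[v]comp_idl -(lunKi d) -!compA E.
Qed.

Lemma rmate_inj a (u v : a ~> x) : ev ∘ (id d ⊠ u) = ev ∘ (id d ⊠ v) -> u = v.
Proof.
rewrite !rmateE => /ltrans_inj E.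
by rewrite -[u]comp_idl -[v]comp_idl -(runKi x) -!compA E.
Qed.

End DualPair.
End Duality.

Section LeftDual.
Context {C : RigidCat}.
Implicit Types x y z : C.

Definition ldualm x y (f : x ~> y) : ldual y ~> ldual x :=
  lmate (lcoev x) (lev y ∘ (id (ldual y) ⊠ f)).

Lemma lev_inj a x (u v : a ~> ldual x) :
  lev x ∘ (u ⊠ id x) = lev x ∘ (v ⊠ id x) -> u = v.
Proof. exact: (lmate_inj (lzag x)). Qed.

Lemma lev_lmate a x (e : a ⊗ x ~> 𝟙) :
  lev x ∘ (lmate (lcoev x) e ⊠ id x) = e.
Proof. exact: (lmateK (lzig x)). Qed.

Lemma lev_ldualm x y (f : x ~> y) :
  lev x ∘ (ldualm f ⊠ id x) = lev y ∘ (id (ldual y) ⊠ f).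
Proof. exact: lev_lmate. Qed.

Lemma rev_inj a x (u v : a ~> rdual x) :
  rev x ∘ (id x ⊠ u) = rev x ∘ (id x ⊠ v) -> u = v.
Proof. exact: (rmate_inj (rzag x)). Qed.

Lemma rev_rmate a x (e : x ⊗ a ~> 𝟙) :
  rev x ∘ (id x ⊠ rmate (rcoev x) e) = e.
Proof. exact: (rmateK (rzig x)). Qed.

Lemma ldualm_id x : ldualm (id x) = id (ldual x).
Proof. by apply: lev_inj; rewrite lev_ldualm. Qed.

Lemma ldualm_comp x y z (g : y ~> z) (f : x ~> y) :
  ldualm (g ∘ f) = ldualm f ∘ ldualm g.
Proof.
apply: lev_inj; rewrite lev_ldualm tl_comp [RHS]compA lev_ldualm -[RHS]compA.
by rewrite trl -(tlr (ldualm g) f) [RHS]compA lev_ldualm -compA -tr_comp.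
Qed.

(** The comparison [^∨y ⊗ ^∨x ~> ^∨(x ⊗ y)] and its inverse, both obtained by
    exhibiting [^∨y ⊗ ^∨x] as a left dual of [x ⊗ y]. *)
Definition ldual_tens_ev x y : (ldual y ⊗ ldual x) ⊗ (x ⊗ y) ~> 𝟙 :=
  lev y ∘ (id (ldual y) ⊠ (lun y ∘ (lev x ⊠ id y) ∘ asci (ldual x) x y))
        ∘ asc (ldual y) (ldual x) (x ⊗ y).

Definition ldual_tens_coev x y : 𝟙 ~> (x ⊗ y) ⊗ (ldual y ⊗ ldual x) :=
  asci x y (ldual y ⊗ ldual x)
    ∘ (id x ⊠ (asc y (ldual y) (ldual x) ∘ (lcoev y ⊠ id (ldual x)) ∘ luni (ldual x)))
    ∘ lcoev x.

Definition ldual_tens_to x y : ldual y ⊗ ldual x ~> ldual (x ⊗ y) :=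
  lmate (lcoev (x ⊗ y)) (ldual_tens_ev x y).

Definition ldual_tens_from x y : ldual (x ⊗ y) ~> ldual y ⊗ ldual x :=
  ltrans_of (lev (x ⊗ y)) (ldual_tens_coev x y) ∘ runi (ldual (x ⊗ y)).

Definition ldual_unit_to : (𝟙 : C) ~> ldual 𝟙 := lun (ldual 𝟙) ∘ lcoev 𝟙.
Definition ldual_unit_from : ldual 𝟙 ~> (𝟙 : C) := lev 𝟙 ∘ runi (ldual 𝟙).

Definition dd2 x y :
    ldual (ldual (x ⊗ y)) ~> ldual (ldual x) ⊗ ldual (ldual y) :=
  ldual_tens_from (ldual y) (ldual x) ∘ ldualm (ldual_tens_to x y).

Definition dd0 : ldual (ldual 𝟙) ~> (𝟙 : C) :=
  ldual_unit_from ∘ ldualm ldual_unit_to.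

End LeftDual.

Definition DoubleDual (C : RigidCat) : Functor C C.
Proof.
refine {| fobj := fun x : C => ldual (ldual x) : C;
          fmap := fun x y f => ldualm (ldualm f) |}.
- by move=> x; rewrite !ldualm_id.
- by move=> x y z g f; rewrite !ldualm_comp.
Defined.

Record PivotalStructure (C : RigidCat) := {
  piv :> NatTrans (IdFunctor C) (DoubleDual C);
  piv_iso : forall x, IsIso (piv x);
  piv_tens : forall x y : C, dd2 x y ∘ piv (x ⊗ y) = piv x ⊠ piv y;
  piv_unit : dd0 ∘ piv 𝟙 = id 𝟙
}.

Record Monad (C : Category) := {
  mfun :> Functor C C;
  mu : forall x, mfun (mfun x) ~> mfun x;
  eta : forall x, x ~> mfun x;
  mu_nat : forall x y (f : x ~> y),
    mu y ∘ fmap mfun (fmap mfun f) = fmap mfun f ∘ mu x;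
  eta_nat : forall x y (f : x ~> y), eta y ∘ f = fmap mfun f ∘ eta x;
  mu_mu : forall x, mu x ∘ mu (mfun x) = mu x ∘ fmap mfun (mu x);
  mu_eta : forall x, mu x ∘ eta (mfun x) = id (mfun x);
  mu_fmap_eta : forall x, mu x ∘ fmap mfun (eta x) = id (mfun x)
}.
Arguments mu {_} _ _.
Arguments eta {_} _ _.

Record MonadMorphism (C : Category) (T G : Monad C) := {
  mor :> NatTrans T G;
  mor_mu : forall x, mor x ∘ mu T x = mu G x ∘ fmap G (mor x) ∘ mor (T x);
  mor_eta : forall x, mor x ∘ eta T x = eta G x
}.

Definition isomorphic_monads (C : Category) (T G : Monad C) : Prop :=
  exists f : MonadMorphism T G, forall x, inhabited (IsIso (f x)).

Record ModuleOn (C : Category) (T : Monad C) (x : C) := {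
  act :> T x ~> x;
  act_mu : act ∘ mu T x = act ∘ fmap T act;
  act_eta : act ∘ eta T x = id x
}.

Record EMObj (C : Category) (T : Monad C) := {
  em_obj : C;
  em_act : ModuleOn T em_obj
}.

Record EMHom (C : Category) (T : Monad C) (M N : EMObj T) := {
  em_map : em_obj M ~> em_obj N;
  em_lin : em_map ∘ em_act M = em_act N ∘ fmap T em_map
}.

Lemma EMHom_eq (C : Category) (T : Monad C) (M N : EMObj T) (f g : EMHom M N) :
  em_map f = em_map g -> f = g.
Proof.
case: f g => [f lf] [g lg] /= E; case: _ / E lg => lg.
by rewrite (proof_irrelevance _ lf lg).
Qed.

Definition EM_id (C : Category) (T : Monad C) (M : EMObj T) : EMHom M M.
Proof. by exists (id (em_obj M)); rewrite fmap_id comp_idl comp_idr. Defined.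

Definition EM_comp (C : Category) (T : Monad C) (M N P : EMObj T)
  (g : EMHom N P) (f : EMHom M N) : EMHom M P.
Proof.
exists (em_map g ∘ em_map f).
by rewrite fmap_comp -compA em_lin compA em_lin -compA.
Defined.

Definition EM (C : Category) (T : Monad C) : Category.
Proof.
refine {| Obj := EMObj T; Hom := @EMHom C T; id := @EM_id C T; comp := @EM_comp C T |}.
- by move=> M N f; apply: EMHom_eq; apply: comp_idl.
- by move=> M N f; apply: EMHom_eq; apply: comp_idr.
- by move=> M N P Q h g f; apply: EMHom_eq; apply: compA.
Defined.

Definition U (C : Category) (T : Monad C) : Functor (EM T) C :=
  {| fobj := fun M : EM T => em_obj M;
     fmap := fun (M N : EM T) (f : M ~> N) => em_map f;
     fmap_id := fun M => eq_refl;
     fmap_comp := fun M N P g f => eq_refl |}.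

Definition free_act (C : Category) (T : Monad C) (x : C) : ModuleOn T (T x) :=
  {| act := mu T x; act_mu := mu_mu T x; act_eta := mu_eta T x |}.

Definition free (C : Category) (T : Monad C) (x : C) : EM T :=
  {| em_obj := T x; em_act := free_act T x |} : EMObj T.

Definition freem (C : Category) (T : Monad C) (x y : C) (f : x ~> y) :
    free T x ~> free T y :=
  {| em_map := fmap T f : em_obj (free T x) ~> em_obj (free T y);
     em_lin := eq_sym (mu_nat T f) |} : EMHom (free T x) (free T y).

Definition F (C : Category) (T : Monad C) : Functor C (EM T).
Proof.
refine {| fobj := free T; fmap := @freem C T |}.
- by move=> x; apply: EMHom_eq; apply: fmap_id.
- by move=> x y z g f; apply: EMHom_eq; apply: fmap_comp.
Defined.

(** The counit of the adjunction between [F T] and [U T]; its unit is [eta T]. *)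
Definition counit (C : Category) (T : Monad C) (M : EM T) : F T (U T M) ~> M :=
  {| em_map := em_act M : em_obj (free T (em_obj M)) ~> em_obj M;
     em_lin := act_mu (em_act M) |} : EMHom (free T (em_obj M)) M.

Record Bimonad (C : MonCat) := {
  bmonad :> Monad C;
  comul : forall x y : C, bmonad (x ⊗ y) ~> bmonad x ⊗ bmonad y;
  couni : bmonad 𝟙 ~> (𝟙 : C);
  comul_nat : forall (x x' y y' : C) (f : x ~> x') (g : y ~> y'),
    comul x' y' ∘ fmap bmonad (f ⊠ g) = (fmap bmonad f ⊠ fmap bmonad g) ∘ comul x y;
  comulA : forall x y z : C,
    asc _ _ _ ∘ (comul x y ⊠ id (bmonad z)) ∘ comul (x ⊗ y) z
    = (id (bmonad x) ⊠ comul y z) ∘ comul x (y ⊗ z) ∘ fmap bmonad (asc x y z);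
  couni_l : forall x : C,
    lun (bmonad x) ∘ (couni ⊠ id (bmonad x)) ∘ comul 𝟙 x = fmap bmonad (lun x);
  couni_r : forall x : C,
    run (bmonad x) ∘ (id (bmonad x) ⊠ couni) ∘ comul x 𝟙 = fmap bmonad (run x);
  comul_mu : forall x y : C,
    comul x y ∘ mu bmonad (x ⊗ y)
    = (mu bmonad x ⊠ mu bmonad y) ∘ comul (bmonad x) (bmonad y) ∘ fmap bmonad (comul x y);
  couni_mu : couni ∘ mu bmonad 𝟙 = couni ∘ fmap bmonad couni;
  comul_eta : forall x y : C,
    comul x y ∘ eta bmonad (x ⊗ y) = eta bmonad x ⊠ eta bmonad y;
  couni_eta : couni ∘ eta bmonad 𝟙 = id 𝟙
}.
Arguments comul {_} _ _ _.
Arguments couni {_} _.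

Definition lfusion (C : MonCat) (H : Bimonad C) (x y : C) :
    H (H x ⊗ y) ~> H x ⊗ H y :=
  (mu H x ⊠ id (H y)) ∘ comul H (H x) y.

Definition rfusion (C : MonCat) (H : Bimonad C) (x y : C) :
    H (x ⊗ H y) ~> H x ⊗ H y :=
  (id (H x) ⊠ mu H y) ∘ comul H x (H y).

Record HopfMonad (C : MonCat) := {
  hbim :> Bimonad C;
  lfusion_iso : forall x y, IsIso (lfusion hbim x y);
  rfusion_iso : forall x y, IsIso (rfusion hbim x y)
}.

Record ComoduleMonad (C : MonCat) (B : Bimonad C) := {
  cmonad :> Monad C;
  coact : forall x y : C, cmonad (x ⊗ y) ~> cmonad x ⊗ B y;
  coact_nat : forall (x x' y y' : C) (f : x ~> x') (g : y ~> y'),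
    coact x' y' ∘ fmap cmonad (f ⊠ g) = (fmap cmonad f ⊠ fmap B g) ∘ coact x y;
  coactA : forall x y z : C,
    asc _ _ _ ∘ (coact x y ⊠ id (B z)) ∘ coact (x ⊗ y) z
    = (id (cmonad x) ⊠ comul B y z) ∘ coact x (y ⊗ z) ∘ fmap cmonad (asc x y z);
  coact_couni : forall x : C,
    run (cmonad x) ∘ (id (cmonad x) ⊠ couni B) ∘ coact x 𝟙 = fmap cmonad (run x);
  coact_mu : forall x y : C,
    coact x y ∘ mu cmonad (x ⊗ y)
    = (mu cmonad x ⊠ mu B y) ∘ coact (cmonad x) (B y) ∘ fmap cmonad (coact x y);
  coact_eta : forall x y : C,
    coact x y ∘ eta cmonad (x ⊗ y) = eta cmonad x ⊠ eta B y
}.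
Arguments coact {_ _} _ _ _.

Definition regular_comodule (C : MonCat) (B : Bimonad C) : ComoduleMonad B :=
  {| cmonad := B; coact := comul B; coact_nat := @comul_nat C B;
     coactA := comulA B; coact_couni := couni_r B; coact_mu := comul_mu B;
     coact_eta := comul_eta B |}.

Record ComoduleMonadMorphism (C : MonCat) (B : Bimonad C) (T G : ComoduleMonad B) := {
  cmor :> MonadMorphism T G;
  cmor_coact : forall x y : C,
    coact G x y ∘ cmor (x ⊗ y) = (cmor x ⊠ id (B y)) ∘ coact T x y
}.

Definition isomorphic_comodule_monads (C : MonCat) (B : Bimonad C)
    (T G : ComoduleMonad B) : Prop :=
  exists f : ComoduleMonadMorphism T G, forall x, inhabited (IsIso (f x)).

(** Functors [A^op × A → D]. *)
Record DiFunctor (A D : Category) := {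
  dobj : A -> A -> D;
  dmap : forall x x' y y' : A, x' ~> x -> y ~> y' -> dobj x y ~> dobj x' y';
  dmap_id : forall x y, dmap (id x) (id y) = id (dobj x y);
  dmap_comp : forall x x' x'' y y' y'' (f : x' ~> x) (f' : x'' ~> x')
      (g' : y' ~> y'') (g : y ~> y'),
    dmap (f ∘ f') (g' ∘ g) = dmap f' g' ∘ dmap f g
}.
Arguments dmap {_ _} _ {_ _ _ _} _ _.

Definition is_cowedge (A D : Category) (P : DiFunctor A D) (z : D)
    (i : forall y, dobj P y y ~> z) :=
  forall y y' (f : y ~> y'), i y ∘ dmap P f (id y) = i y' ∘ dmap P (id y') f.

Record IsCoend (A D : Category) (P : DiFunctor A D) (z : D)
    (i : forall y, dobj P y y ~> z) : Prop := {
  coend_cowedge : is_cowedge i;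
  coend_univ : forall (w : D) (j : forall y, dobj P y y ~> w), is_cowedge j ->
    exists! u : z ~> w, forall y, u ∘ i y = j y
}.

Section Centralisers.
Variables (A : RigidCat) (T : Functor A A).

Definition integrand (x : A) : DiFunctor A A.
Proof.
refine {| dobj := fun y y' : A => ldual (T y) ⊗ (x ⊗ y') : A;
          dmap := fun _ _ _ _ f g => ldualm (fmap T f) ⊠ (id x ⊠ g) |}.
- by move=> y y'; rewrite fmap_id ldualm_id !tensm_id.
- by move=> *; rewrite fmap_comp ldualm_comp tr_comp tensm_comp.
Defined.

Definition centralisable : Prop :=
  forall x : A, exists (z : A) (i : forall y, dobj (integrand x) y y ~> z), IsCoend i.

(** [Centraliser Z] : the functor [Z] is the centraliser [Z_T] of [T]. *)
Record Centraliser (Z : Functor A A) := {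
  cstr : forall x y : A, ldual (T y) ⊗ (x ⊗ y) ~> Z x;
  cstr_coend : forall x : A, @IsCoend A A (integrand x) (Z x) (cstr x);
  cstr_nat : forall (x x' y : A) (f : x ~> x'),
    fmap Z f ∘ cstr x y = cstr x' y ∘ (id (ldual (T y)) ⊠ (f ⊠ id y))
}.

(** The universal coaction: the transpose of the structure map of the coend. *)
Definition ucoact (Z : Functor A A) (c : Centraliser Z) (x y : A) :
    x ⊗ y ~> T y ⊗ Z x :=
  ltrans (lcoev (T y)) (cstr c x y).

(** The unit and multiplication of [Z_T], for [T] oplax monoidal through
    [T2] and [T0]. *)
Definition centraliser_unit (T0 : T 𝟙 ~> (𝟙 : A)) (Z : Monad A) (c : Centraliser Z) :=
  forall x : A,
    eta Z x = lun (Z x) ∘ (T0 ⊠ id (Z x)) ∘ ucoact c x 𝟙 ∘ runi x.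

Definition centraliser_mult (T2 : forall y z : A, T (y ⊗ z) ~> T y ⊗ T z)
    (Z : Monad A) (c : Centraliser Z) :=
  forall x y z : A,
    (id (T y) ⊠ (id (T z) ⊠ mu Z x)) ∘ (id (T y) ⊠ ucoact c (Z x) z)
      ∘ asc (T y) (Z x) z ∘ (ucoact c x y ⊠ id z)
    = asc (T y) (T z) (Z x) ∘ (T2 y z ⊠ id (Z x)) ∘ ucoact c x (y ⊗ z) ∘ asc x y z.

End Centralisers.

(** The bimonad structure is pinned down by the universal coaction
    [χ x y : x ⊗ y ~> y ⊗ D x]. *)
Record DrinfeldBimonad (A : RigidCat) := {
  dbim :> Bimonad A;
  dcent : Centraliser (IdFunctor A) dbim;
  dcent_unit : @centraliser_unit A (IdFunctor A) (id 𝟙) dbim dcent;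
  dcent_mult : @centraliser_mult A (IdFunctor A) (fun y z => id (y ⊗ z)) dbim dcent;
  dcent_comul : forall x y z : A,
    (id z ⊠ comul dbim x y) ∘ ucoact dcent (x ⊗ y) z
    = asc z (dbim x) (dbim y) ∘ (ucoact dcent x z ⊠ id (dbim y))
        ∘ asci x z (dbim y) ∘ (id x ⊠ ucoact dcent y z) ∘ asc x y z;
  dcent_couni : forall z : A,
    run z ∘ (id z ⊠ couni dbim) ∘ ucoact dcent 𝟙 z ∘ luni z = id z
}.

(** The comodule monad structure is pinned down by the universal coaction
    [ξ x y : x ⊗ y ~> ^∨∨y ⊗ Q x]. *)
Record AntiDrinfeldMonad (A : RigidCat) (D : DrinfeldBimonad A) := {
  qcom :> ComoduleMonad D;
  qcent : Centraliser (DoubleDual A) qcom;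
  qcent_unit : @centraliser_unit A (DoubleDual A) dd0 qcom qcent;
  qcent_mult : @centraliser_mult A (DoubleDual A) dd2 qcom qcent;
  qcent_coact : forall x y z : A,
    (id (DoubleDual A z) ⊠ coact qcom x y) ∘ ucoact qcent (x ⊗ y) z
    = asc (DoubleDual A z) (qcom x) (D y) ∘ (ucoact qcent x z ⊠ id (D y))
        ∘ asci x z (D y) ∘ (id x ⊠ ucoact (dcent D) y z) ∘ asc x y z
}.

Section EMMonoidal.
Variables (C : MonCat) (H : Bimonad C).
Implicit Types M N P : EMObj H.

Definition EM_tens_act M N : ModuleOn H (em_obj M ⊗ em_obj N).
Proof.
exists ((em_act M ⊠ em_act N) ∘ comul H (em_obj M) (em_obj N)).
- rewrite -compA comul_mu !fmap_comp -!compA (post2 (comul_nat _ _ _)).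
  by rewrite !compA -!tensm_comp !act_mu.
- by rewrite -compA comul_eta -tensm_comp !act_eta tensm_id.
Defined.

Definition EM_tens M N : EMObj H := {| em_act := EM_tens_act M N |}.

Definition EM_unit_act : ModuleOn H 𝟙 :=
  {| act := couni H; act_mu := couni_mu H; act_eta := couni_eta H |}.

Definition EM_unit : EMObj H := {| em_act := EM_unit_act |}.

Definition EM_tensm M M' N N' (f : EMHom M M') (g : EMHom N N') :
  EMHom (EM_tens M N) (EM_tens M' N').
Proof.
exists (em_map f ⊠ em_map g).
by rewrite /= compA -tensm_comp !em_lin tensm_comp -!compA comul_nat.
Defined.

Lemma inverse_linear M N (f : em_obj M ~> em_obj N) (g : em_obj N ~> em_obj M) :
  g ∘ f = id _ -> f ∘ g = id _ ->
  f ∘ em_act M = em_act N ∘ fmap H f -> g ∘ em_act N = em_act M ∘ fmap H g.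
Proof.
move=> gf fg E.
by rewrite -[em_act N : _ ~> _]comp_idr -fmap_id -fg fmap_comp !compA
  -(compA g) -E compA gf comp_idl.
Qed.

Definition EM_asc M N P :
  EMHom (EM_tens (EM_tens M N) P) (EM_tens M (EM_tens N P)).
Proof.
exists (asc _ _ _).
rewrite /= -[em_act P : _ ~> _]comp_idr tensm_comp !compA asc_nat.
rewrite -[(em_act M : _ ~> _) in RHS]comp_idr tensm_comp -!compA.
by rewrite comp_idr; congr (_ ∘ _); rewrite !compA comulA.
Defined.

Definition EM_asci M N P :
  EMHom (EM_tens M (EM_tens N P)) (EM_tens (EM_tens M N) P).
Proof.
exists (asci _ _ _).
exact: (@inverse_linear (EM_tens (EM_tens M N) P) (EM_tens M (EM_tens N P)) _ _
         (asciK _ _ _) (ascKi _ _ _) (em_lin (EM_asc M N P))).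
Defined.

Definition EM_lun M : EMHom (EM_tens EM_unit M) M.
Proof.
exists (lun _); rewrite /= -trl -couni_l !compA; congr (_ ∘ _).
by rewrite -!compA !(post2 (lun_nat _)) !compA.
Defined.

Definition EM_luni M : EMHom M (EM_tens EM_unit M).
Proof.
exists (luni _).
exact: (@inverse_linear (EM_tens EM_unit M) M _ _
         (luniK _) (lunKi _) (em_lin (EM_lun M))).
Defined.

Definition EM_run M : EMHom (EM_tens M EM_unit) M.
Proof.
exists (run _); rewrite /= -tlr -couni_r !compA; congr (_ ∘ _).
by rewrite -!compA !(post2 (run_nat _)) !compA.
Defined.

Definition EM_runi M : EMHom M (EM_tens M EM_unit).
Proof.
exists (runi _).
exact: (@inverse_linear (EM_tens M EM_unit) M _ _
         (runiK _) (runKi _) (em_lin (EM_run M))).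
Defined.

Definition EM_mon : MonCat.
Proof.
refine {| mcat := EM H; tens := EM_tens; munit := EM_unit; tensm := EM_tensm;
          asc := EM_asc; asci := EM_asci; lun := EM_lun; luni := EM_luni;
          run := EM_run; runi := EM_runi |}; move=> *; apply: EMHom_eq.
- exact: tensm_id.
- exact: tensm_comp.
- exact: asciK.
- exact: ascKi.
- exact: asc_nat.
- exact: luniK.
- exact: lunKi.
- exact: lun_nat.
- exact: runiK.
- exact: runKi.
- exact: run_nat.
- exact: pentagon.
- exact: triangle.
Defined.

End EMMonoidal.

Section EMRigid.
Variables (C : RigidCat) (H : HopfMonad C).
Implicit Types M N : EMObj H.

Definition rfus (y : C) M : H (y ⊗ em_obj M) ~> H y ⊗ em_obj M :=
  (id (H y) ⊠ em_act M) ∘ comul H y (em_obj M).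

Definition rfus_inv (y : C) M : H y ⊗ em_obj M ~> H (y ⊗ em_obj M) :=
  fmap H (id y ⊠ em_act M) ∘ iso_inv (rfusion_iso H y (em_obj M))
    ∘ (id (H y) ⊠ eta H (em_obj M)).

Definition lfus M (y : C) : H (em_obj M ⊗ y) ~> em_obj M ⊗ H y :=
  (em_act M ⊠ id (H y)) ∘ comul H (em_obj M) y.

Definition lfus_inv M (y : C) : em_obj M ⊗ H y ~> H (em_obj M ⊗ y) :=
  fmap H (em_act M ⊠ id y) ∘ iso_inv (lfusion_iso H (em_obj M) y)
    ∘ (eta H (em_obj M) ⊠ id (H y)).

Lemma rfus_nat (y y' : C) M N (f : y ~> y') (g : EMHom M N) :
  rfus y' N ∘ fmap H (f ⊠ em_map g) = (fmap H f ⊠ em_map g) ∘ rfus y M.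
Proof.
rewrite /rfus -!compA comul_nat !compA -!tensm_comp -em_lin.
by rewrite comp_idl comp_idr.
Qed.

Lemma lfus_nat (y y' : C) M N (f : y ~> y') (g : EMHom M N) :
  lfus N y' ∘ fmap H (em_map g ⊠ f) = (em_map g ⊠ fmap H f) ∘ lfus M y.
Proof.
rewrite /lfus -!compA comul_nat !compA -!tensm_comp -em_lin.
by rewrite comp_idl comp_idr.
Qed.

Lemma rfus_act (y : C) M :
  rfus y M ∘ fmap H (id y ⊠ em_act M) = (id _ ⊠ em_act M) ∘ rfusion H y (em_obj M).
Proof. by have := rfus_nat (id y) (counit (M : EM H)); rewrite fmap_id. Qed.

Lemma lfus_act (y : C) M :
  lfus M y ∘ fmap H (em_act M ⊠ id y) = (em_act M ⊠ id _) ∘ lfusion H (em_obj M) y.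
Proof. by have := lfus_nat (id y) (counit (M : EM H)); rewrite fmap_id. Qed.

Lemma rfusion_fmap (y x x' : C) (f : x ~> x') :
  rfusion H y x' ∘ fmap H (id y ⊠ fmap H f)
  = (id _ ⊠ fmap H f) ∘ rfusion H y x.
Proof. by have := rfus_nat (id y) (freem H f); rewrite fmap_id. Qed.

Lemma rfusion_mu (y x : C) :
  rfusion H y x ∘ fmap H (id y ⊠ mu H x) = (id _ ⊠ mu H x) ∘ rfusion H y (H x).
Proof. exact: (rfus_act y (F H x)). Qed.

Lemma lfusion_fmap (y x x' : C) (f : x ~> x') :
  lfusion H x' y ∘ fmap H (fmap H f ⊠ id y)
  = (fmap H f ⊠ id _) ∘ lfusion H x y.
Proof. by have := lfus_nat (id y) (freem H f); rewrite fmap_id. Qed.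

Lemma lfusion_mu (y x : C) :
  lfusion H x y ∘ fmap H (mu H x ⊠ id y) = (mu H x ⊠ id _) ∘ lfusion H (H x) y.
Proof. exact: (lfus_act y (F H x)). Qed.

Lemma rfus_mu (y : C) M :
  rfus y M ∘ mu H _ = (mu H y ⊠ id _) ∘ rfus (H y) M ∘ fmap H (rfus y M).
Proof.
rewrite /rfus -!compA comul_mu fmap_comp -!compA (post2 (comul_nat _ _ _)).
by rewrite !compA -!tensm_comp fmap_id !comp_idl ?comp_idr act_mu.
Qed.

Lemma lfus_mu (y : C) M :
  lfus M y ∘ mu H _ = (id _ ⊠ mu H y) ∘ lfus M (H y) ∘ fmap H (lfus M y).
Proof.
rewrite /lfus -!compA comul_mu fmap_comp -!compA (post2 (comul_nat _ _ _)).
by rewrite !compA -!tensm_comp fmap_id !comp_idl ?comp_idr act_mu.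
Qed.

Lemma rfus_eta (y : C) M : rfus y M ∘ eta H _ = eta H y ⊠ id _.
Proof. by rewrite /rfus -compA comul_eta -tensm_comp comp_idl act_eta. Qed.

Lemma lfus_eta (y : C) M : lfus M y ∘ eta H _ = id _ ⊠ eta H y.
Proof. by rewrite /lfus -compA comul_eta -tensm_comp comp_idl act_eta. Qed.

Lemma split_epi (B : Category) (x y z : B) (p : x ~> y) (s : y ~> x) (f g : y ~> z) :
  p ∘ s = id y -> f ∘ p = g ∘ p -> f = g.
Proof. by move=> ps E; rewrite -[f]comp_idr -[g]comp_idr -ps !compA E. Qed.

Lemma split_mono (B : Category) (x y z : B) (p : x ~> y) (s : y ~> x) (f g : z ~> x) :
  s ∘ p = id x -> p ∘ f = p ∘ g -> f = g.
Proof. by move=> sp E; rewrite -[f]comp_idl -[g]comp_idl -sp -!compA E. Qed.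

Lemma iso_of_fork (B : Category) (a0 a1 a2 b0 b1 b2 : B)
    (r0 : a0 ~> b0) (r1 : a1 ~> b1) (r2 : a2 ~> b2) (i1 : b1 ~> a1) (i2 : b2 ~> a2)
    (p : a1 ~> a0) (P Ma : a2 ~> a1) (q : b1 ~> b0) (Q Mb : b2 ~> b1)
    (s : a0 ~> a1) (e : b0 ~> b1) (E : b1 ~> b2) :
  i1 ∘ r1 = id _ -> r1 ∘ i1 = id _ -> r2 ∘ i2 = id _ ->
  p ∘ s = id _ -> q ∘ e = id _ -> r0 ∘ p = q ∘ r1 ->
  r1 ∘ P = Q ∘ r2 -> r1 ∘ Ma = Mb ∘ r2 -> p ∘ P = p ∘ Ma -> e ∘ q = Q ∘ E ->
  Mb ∘ E = id _ ->
  (p ∘ i1 ∘ e) ∘ r0 = id _ /\ r0 ∘ (p ∘ i1 ∘ e) = id _.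
Proof.
move=> ir ri ri2 ps qe rp rP rM pP eq ME; split.
- have iQ : i1 ∘ Q = P ∘ i2.
    apply: (split_mono ir); rewrite !compA ri comp_idl.
    by rewrite rP -compA ri2 comp_idr.
  have iM : i1 ∘ Mb = Ma ∘ i2.
    apply: (split_mono ir); rewrite !compA ri comp_idl.
    by rewrite rM -compA ri2 comp_idr.
  apply: (split_epi ps); rewrite -!compA rp (post2 eq) -!compA (post2 iQ) -!compA.
  by rewrite (post2 pP) -!compA (post2 (esym iM)) -!compA (post2 ME) comp_idl ir comp_idl comp_idr.
- by rewrite -!compA (post2 rp) -!compA (post2 ri) comp_idl qe.
Qed.

Lemma rfus_iso (y : C) M :
  rfus_inv y M ∘ rfus y M = id _ /\ rfus y M ∘ rfus_inv y M = id _.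
Proof.
apply: (iso_of_fork (s := fmap H (id y ⊠ eta H _)) (E := id _ ⊠ eta H _)
          (iso_invK _) (iso_Kinv _) (iso_Kinv (rfusion_iso H y _))
          _ _ (rfus_act y M) (rfusion_fmap _ _) (rfusion_mu _ _)).
- by rewrite -fmap_comp -tr_comp act_eta tensm_id fmap_id.
- by rewrite -tr_comp act_eta tensm_id.
- by rewrite -!fmap_comp -!tr_comp act_mu.
- by rewrite -!tr_comp -eta_nat.
- by rewrite -tr_comp mu_eta tensm_id.
Qed.

Lemma lfus_iso (y : C) M :
  lfus_inv M y ∘ lfus M y = id _ /\ lfus M y ∘ lfus_inv M y = id _.
Proof.
apply: (iso_of_fork (s := fmap H (eta H _ ⊠ id y)) (E := eta H _ ⊠ id _)
          (iso_invK _) (iso_Kinv _) (iso_Kinv (lfusion_iso H _ y))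
          _ _ (lfus_act y M) (lfusion_fmap _ _) (lfusion_mu _ _)).
- by rewrite -fmap_comp -tl_comp act_eta tensm_id fmap_id.
- by rewrite -tl_comp act_eta tensm_id.
- by rewrite -!fmap_comp -!tl_comp act_mu.
- by rewrite -!tl_comp -eta_nat.
- by rewrite -tl_comp mu_eta tensm_id.
Qed.

Definition rfusK y M := proj1 (rfus_iso y M).
Definition rfus_invK y M := proj2 (rfus_iso y M).
Definition lfusK y M := proj1 (lfus_iso y M).
Definition lfus_invK y M := proj2 (lfus_iso y M).

(** The action on [^∨x] is the only one for which the evaluation is linear. *)
Definition ldual_map M : H (ldual (em_obj M)) ~> ldual (em_obj M) :=
  lmate (lcoev (em_obj M))
    (couni H ∘ fmap H (lev (em_obj M)) ∘ rfus_inv (ldual (em_obj M)) M).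

Lemma ldual_map_lin M :
  lev (em_obj M) ∘ (ldual_map M ⊠ id _) ∘ rfus (ldual (em_obj M)) M
  = couni H ∘ fmap H (lev (em_obj M)).
Proof. by rewrite lev_lmate -compA rfusK comp_idr. Qed.

Definition ldual_act M : ModuleOn H (ldual (em_obj M)).
Proof.
exists (ldual_map M); apply: lev_inj; set m := em_obj M; set d := ldual m.
- have L := ldual_map_lin M; have X := rfus_mu d M.
  have N := rfus_nat (ldual_map M) (EM_id M); rewrite /= in N.
  apply: (split_epi (rfus_invK (H _) M)).
  apply: (@split_epi _ _ _ _ (fmap H (rfus d M)) (fmap H (rfus_inv d M)));
    first by rewrite -fmap_comp rfus_invK fmap_id.
  rewrite -/m -/d in L X N *.
  move: (rfus d M) (rfus (H d) M) L X N => r R L X N.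
  transitivity (lev m ∘ (ldual_map M ⊠ id m) ∘ ((mu H d ⊠ id m) ∘ R ∘ fmap H r)).
    by rewrite tl_comp !compA.
  transitivity (lev m ∘ (ldual_map M ⊠ id m) ∘ ((fmap H (ldual_map M) ⊠ id m) ∘ R)
                ∘ fmap H r); last by rewrite [in RHS]tl_comp !compA.
  rewrite -X -N !compA L -!compA -!fmap_comp.
  rewrite [in RHS](compA (lev m)) L -mu_nat fmap_comp !compA.
  by rewrite couni_mu.
- have L := ldual_map_lin M; have X := rfus_eta d M.
  rewrite -/m -/d in L X *; move: (rfus d M) L X => r L X.
  rewrite tensm_id comp_idr tl_comp -X !compA L -compA -eta_nat compA couni_eta.
  by rewrite comp_idl.
Defined.

Definition EM_ldual M : EMObj H := {| em_act := ldual_act M |}.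

Definition EM_lev M : EMHom (EM_tens (EM_ldual M) M) (EM_unit H).
Proof.
exists (lev (em_obj M)).
by rewrite /= -(tlr (ldual_map M)) !compA -(compA _ _ (comul _ _ _)) ldual_map_lin.
Defined.

Definition EM_lcoev M : EMHom (EM_unit H) (EM_tens M (EM_ldual M)).
Proof.
exists (lcoev (em_obj M)).
apply: (rtrans_inj (lzag (em_obj M))); apply: (split_epi (rfus_invK 𝟙 M)).
have Z : run (em_obj M) ∘ (id (em_obj M) ⊠ lev (em_obj M))
          ∘ asc _ _ _ ∘ (lcoev (em_obj M) ⊠ id _) = lun (em_obj M).
  by rewrite -[LHS]comp_idr -(luniK (em_obj M)) !compA lzig comp_idl.
have L := em_lin (EM_lev M); rewrite /= in L.
rewrite /rtrans_of /rfus /=; set m := em_obj M in Z L *.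
move: (ldual_map M) L => k L.
transitivity (em_act M ∘ fmap H (lun m)).
- rewrite tl_comp !compA Z -couni_l -!compA; rewrite (post2 (tlr _ _)).
  by rewrite -(trl (couni H)) -!compA (post2 (lun_nat _)) -!compA.
- rewrite -Z !fmap_comp -couni_r.
  have E1 : (((em_act M ⊠ k) ∘ comul H m (ldual m) ∘ fmap H (lcoev m)) ⊠ id m)
      ∘ ((id (H 𝟙) ⊠ em_act M) ∘ comul H 𝟙 m)
    = ((em_act M ⊠ k) ⊠ em_act M) ∘ ((comul H m (ldual m) ⊠ id (H m))
        ∘ comul H (m ⊗ ldual m) m) ∘ fmap H (lcoev m ⊠ id m).
    rewrite -!compA comul_nat fmap_id !compA -!tensm_comp.
    by rewrite !comp_idl !comp_idr.
  have E2 : (id m ⊠ lev m) ∘ (em_act M ⊠ (k ⊠ em_act M)) ∘ (id (H m) ⊠ comul H _ _)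
    = (em_act M ⊠ id 𝟙) ∘ (id (H m) ⊠ couni H) ∘ (id (H m) ⊠ fmap H (lev m)).
    by rewrite -!tensm_comp !comp_idl ?comp_idr -L !compA.
  have E3 : (id (H m) ⊠ fmap H (lev m)) ∘ comul H m (ldual m ⊗ m)
    = comul H m 𝟙 ∘ fmap H (id m ⊠ lev m).
    by rewrite comul_nat fmap_id.
  rewrite -[RHS]compA E1 -!compA (post2 (asc_nat _ _ _)) -!compA.
  rewrite (post3 (etrans (compA _ _ _) (comulA H _ _ _))) -!compA.
  rewrite (post3 (etrans (compA _ _ _) E2)) -!compA (post2 E3) -!compA.
  by rewrite (post2 (run_nat _)) -!compA.
Defined.

Definition rdual_map M : H (rdual (em_obj M)) ~> rdual (em_obj M) :=
  rmate (rcoev (em_obj M))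
    (couni H ∘ fmap H (rev (em_obj M)) ∘ lfus_inv M (rdual (em_obj M))).

Lemma rdual_map_lin M :
  rev (em_obj M) ∘ (id _ ⊠ rdual_map M) ∘ lfus M (rdual (em_obj M))
  = couni H ∘ fmap H (rev (em_obj M)).
Proof. by rewrite rev_rmate -compA lfusK comp_idr. Qed.

Definition rdual_act M : ModuleOn H (rdual (em_obj M)).
Proof.
exists (rdual_map M); apply: rev_inj; set m := em_obj M; set d := rdual m.
- have L := rdual_map_lin M; have X := lfus_mu d M.
  have N := lfus_nat (rdual_map M) (EM_id M); rewrite /= in N.
  apply: (split_epi (lfus_invK (H _) M)).
  apply: (@split_epi _ _ _ _ (fmap H (lfus M d)) (fmap H (lfus_inv M d)));
    first by rewrite -fmap_comp lfus_invK fmap_id.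
  rewrite -/m -/d in L X N *.
  move: (lfus M d) (lfus M (H d)) L X N => r R L X N.
  transitivity (rev m ∘ (id m ⊠ rdual_map M) ∘ ((id m ⊠ mu H d) ∘ R ∘ fmap H r)).
    by rewrite tr_comp !compA.
  transitivity (rev m ∘ (id m ⊠ rdual_map M) ∘ ((id m ⊠ fmap H (rdual_map M)) ∘ R)
                ∘ fmap H r); last by rewrite [in RHS]tr_comp !compA.
  rewrite -X -N !compA L -!compA -!fmap_comp.
  rewrite [in RHS](compA (rev m)) L -mu_nat fmap_comp !compA.
  by rewrite couni_mu.
- have L := rdual_map_lin M; have X := lfus_eta d M.
  rewrite -/m -/d in L X *; move: (lfus M d) L X => r L X.
  rewrite tensm_id comp_idr tr_comp -X !compA L -compA -eta_nat compA couni_eta.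
  by rewrite comp_idl.
Defined.

Definition EM_rdual M : EMObj H := {| em_act := rdual_act M |}.

Definition EM_rev M : EMHom (EM_tens M (EM_rdual M)) (EM_unit H).
Proof.
exists (rev (em_obj M)).
by rewrite /= -(trl _ (rdual_map M)) !compA -(compA _ _ (comul _ _ _)) rdual_map_lin.
Defined.

Lemma comulA_inv (x y z : C) :
  asci _ _ _ ∘ (id (H x) ⊠ comul H y z) ∘ comul H x (y ⊗ z)
  = (comul H x y ⊠ id (H z)) ∘ comul H (x ⊗ y) z ∘ fmap H (asci x y z).
Proof.
rewrite -[LHS]comp_idr -(fmap_id H (x ⊗ (y ⊗ z))) -(ascKi x y z) fmap_comp -!compA.
have := comulA H x y z; rewrite -!compA => E.
rewrite (post3 (esym E)) -!compA.
by rewrite (post2 (asciK _ _ _)) comp_idl.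
Qed.

Definition EM_rcoev M : EMHom (EM_unit H) (EM_tens (EM_rdual M) M).
Proof.
exists (rcoev (em_obj M)).
apply: (ltrans_inj (rzag (em_obj M))); apply: (split_epi (lfus_invK 𝟙 M)).
have Z : lun (em_obj M) ∘ (rev (em_obj M) ⊠ id (em_obj M))
          ∘ asci _ _ _ ∘ (id _ ⊠ rcoev (em_obj M)) = run (em_obj M).
  by rewrite -[LHS]comp_idr -(runiK (em_obj M)) !compA rzig comp_idl.
have L := em_lin (EM_rev M); rewrite /= in L.
rewrite /ltrans_of /lfus /=; set m := em_obj M in Z L *.
move: (rdual_map M) L => k L.
transitivity (em_act M ∘ fmap H (run m)).
- rewrite tr_comp !compA Z -couni_r -!compA; rewrite (post2 (trl _ _)).
  by rewrite -(tlr _ (couni H)) -!compA (post2 (run_nat _)) -!compA.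
- rewrite -Z !fmap_comp -couni_l.
  have E1 : (id m ⊠ ((k ⊠ em_act M) ∘ comul H (rdual m) m ∘ fmap H (rcoev m)))
      ∘ ((em_act M ⊠ id (H 𝟙)) ∘ comul H m 𝟙)
    = (em_act M ⊠ (k ⊠ em_act M)) ∘ ((id (H m) ⊠ comul H (rdual m) m)
        ∘ comul H m (rdual m ⊗ m)) ∘ fmap H (id m ⊠ rcoev m).
    rewrite -!compA comul_nat fmap_id !compA -!tensm_comp.
    by rewrite !comp_idl !comp_idr.
  have E2 : (rev m ⊠ id m) ∘ ((em_act M ⊠ k) ⊠ em_act M) ∘ (comul H _ _ ⊠ id (H m))
    = (id 𝟙 ⊠ em_act M) ∘ (couni H ⊠ id (H m)) ∘ (fmap H (rev m) ⊠ id (H m)).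
    by rewrite -!tensm_comp !comp_idl ?comp_idr -L !compA.
  have E3 : (fmap H (rev m) ⊠ id (H m)) ∘ comul H (m ⊗ rdual m) m
    = comul H 𝟙 m ∘ fmap H (rev m ⊠ id m).
    by rewrite comul_nat fmap_id.
  rewrite -[RHS]compA E1 -!compA (post2 (asci_nat _ _ _)) -!compA.
  rewrite (post3 (etrans (compA _ _ _) (comulA_inv _ _ _))) -!compA.
  rewrite (post3 (etrans (compA _ _ _) E2)) -!compA (post2 E3) -!compA.
  by rewrite (post2 (lun_nat _)) -!compA.
Defined.

Definition EM_rig : RigidCat.
Proof.
refine {| rmon := EM_mon H; ldual := EM_ldual; lev := EM_lev; lcoev := EM_lcoev;
          rdual := EM_rdual; rev := EM_rev; rcoev := EM_rcoev |};
  move=> M; apply: EMHom_eq.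
- exact: lzig.
- exact: lzag.
- exact: rzig.
- exact: rzag.
Defined.

End EMRigid.

Canonical EM_mon.
Canonical EM_rig.

Section PushMonad.
Variables (C : Category) (H : Monad C) (T : Monad (EM H)).

Lemma counit_nat (M N : EM H) (f : M ~> N) :
  counit N ∘ fmap (F H) (fmap (U H) f) = f ∘ counit M.
Proof. apply: EMHom_eq; exact: (esym (em_lin f)). Qed.

Lemma counit_free (x : C) : counit (F H x) ∘ fmap (F H) (eta H x) = id _.
Proof. apply: EMHom_eq; exact: mu_fmap_eta. Qed.

Definition push_functor : Functor C C :=
  CompFunctor (U H) (CompFunctor T (F H)).

Definition push_mu (x : C) : T (F H (U H (T (F H x)))) ~> T (F H x) :=
  mu T (F H x) ∘ fmap T (counit (T (F H x))).

Lemma push_mu_nat (M : EM H) (x : C) (f : M ~> T (F H x)) :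
  push_mu x ∘ fmap T (fmap (F H) (fmap (U H) f)) = mu T (F H x) ∘ fmap T (f ∘ counit M).
Proof. by rewrite /push_mu -!compA -fmap_comp counit_nat. Qed.

Definition push_monad : Monad C.
Proof.
refine {| mfun := push_functor;
          mu := fun x => fmap (U H) (push_mu x);
          eta := fun x => fmap (U H) (eta T (F H x)) ∘ eta H x |}.
- move=> x y f; apply: (f_equal (fmap (U H)) (_ : push_mu y ∘ fmap T (fmap (F H)
    (fmap (U H) (fmap T (fmap (F H) f)))) = fmap T (fmap (F H) f) ∘ push_mu x)).
  by rewrite push_mu_nat fmap_comp compA mu_nat /push_mu compA.
- move=> x y f; rewrite -!compA eta_nat !compA; congr (_ ∘ _).
  apply: (f_equal (fmap (U H)) (_ : eta T (F H y) ∘ fmap (F H) f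
    = fmap T (fmap (F H) f) ∘ eta T (F H x))).
  by rewrite eta_nat.
- move=> x; apply: (f_equal (fmap (U H)) (_ : push_mu x ∘ push_mu (push_functor x)
    = push_mu x ∘ fmap T (fmap (F H) (fmap (U H) (push_mu x))))).
  rewrite push_mu_nat {1}/push_mu -compA [fmap T _ ∘ _]compA -mu_nat -compA.
  by rewrite !fmap_comp !compA mu_mu.
- move=> x; rewrite compA.
  have -> : fmap (U H) (push_mu x) ∘ fmap (U H) (eta T (F H (push_functor x)))
    = fmap (U H) (counit (T (F H x))).
    apply: (f_equal (fmap (U H)) (_ : push_mu x ∘ eta T (F H (push_functor x)) = _)).
    by rewrite /push_mu -compA -eta_nat compA mu_eta comp_idl.
  exact: (act_eta (em_act (T (F H x)))).
- move=> x; apply: (f_equal (fmap (U H)) (_ : push_mu x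
    ∘ fmap T (fmap (F H) (fmap (U H) (eta T (F H x)) ∘ eta H x)) = id _)).
  rewrite !fmap_comp compA push_mu_nat -compA -fmap_comp -compA counit_free comp_idr.
  by rewrite mu_fmap_eta.
Defined.

End PushMonad.

Section PushComodule.
Variables (C : MonCat) (H : Bimonad C).

Definition F2 (x y : C) : F H (x ⊗ y) ~> F H x ⊗ F H y :=
  {| em_map := comul H x y : em_obj (free H (x ⊗ y)) ~> em_obj (EM_tens (free H x) (free H y));
     em_lin := comul_mu H x y |} : EMHom (free H (x ⊗ y)) (EM_tens (free H x) (free H y)).

Definition F0 : F H (𝟙 : C) ~> 𝟙 :=
  {| em_map := couni H : em_obj (free H 𝟙) ~> em_obj (EM_unit H);
     em_lin := couni_mu H |} : EMHom (free H 𝟙) (EM_unit H).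

Lemma F2_nat (x x' y y' : C) (f : x ~> x') (g : y ~> y') :
  F2 x' y' ∘ fmap (F H) (f ⊠ g) = (fmap (F H) f ⊠ fmap (F H) g) ∘ F2 x y.
Proof. apply: EMHom_eq; exact: comul_nat. Qed.

Lemma F2A (x y z : C) :
  asc _ _ _ ∘ (F2 x y ⊠ id (F H z)) ∘ F2 (x ⊗ y) z
  = (id (F H x) ⊠ F2 y z) ∘ F2 x (y ⊗ z) ∘ fmap (F H) (asc x y z).
Proof. apply: EMHom_eq; exact: comulA. Qed.

Lemma F0_l (x : C) : lun (F H x) ∘ (F0 ⊠ id (F H x)) ∘ F2 𝟙 x = fmap (F H) (lun x).
Proof. apply: EMHom_eq; exact: couni_l. Qed.

Lemma F0_r (x : C) : run (F H x) ∘ (id (F H x) ⊠ F0) ∘ F2 x 𝟙 = fmap (F H) (run x).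
Proof. apply: EMHom_eq; exact: couni_r. Qed.

Lemma counit_tens (M N : EM_mon H) :
  counit (M ⊗ N) = (counit M ⊠ counit N) ∘ F2 (U H M) (U H N).
Proof. exact: EMHom_eq. Qed.

Lemma counit_unit : counit (𝟙 : EM_mon H) = F0.
Proof. exact: EMHom_eq. Qed.

Section Coaction.
Variables (B : Bimonad (EM_mon H)) (Q : ComoduleMonad B).

Definition push_coact_EM (x y : C) : Q (F H (x ⊗ y)) ~> Q (F H x) ⊗ B (F H y) :=
  coact Q (F H x) (F H y) ∘ fmap Q (F2 x y).

Definition push_coact (x y : C) :
    push_monad Q (x ⊗ y) ~> push_monad Q x ⊗ push_monad B y :=
  fmap (U H) (push_coact_EM x y).

Lemma push_coact_nat (x x' y y' : C) (f : x ~> x') (g : y ~> y') :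
  push_coact x' y' ∘ fmap (push_monad Q) (f ⊠ g)
  = (fmap (push_monad Q) f ⊠ fmap (push_monad B) g) ∘ push_coact x y.
Proof.
apply: (f_equal (fmap (U H)) (_ : push_coact_EM x' y' ∘ fmap Q (fmap (F H) (f ⊠ g))
  = (fmap Q (fmap (F H) f) ⊠ fmap B (fmap (F H) g)) ∘ push_coact_EM x y)).
rewrite /push_coact_EM -compA -fmap_comp F2_nat fmap_comp compA coact_nat.
by rewrite -compA.
Qed.

Lemma push_coact_mu (x y : C) :
  push_coact x y ∘ mu (push_monad Q) (x ⊗ y)
  = (mu (push_monad Q) x ⊠ mu (push_monad B) y)
    ∘ push_coact (push_monad Q x) (push_monad B y)
    ∘ fmap (push_monad Q) (push_coact x y).
Proof.
apply: (f_equal (fmap (U H)) (_ : push_coact_EM x y ∘ push_mu Q (x ⊗ y)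
  = (push_mu Q x ⊠ push_mu B y) ∘ push_coact_EM (push_monad Q x) (push_monad B y)
    ∘ fmap Q (fmap (F H) (fmap (U H) (push_coact_EM x y))))).
transitivity ((mu Q (F H x) ⊠ mu B (F H y)) ∘ coact Q (Q (F H x)) (B (F H y))
   ∘ fmap Q (push_coact_EM x y ∘ counit (Q (F H (x ⊗ y))))).
  rewrite {1}/push_coact_EM /push_mu -!compA (post2 (esym (mu_nat Q _))) -!compA.
  by rewrite (post2 (coact_mu Q _ _)) -!compA !fmap_comp.
rewrite -counit_nat counit_tens !fmap_comp.
rewrite /push_mu tensm_comp -!compA; congr (_ ∘ _).
by rewrite (post2 (coact_nat Q _ _)) -!compA.
Qed.

Lemma push_coact_eta (x y : C) :
  push_coact x y ∘ eta (push_monad Q) (x ⊗ y)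
  = eta (push_monad Q) x ⊠ eta (push_monad B) y.
Proof.
have E : push_coact_EM x y ∘ eta Q (F H (x ⊗ y))
    = (eta Q (F H x) ⊠ eta B (F H y)) ∘ F2 x y.
  by rewrite /push_coact_EM -compA -eta_nat compA coact_eta.
rewrite [LHS]compA [X in X ∘ _](f_equal (fmap (U H)) E).
rewrite [RHS](tensm_comp (fmap (U H) (eta Q (F H x))) _ (fmap (U H) (eta B (F H y)))).
rewrite -(comul_eta H x y) compA.
by [].
Qed.

Lemma push_coactA (x y z : C) :
  asc _ _ _ ∘ (push_coact x y ⊠ id (push_monad B z)) ∘ push_coact (x ⊗ y) z
  = (id (push_monad Q x) ⊠ fmap (U H) (comul B (F H y) (F H z) ∘ fmap B (F2 y z)))
    ∘ push_coact x (y ⊗ z) ∘ fmap (push_monad Q) (asc x y z).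
Proof.
apply: (f_equal (fmap (U H)) (_ :
  asc _ _ _ ∘ (push_coact_EM x y ⊠ id (B (F H z))) ∘ push_coact_EM (x ⊗ y) z
  = (id (Q (F H x)) ⊠ (comul B (F H y) (F H z) ∘ fmap B (F2 y z)))
    ∘ push_coact_EM x (y ⊗ z) ∘ fmap Q (fmap (F H) (asc x y z)))).
rewrite /push_coact_EM tl_comp tr_comp -!compA.
rewrite -(fmap_id B (F H z)) (post2 (esym (coact_nat Q _ _))).
rewrite -[in RHS](fmap_id Q (F H x)) [in RHS](post2 (esym (coact_nat Q _ _))).
rewrite !fmap_id -!compA -!fmap_comp !compA.
rewrite coactA -!compA -fmap_comp.
by rewrite !compA F2A.
Qed.

Lemma push_coact_couni (x : C) :
  run (push_monad Q x)
    ∘ (id (push_monad Q x) ⊠ fmap (U H) (couni B ∘ fmap B F0)) ∘ push_coact x 𝟙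
  = fmap (push_monad Q) (run x).
Proof.
apply: (f_equal (fmap (U H)) (_ :
  run (Q (F H x)) ∘ (id (Q (F H x)) ⊠ (couni B ∘ fmap B F0)) ∘ push_coact_EM x 𝟙
  = fmap Q (fmap (F H) (run x)))).
rewrite /push_coact_EM tr_comp -!compA -(fmap_id Q (F H x)).
rewrite (post2 (esym (coact_nat Q _ _))) fmap_id -compA -fmap_comp.
by rewrite !compA coact_couni -fmap_comp compA F0_r.
Qed.

End Coaction.

Definition push_bimonad (B : Bimonad (EM_mon H)) : Bimonad C.
Proof.
refine {| bmonad := push_monad B;
          comul := push_coact (regular_comodule B);
          couni := fmap (U H) (couni B ∘ fmap B F0) |}.
- exact: (push_coact_nat (regular_comodule B)).
- exact: (push_coactA (regular_comodule B)).
- move=> x; apply: (f_equal (fmap (U H)) (_ :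
    lun (B (F H x)) ∘ ((couni B ∘ fmap B F0) ⊠ id (B (F H x)))
      ∘ (comul B (F H 𝟙) (F H x) ∘ fmap B (F2 𝟙 x)) = fmap B (fmap (F H) (lun x)))).
  rewrite tl_comp -!compA -(fmap_id B (F H x)) (post2 (esym (comul_nat B _ _))).
  by rewrite fmap_id -compA -fmap_comp !compA couni_l -fmap_comp compA F0_l.
- exact: (push_coact_couni (regular_comodule B)).
- exact: (push_coact_mu (regular_comodule B)).
- apply: (f_equal (fmap (U H)) (_ :
    couni B ∘ fmap B F0 ∘ push_mu B 𝟙
    = couni B ∘ fmap B F0 ∘ fmap B (fmap (F H) (fmap (U H) (couni B ∘ fmap B F0))))).
  have E (M : EM H) (f : M ~> 𝟙) : F0 ∘ fmap (F H) (fmap (U H) f) = f ∘ counit M.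
    exact: (counit_nat f).
  rewrite -[RHS]compA -fmap_comp E /push_mu -!compA.
  by rewrite (post2 (esym (mu_nat B _))) -!compA (post2 (couni_mu B)) -!compA !fmap_comp.
- exact: (push_coact_eta (regular_comodule B)).
- have E : (couni B ∘ fmap B F0) ∘ eta B (F H 𝟙) = F0.
    by rewrite -compA -eta_nat compA couni_eta comp_idl.
  rewrite [LHS]compA [X in X ∘ _](f_equal (fmap (U H)) E).
  exact: couni_eta.
Defined.

Definition push_comodule (B : Bimonad (EM_mon H)) (Q : ComoduleMonad B) :
  ComoduleMonad (push_bimonad B) :=
  {| cmonad := push_monad Q : Monad C;
     coact := push_coact Q : forall x y, push_monad Q (x ⊗ y)
                                ~> push_monad Q x ⊗ push_bimonad B y;
     coact_nat := push_coact_nat Q; coactA := push_coactA Q;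
     coact_couni := push_coact_couni Q; coact_mu := push_coact_mu Q;
     coact_eta := push_coact_eta Q |}.

End PushComodule.

(** [D] is the centraliser of the identity of the category of [H]-modules and
    [Q] the one of its double dual functor; both are unique up to a unique
    isomorphism. *)
Definition double (C : RigidCat) (H : HopfMonad C)
    (D : DrinfeldBimonad (EM_rig H)) : Bimonad C :=
  push_bimonad D.

Definition anti_double (C : RigidCat) (H : HopfMonad C)
    (D : DrinfeldBimonad (EM_rig H)) (Q : AntiDrinfeldMonad D) :
    ComoduleMonad (double D) :=
  push_comodule Q.

Definition admits_double (C : RigidCat) (H : HopfMonad C) : Prop :=
  centralisable H.

Definition admits_anti_double (C : RigidCat) (H : HopfMonad C) : Prop :=
  @centralisable C (CompFunctor (U H) (CompFunctor (DoubleDual (EM_rig H)) (F H))).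

Definition unit_lifts (C : MonCat) (T : Monad C) : Prop :=
  inhabited (ModuleOn T 𝟙).

Record GroupLike (C : MonCat) (H : Bimonad C) := {
  gl :> NatTrans (IdFunctor C) H;
  gl_tens : forall x y : C, comul H x y ∘ gl (x ⊗ y) = gl x ⊠ gl y;
  gl_unit : couni H ∘ gl 𝟙 = id 𝟙
}.

Definition gl_inverse (C : MonCat) (H : Bimonad C) (g g' : GroupLike H) : Prop :=
  forall x : C, mu H x ∘ g (H x) ∘ g' x = eta H x
             /\ mu H x ∘ g' (H x) ∘ g x = eta H x.

Definition gl_left (C : MonCat) (H : Bimonad C) (g : GroupLike H) (x : C) :
    H x ~> H x :=
  mu H x ∘ g (H x).

Definition gl_right (C : MonCat) (H : Bimonad C) (g : GroupLike H) (x : C) :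
    H x ~> H x :=
  mu H x ∘ fmap H (g x).

Definition comul3 (C : MonCat) (H : Bimonad C) (x y z : C) :
    H ((x ⊗ y) ⊗ z) ~> (H x ⊗ H y) ⊗ H z :=
  (comul H x y ⊠ id (H z)) ∘ comul H (x ⊗ y) z.

Section Involution.
Variables (C : RigidCat) (H : HopfMonad C).

(** The component of the antipode is read off from the dual of a free module;
    [left_antipodeE] is its defining property. *)
Definition left_antipode (x : C) : H (ldual (H x)) ~> ldual x :=
  ldualm (eta H x) ∘ em_act (ldual (F H x : EM_rig H)).

Lemma left_antipode_nat (x y : C) (f : x ~> y) :
  ldualm f ∘ left_antipode y
  = left_antipode x ∘ fmap H (ldualm (fmap H f)).
Proof.
have E : ldualm (fmap H f) ∘ em_act (ldual (F H y : EM_rig H))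
    = em_act (ldual (F H x : EM_rig H)) ∘ fmap H (ldualm (fmap H f)).
  exact: (em_lin (ldualm (fmap (F H) f : F H x ~> (F H y : EM_rig H)))).
rewrite /left_antipode -[RHS]compA.
apply: etrans (f_equal (comp (ldualm (eta H x))) E).
have K : ldualm f ∘ ldualm (eta H y) = ldualm (eta H x) ∘ ldualm (fmap H f).
  by rewrite -!ldualm_comp eta_nat.
apply: etrans (compA _ _ _) (etrans _ (esym (compA _ _ _))).
exact: (f_equal (fun h => h ∘ _) K).
Qed.

Lemma left_antipodeE (M : EM_rig H) :
  em_act (ldual M) = left_antipode (em_obj M) ∘ fmap H (ldualm (em_act M)) :> (_ ~> _).
Proof.
have E : ldualm (em_act M) ∘ em_act (ldual M)
    = em_act (ldual (F H (em_obj M) : EM_rig H)) ∘ fmap H (ldualm (em_act M)).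
  exact: (em_lin (ldualm (counit M : _ ~> (M : EM_rig H)))).
rewrite /left_antipode -[RHS]compA.
apply: etrans (f_equal (comp (ldualm (eta H (em_obj M)))) E).
have K : ldualm (eta H (em_obj M)) ∘ ldualm (em_act M) = id _.
  by rewrite -ldualm_comp act_eta ldualm_id.
apply: etrans (esym (comp_idl _)) (etrans _ (esym (compA _ _ _))).
exact: (f_equal (fun h => h ∘ _) (esym K)).
Qed.

(** The action of [^∨β] on [^∨1], transported along [^∨1 ≅ 1]. *)
Definition dual_character_act (b : ModuleOn H 𝟙) : H 𝟙 ~> 𝟙 :=
  ldual_unit_from
    ∘ em_act (ldual ({| em_obj := 𝟙 : C; em_act := b |} : EM_rig H))
    ∘ fmap H ldual_unit_to.

Definition character_adjoint (b : ModuleOn H 𝟙) (x : C) : H x ~> H x :=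
  lun (H x) ∘ run (𝟙 ⊗ H x)
    ∘ ((b ⊠ id (H x)) ⊠ dual_character_act b)
    ∘ comul3 H 𝟙 x 𝟙
    ∘ fmap H (runi (𝟙 ⊗ x) ∘ luni x).

Definition antipode_square (phi : PivotalStructure C) (x : C) : H x ~> H x :=
  iso_inv (piv_iso phi (H x))
    ∘ left_antipode (ldual (H x))
    ∘ fmap H (ldualm (left_antipode x))
    ∘ fmap H (phi x).

(** [g'] is the inverse of [g] in the group of group-likes. *)
Definition pair_in_involution (phi : PivotalStructure C)
    (g : GroupLike H) (b : ModuleOn H 𝟙) : Prop :=
  exists g' : GroupLike H, gl_inverse g g' /\
    forall x : C,
      gl_left g x ∘ gl_right g' x = character_adjoint b x ∘ antipode_square phi x.

End Involution.

(* Main.v *)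
(** Write [D] and [Q] for the centralisers on the category [A] of [H]-modules.

    (iii) => (i) transports the counit of [D(H)].  For (i) => (ii), an action [a] of [Q(H)] on [1]
    gives a morphism of comodule monads
    [Q(H) x -> Q(H) 1 ⊗ D(H) x -> 1 ⊗ D(H) x = D(H) x], and the point is its invertibility.
    The action [a] descends to a [Q]-module [b] in [A] with underlying object [1], because [Q]
    preserves the coequaliser presenting a module by free ones; so no monadicity of [Q(H)] is
    needed.  A [Q]-module structure on [b] is the same as a half-braiding
    [s y : b ⊗ y -> ^∨∨y ⊗ b], and [s (^∨y)] is inverted by the mate of [s y].  Since [b ⊗ D x] is
    the coend of [b ⊗ ^∨y ⊗ x ⊗ y] and [Q (b ⊗ x)] that of [^∨∨∨y ⊗ b ⊗ x ⊗ y], this makes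
    [Q (b ⊗ x) -> b ⊗ D x] invertible; one concludes with [F (1 ⊗ x) = b ⊗ F x], which holds by
    invertibility of the fusion operator.

    With a pivotal structure [phi], composing [s] with the inverse of [phi] turns it into a monoidal
    automorphism of the forgetful functor, i.e. a group-like [g].  Linearity of [s] becomes
    [g · β(h1) h2 = S²(h1) β(h2) · g] for the character [β] of [b], which says that [(g, β^-1)] is a
    pair in involution. *)

From Stdlib Require Import ssreflect Description.
Require Import Defs.

Set Implicit Arguments.
Unset Strict Implicit.
Unset Printing Implicit Defensive.

(** * The right-nested normal form of a morphism *)

Section Strictification.
Variable C : MonCat.

Inductive oexp := OA (x : C) | OU | OT (X Y : oexp).

Fixpoint oev (X : oexp) : C :=
  match X with OA x => x | OU => 𝟙 | OT X Y => oev X ⊗ oev Y end.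

(** [oev X ⊗ w] with all brackets moved to the right and all units dropped. The free tail [w] makes
    reassociation and removal of units definitional, as when a monoidal category is strictified by
    its action on itself. *)
Fixpoint ext (X : oexp) (w : C) : C :=
  match X with OA x => x ⊗ w | OU => w | OT X Y => ext X (ext Y w) end.

Fixpoint extm (X : oexp) (w w' : C) (h : w ~> w') : ext X w ~> ext X w' :=
  match X with
  | OA x => id x ⊠ h
  | OU => h
  | OT X Y => extm X (extm Y h)
  end.

Fixpoint nest (X : oexp) (w : C) : oev X ⊗ w ~> ext X w :=
  match X with
  | OA x => id (x ⊗ w)
  | OU => lun w
  | OT X Y => nest X (ext Y w) ∘ (id (oev X) ⊠ nest Y w) ∘ asc (oev X) (oev Y) w
  end.

Fixpoint unnest (X : oexp) (w : C) : ext X w ~> oev X ⊗ w :=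
  match X with
  | OA x => id (x ⊗ w)
  | OU => luni w
  | OT X Y => asci (oev X) (oev Y) w ∘ (id (oev X) ⊠ unnest Y w) ∘ unnest X (ext Y w)
  end.

Lemma unnestK X w : unnest X w ∘ nest X w = id _.
Proof.
elim: X w => [x||X IX Y IY] w /=; first exact: comp_idl.
- exact: luniK.
- rewrite -!compA (post2 (IX _)) comp_idl (post2 (eq_sym (tr_comp _ _ _))) IY.
  by rewrite tensm_id comp_idl asciK.
Qed.

Lemma nestK X w : nest X w ∘ unnest X w = id _.
Proof.
elim: X w => [x||X IX Y IY] w /=; first exact: comp_idl.
- exact: lunKi.
- rewrite -!compA (post2 (ascKi _ _ _)) comp_idl (post2 (eq_sym (tr_comp _ _ _))) IY.
  by rewrite tensm_id comp_idl IX.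
Qed.

Lemma nest_nat X w w' (h : w ~> w') :
  nest X w' ∘ (id _ ⊠ h) = extm X h ∘ nest X w.
Proof.
elim: X w w' h => [x||X IX Y IY] w w' h /=; first by rewrite comp_idl comp_idr.
- exact: lun_nat.
- rewrite -!compA -tensm_id asc_nat (post2 (eq_sym (tr_comp _ _ _))) IY tr_comp -!compA.
  by rewrite (post2 (IX _ _ _)) -!compA.
Qed.

Inductive mexp : oexp -> oexp -> Type :=
| MA X Y (f : oev X ~> oev Y) : mexp X Y
| MI X : mexp X X
| MC X Y Z (g : mexp Y Z) (f : mexp X Y) : mexp X Z
| MT X X' Y Y' (f : mexp X X') (g : mexp Y Y') : mexp (OT X Y) (OT X' Y')
| Masc X Y Z : mexp (OT (OT X Y) Z) (OT X (OT Y Z))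
| Masci X Y Z : mexp (OT X (OT Y Z)) (OT (OT X Y) Z)
| Mlun X : mexp (OT OU X) X
| Mluni X : mexp X (OT OU X)
| Mrun X : mexp (OT X OU) X
| Mruni X : mexp X (OT X OU).

Fixpoint mev X Y (f : mexp X Y) : oev X ~> oev Y :=
  match f with
  | MA f => f
  | MI X => id _
  | MC g f => mev g ∘ mev f
  | MT f g => mev f ⊠ mev g
  | Masc X Y Z => asc (oev X) (oev Y) (oev Z)
  | Masci X Y Z => asci (oev X) (oev Y) (oev Z)
  | Mlun X => lun (oev X)
  | Mluni X => luni (oev X)
  | Mrun X => run (oev X)
  | Mruni X => runi (oev X)
  end.

(** Sealed, so that rewriting does not look inside. *)
Lemma hat_sealed X Y (f : oev X ~> oev Y) :
  {h : forall w, ext X w ~> ext Y w |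
    forall w, h w = nest Y w ∘ (f ⊠ id w) ∘ unnest X w}.
Proof. by exists (fun w => nest Y w ∘ (f ⊠ id w) ∘ unnest X w). Qed.

Definition hat X Y (f : oev X ~> oev Y) := proj1_sig (hat_sealed f).

Lemma hatE X Y (f : oev X ~> oev Y) w :
  hat f w = nest Y w ∘ (f ⊠ id w) ∘ unnest X w.
Proof. exact: (proj2_sig (hat_sealed f)). Qed.

(** [strict f w] is [f ⊗ w] between right-nested objects; there the associators and unitors
    become identities, and interchange becomes naturality in [w]. *)
Fixpoint strict X Y (f : mexp X Y) : forall w, ext X w ~> ext Y w :=
  match f in mexp X Y return forall w, ext X w ~> ext Y w with
  | MA f => hat f
  | MI X => fun w => id _
  | MC g f => fun w => strict g w ∘ strict f w
  | @MT X X' Y Y' f g => fun w => strict f (ext Y' w) ∘ extm X (strict g w)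
  | Masc X Y Z => fun w => id _
  | Masci X Y Z => fun w => id _
  | Mlun X => fun w => id _
  | Mluni X => fun w => id _
  | Mrun X => fun w => id _
  | Mruni X => fun w => id _
  end.

Lemma strictE X Y (f : mexp X Y) w :
  nest Y w ∘ (mev f ⊠ id w) = strict f w ∘ nest X w.
Proof.
(* The cases of [asci], [luni] and [runi] follow from those of their inverses by cancelling an
   invertible factor. *)
have inv : forall (a b e v : C) (p : a ⊗ v ~> e) (q : b ⊗ v ~> e) (h : a ~> b) (k : b ~> a),
   h ∘ k = id _ -> q ∘ (h ⊠ id v) = p -> p ∘ (k ⊠ id v) = q.
  move=> a b e v p q h k hk <-.
  by rewrite -compA -tl_comp hk tensm_id comp_idr.
have asc_case : forall X Y Z w, nest (OT X (OT Y Z)) w ∘ (asc _ _ _ ⊠ id w)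
    = nest (OT (OT X Y) Z) w.
  move=> {f w}X {}Y Z w /=.
  rewrite !tr_comp -!compA -pentagon.
  by rewrite -tensm_id (post2 (eq_sym (asc_nat _ _ _))) -!compA.
have lun_case : forall X w, nest X w ∘ (lun _ ⊠ id w) = nest (OT OU X) w.
  move=> {f w}X w /=.
  by rewrite -(lun_tens) lun_nat !compA.
have run_case : forall X w, nest X w ∘ (run _ ⊠ id w) = nest (OT X OU) w.
  by move=> {f w}X w /=; rewrite -triangle -!compA.
elim: {X Y} f w => [X Y f|X|X Y Z g IG f IF|X X' Y Y' f IF g IG|X Y Z|X Y Z|X|X|X|X] w /=.
- by rewrite hatE -!compA unnestK comp_idr.
- by rewrite tensm_id comp_idl comp_idr.
- by rewrite tl_comp !compA IG -!compA IF.
- rewrite -!compA asc_nat (post2 (eq_sym (tensm_comp _ _ _ _))) IG comp_idl.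
  have -> : mev f ⊠ (strict g w ∘ nest Y w)
      = (mev f ⊠ id _) ∘ (id _ ⊠ strict g w) ∘ (id _ ⊠ nest Y w).
    by rewrite tlr -tensm_comp comp_idr.
  rewrite -!compA (post2 (IF _)) -!compA; congr (_ ∘ _).
  by rewrite (post2 (nest_nat _ _)) -!compA.
- by rewrite comp_idl; apply: asc_case.
- rewrite comp_idl; exact: inv (ascKi _ _ _) (asc_case _ _ _ _).
- by rewrite comp_idl; apply: lun_case.
- rewrite comp_idl; exact: inv (lunKi _) (lun_case _ _).
- by rewrite comp_idl; apply: run_case.
- rewrite comp_idl; exact: inv (runKi _) (run_case _ _).
Qed.

(** [nest] and [unnest] are mutually inverse and tensoring with [𝟙] is faithful, so equations may be
    checked between right-nested objects. *)
Lemma strict_inj X Y (f g : mexp X Y) :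
  (forall w, strict f w = strict g w) -> mev f = mev g.
Proof.
move=> E; apply: tl1_inj.
rewrite -[LHS]comp_idl -[RHS]comp_idl -(unnestK Y) -!compA.
by rewrite !strictE E.
Qed.

Lemma strict_eq X Y (f g : mexp X Y) :
  mev f = mev g -> forall w, strict f w = strict g w.
Proof.
move=> E w; rewrite -[LHS]comp_idr -[RHS]comp_idr -(nestK X) !compA.
by rewrite -!strictE E.
Qed.

(** The form taken by the interchange law between right-nested objects. *)
Lemma hat_nat X Y (f : oev X ~> oev Y) w w' (h : w ~> w') :
  hat f w' ∘ extm X h = extm Y h ∘ hat f w.
Proof.
rewrite !hatE -!compA.
have -> : unnest X w' ∘ extm X h = (id _ ⊠ h) ∘ unnest X w.
  rewrite -[LHS]comp_idr -(nestK X) -!compA (post2 (eq_sym (nest_nat _ _))).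
  by rewrite -!compA (post2 (unnestK _ _)) comp_idl.
by rewrite (post2 (tlr _ _)) -(trl f h) -!compA (post2 (nest_nat _ _)) -!compA.
Qed.

End Strictification.

(** * Reification of morphisms and rewriting in the normal form *)

Ltac reify_obj C x :=
  lazymatch x with
  | @tens _ ?a ?b => let a' := reify_obj C a in let b' := reify_obj C b in
                     constr:(@OT C a' b')
  | @munit _ => constr:(@OU C)
  | _ => constr:(@OA C x)
  end.

Ltac reify_mor C f :=
  lazymatch f with
  | @id _ ?x => let X := reify_obj C x in constr:(@MI C X)
  | @comp _ _ _ _ ?g ?h =>
      let g' := reify_mor C g in let h' := reify_mor C h in constr:(MC g' h')
  | @tensm _ _ _ _ _ ?g ?h =>
      let g' := reify_mor C g in let h' := reify_mor C h in constr:(MT g' h')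
  | @asc _ ?x ?y ?z => let X := reify_obj C x in let Y := reify_obj C y in
      let Z := reify_obj C z in constr:(@Masc C X Y Z)
  | @asci _ ?x ?y ?z => let X := reify_obj C x in let Y := reify_obj C y in
      let Z := reify_obj C z in constr:(@Masci C X Y Z)
  | @lun _ ?x => let X := reify_obj C x in constr:(@Mlun C X)
  | @luni _ ?x => let X := reify_obj C x in constr:(@Mluni C X)
  | @run _ ?x => let X := reify_obj C x in constr:(@Mrun C X)
  | @runi _ ?x => let X := reify_obj C x in constr:(@Mruni C X)
  | _ => lazymatch type of f with
         | @Hom _ ?x ?y => let X := reify_obj C x in let Y := reify_obj C y in
                           constr:(@MA C X Y f)
         end
  end.

Ltac strict_simpl :=
  cbn [strict ext extm];
  rewrite ?(comp_idl, comp_idr, tensm_id, tr_comp) -?compA.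

Ltac strict_simpl_in H :=
  cbn [strict ext extm] in H;
  rewrite ?(comp_idl, comp_idr, tensm_id, tr_comp) -?compA in H.

Ltac strictify :=
  lazymatch goal with
  | |- @eq (@Hom (mcat ?C) ?x ?y) ?f ?g =>
      let f' := reify_mor C f in let g' := reify_mor C g in
      refine (@strict_inj C _ _ f' g' _);
      let w := fresh "w" in intro w; strict_simpl
  end.

Ltac strict_of H K :=
  lazymatch type of H with
  | @eq (@Hom (mcat ?C) ?x ?y) ?f ?g =>
      let f' := reify_mor C f in let g' := reify_mor C g in
      let p := constr:(fun w : C => ltac:(
        let E := fresh "E" in
        pose proof (@strict_eq C _ _ f' g' H w) as E;
        strict_simpl_in E; exact E)) in
      pose proof p as K
  end.

Ltac hat_nat_of f N :=
  lazymatch type of f with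
  | @Hom (mcat ?C) ?x ?y => let X := reify_obj C x in let Y := reify_obj C y in
      pose proof (@hat_nat C X Y f) as N; cbn [ext extm] in N
  end.

Lemma whisk2 (C : MonCat) (v x y z : C) (f : y ~> z) (g : x ~> y) (h : x ~> z) :
  f ∘ g = h -> (id v ⊠ f) ∘ (id v ⊠ g) = id v ⊠ h.
Proof. by move=> <-; rewrite tr_comp. Qed.

Lemma whisk1 (C : MonCat) (v x y y' z : C) (f : y ~> z) (g : x ~> y) (f' : y' ~> z) (g' : x ~> y') :
  f ∘ g = f' ∘ g' -> (id v ⊠ f) ∘ (id v ⊠ g) = (id v ⊠ f') ∘ (id v ⊠ g').
Proof. by rewrite -!tr_comp => ->. Qed.

Lemma post (C : Category) (x y y' z : C) (f : y ~> z) (g : x ~> y) (f' : y' ~> z) (g' : x ~> y') :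
  f ∘ g = f' ∘ g' -> forall w (k : w ~> x), f ∘ (g ∘ k) = f' ∘ (g' ∘ k).
Proof. by move=> E w k; rewrite !compA E. Qed.

(** Not ssreflect's [rewrite -!compA], which also unfolds composites such as [ucoact] and [dd2]. *)
Ltac rassoc := repeat rewrite <- compA.

Lemma post23 (C : Category) (x y y' y'' z : C) (f : y ~> z) (g : x ~> y)
    (f' : y' ~> z) (g' : y'' ~> y') (h' : x ~> y'') :
  f ∘ g = f' ∘ (g' ∘ h') ->
  forall w (k : w ~> x), f ∘ (g ∘ k) = f' ∘ (g' ∘ (h' ∘ k)).
Proof. by move=> E w k; rewrite !compA E !compA. Qed.

(** * Double duals *)

Section DualCoherence.
Context {C : RigidCat}.
Implicit Types x y z : C.

(** Tested against the evaluation of [x ⊗ y], the composite reduces by the triangle identities of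
    [x] and of [y]. *)
Lemma ldual_tens_fromK x y : ldual_tens_to x y ∘ ldual_tens_from x y = id _.
Proof.
apply: lev_inj; rewrite tl_comp compA lev_lmate.
rewrite /ldual_tens_ev /ldual_tens_from /ldual_tens_coev /ltrans_of.
strictify.
strict_of (lzig x) K.
strict_of (lzig y) K'.
hat_nat_of (lev (x ⊗ y)) N.
rewrite -!(post (N _ _ _)).
hat_nat_of (lcoev y) Ny.
rewrite -(post (whisk1 _ (whisk1 _ (Ny _ _ _)))).
rewrite (post2 (whisk2 _ (whisk2 _ (K' _)))) !tensm_id comp_idl.
by rewrite (whisk2 _ (K _)) !tensm_id comp_idr.
Qed.

Lemma ldual_tens_toK x y : ldual_tens_from x y ∘ ldual_tens_to x y = id _.
Proof.
have E := lev_lmate (ldual_tens_ev x y).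
rewrite -/(ldual_tens_to x y) in E; move: (ldual_tens_to x y) E => u E.
rewrite /ldual_tens_from /ldual_tens_coev /ltrans_of.
strictify.
rewrite /ldual_tens_ev in E.
strict_of (lzag x) K.
strict_of (lzag y) K'.
strict_of E E'.
hat_nat_of u N.
rewrite -N -(post (N _ _ _)) (post2 (E' _)).
hat_nat_of (lev x) Mx.
rewrite -!compA (post (whisk1 _ (Mx _ _ _))) (whisk2 _ (K _)) tensm_id comp_idr.
exact: K'.
Qed.

Lemma lev_ldual_tens_to x y :
  lev (x ⊗ y) ∘ (ldual_tens_to x y ⊠ id _) = ldual_tens_ev x y.
Proof. exact: lev_lmate. Qed.

(** Left duality exchanges the structure maps: up to comparison, the dual of an evaluation is a
    coevaluation. The next lemma is the mirror image. *)
Lemma ldual_tens_to_lcoev y :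
  ldual_tens_to (ldual y) y ∘ lcoev (ldual y) = ldualm (lev y) ∘ ldual_unit_to.
Proof.
apply: lev_inj; rewrite (tl_comp _ (ldual_tens_to _ _)) (tl_comp _ (ldualm _)).
rewrite [LHS]compA [RHS]compA lev_ldual_tens_to lev_ldualm.
rewrite /ldual_tens_ev /ldual_unit_to.
strictify.
strict_of (lzig (ldual y)) K; strict_of (lzig (𝟙 : C)) K1.
hat_nat_of (lcoev (𝟙 : C)) M1.
by rewrite K comp_idr -M1 (post2 (K1 _)) comp_idl.
Qed.

Lemma ldual_tens_to_lev y :
  ldualm (lcoev y) ∘ ldual_tens_to y (ldual y) = ldual_unit_to ∘ lev (ldual y).
Proof.
apply: lev_inj; rewrite (tl_comp _ (ldualm _)) (tl_comp _ (ldual_unit_to)).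
rewrite [LHS]compA lev_ldualm -[LHS]compA trl.
rewrite -(tlr (ldual_tens_to _ _)) [LHS]compA lev_ldual_tens_to.
rewrite /ldual_tens_ev /ldual_unit_to.
strictify.
strict_of (lzag y) K; strict_of (lzig (𝟙 : C)) K1.
by rewrite (whisk2 _ (K _)) tensm_id comp_idr (post2 (K1 _)) comp_idl.
Qed.

Lemma ldual_unit_toK : ldual_unit_from ∘ ldual_unit_to = id (𝟙 : C).
Proof.
rewrite /ldual_unit_from /ldual_unit_to; strictify.
strict_of (lzig (𝟙 : C)) K1; exact: K1.
Qed.

Lemma ldual_unit_fromK : ldual_unit_to ∘ ldual_unit_from = id (ldual (𝟙 : C)).
Proof.
rewrite /ldual_unit_from /ldual_unit_to; strictify.
strict_of (lzag (𝟙 : C)) K1; hat_nat_of (lev (𝟙 : C)) M1.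
by rewrite -M1 K1.
Qed.

(** Dualising twice undoes the exchange, so the double dual carries evaluations to evaluations. With
    [lcoev_ddual], this is what lets mates invert half-braidings. *)
Lemma lev_ddual y :
  lev (ldual (ldual y)) ∘ dd2 (ldual y) y = dd0 ∘ ldualm (ldualm (lev y)).
Proof.
rewrite -[lev (ldual (ldual y))]comp_idl -ldual_unit_toK; rassoc.
rewrite [in LHS](post2 (eq_sym (ldual_tens_to_lev _))) /dd2 /dd0; rassoc.
rewrite (post2 (ldual_tens_fromK _ _)) comp_idl -!ldualm_comp ldual_tens_to_lcoev.
by [].
Qed.

Lemma lcoev_ddual y :
  dd2 y (ldual y) ∘ ldualm (ldualm (lcoev y)) = lcoev (ldual (ldual y)) ∘ dd0.
Proof.
rewrite /dd2 /dd0; rassoc; rewrite -ldualm_comp ldual_tens_to_lev ldualm_comp.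
rewrite -[lcoev _]comp_idl -(ldual_tens_toK _ _); rassoc.
by rewrite (post2 (ldual_tens_to_lcoev _)); rassoc; rewrite (post2 ldual_unit_fromK) comp_idl.
Qed.

End DualCoherence.

(** * Half-braidings and centralisers *)

Section HalfBraiding.
Variables (A : RigidCat) (b : A).

(** A half-braiding twisted by the double dual. Invertibility of [s] is a consequence of these
    axioms and rigidity, see [hb_iso]. *)
Record IsHalfBraiding (s : forall y : A, b ⊗ y ~> ldual (ldual y) ⊗ b) : Prop := {
  hb_nat : forall (y y' : A) (f : y ~> y'),
    s y' ∘ (id b ⊠ f) = (ldualm (ldualm f) ⊠ id b) ∘ s y;
  hb_unit : (dd0 ⊠ id b) ∘ s 𝟙 = luni b ∘ run b;
  hb_tens : forall y z : A,
    asc _ _ _ ∘ (dd2 y z ⊠ id b) ∘ s (y ⊗ z) ∘ asc b y z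
    = (id _ ⊠ s z) ∘ asc _ _ _ ∘ (s y ⊠ id z)
}.

Variable s : forall y : A, b ⊗ y ~> ldual (ldual y) ⊗ b.
Hypothesis hb : IsHalfBraiding s.

(** Moves [b] past [y] and then evaluates the double dual of [y]. The transpose [hb_inv] is the mate
    of [s y], which inverts [s (ldual y)]. *)
Definition hb_slide (y : A) : (ldual (ldual (ldual y)) ⊗ b) ⊗ y ~> b :=
  lun b ∘ (lev (ldual (ldual y)) ⊠ id b) ∘ asci _ _ _ ∘ (id _ ⊠ s y) ∘ asc _ _ _.

Definition hb_inv (y : A) : ldual (ldual (ldual y)) ⊗ b ~> b ⊗ ldual y :=
  rtrans (lcoev y) (hb_slide y).

Lemma hb_invE (y : A) :
  run b ∘ (id b ⊠ lev y) ∘ asc _ _ _ ∘ (hb_inv y ⊠ id y) = hb_slide y.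
Proof. exact: (rtransK (lzig y)). Qed.

(** The two successive half-braidings merge into [s (ldual y ⊗ y)]; [lev_ddual] and naturality move
    the evaluation before it, and the unit axiom removes the remaining [s 𝟙]. *)
Lemma hb_slideE (y : A) :
  hb_slide y ∘ (s (ldual y) ⊠ id y) = run b ∘ (id b ⊠ lev y) ∘ asc _ _ _.
Proof.
have T := hb_tens hb (ldual y) y; have N := hb_nat hb (lev y).
have O := hb_unit hb; have L := lev_ddual y.
rewrite /hb_slide; strictify.
strict_of T T'; strict_of N N'; strict_of O O'; strict_of L L'.
rewrite -T' (post2 (L' _)) -compA -N' (post2 (O' _)).
by rewrite comp_idl.
Qed.

Lemma hb_invK (y : A) : hb_inv y ∘ s (ldual y) = id _.
Proof.
apply: (rtrans_inj (lzag y)); rewrite /rtrans_of.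
by rewrite (tl_comp y (hb_inv y)) compA hb_invE hb_slideE tensm_id comp_idr.
Qed.

Lemma hb_Kinv (y : A) : s (ldual y) ∘ hb_inv y = id _.
Proof.
have T := hb_tens hb y (ldual y); have N := hb_nat hb (lcoev y).
have O := hb_unit hb; have L := lcoev_ddual y.
have Z := lzag (ldual (ldual y)).
rewrite /hb_inv /hb_slide /rtrans; strictify.
strict_of T T'; strict_of N N'; strict_of O O'; strict_of L L'; strict_of Z Z'.
hat_nat_of (lev (ldual (ldual y))) M.
rewrite -(post (M _ _ _)).
rewrite (post (whisk1 _ (eq_sym (T' _)))) (whisk1 _ (N' _)) (post (whisk1 _ (L' _))).
by rewrite (whisk2 _ (O' _)) tensm_id comp_idr.
Qed.

(** Every [y] is isomorphic to the left dual of [rdual y], where the mate is an inverse; naturality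
    of [s] carries it back to [y]. *)
Lemma hb_iso (y : A) : exists t : ldual (ldual y) ⊗ b ~> b ⊗ y,
  t ∘ s y = id _ /\ s y ∘ t = id _.
Proof.
pose i : y ~> ldual (rdual y) := lmate (lcoev (rdual y)) (rev y).
pose j : ldual (rdual y) ~> y := lmate (rcoev y) (lev (rdual y)).
have li : lev (rdual y) ∘ (i ⊠ id _) = rev y := lev_lmate _.
have lj : rev y ∘ (j ⊠ id _) = lev (rdual y) := lmateK (rzag y) _.
have ji : j ∘ i = id _.
  by apply: (lmate_inj (rzig y)); rewrite (tl_comp _ j) compA lj li tensm_id comp_idr.
have ij : i ∘ j = id _.
  by apply: lev_inj; rewrite (tl_comp _ i) compA li lj tensm_id comp_idr.
have := hb_invK (rdual y); have := hb_Kinv (rdual y).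
move: (hb_inv (rdual y)) => t st ts.
exists ((id b ⊠ j) ∘ t ∘ (ldualm (ldualm i) ⊠ id b)); split.
  rewrite -compA -(hb_nat hb) compA -(compA _ t) ts comp_idr -tr_comp ji.
  exact: tensm_id.
rewrite !compA (hb_nat hb) -(compA _ (s _)) st comp_idr -tl_comp -!ldualm_comp.
by rewrite ji !ldualm_id tensm_id.
Qed.

End HalfBraiding.

(** * Universal coactions of a centraliser *)

Section CentraliserTheory.
Variables (A : RigidCat) (T : Functor A A).

Lemma ltrans_ofE (x a a' v v' : A) (k : v ~> v') (u : a ~> x ⊗ v) (h : a' ~> a) :
  ltrans_of (lev x) ((id x ⊠ k) ∘ u ∘ h) = k ∘ ltrans_of (lev x) u ∘ (id _ ⊠ h).
Proof.
rewrite /ltrans_of; strictify.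
hat_nat_of (lev x) N.
by rewrite (post (N _ _ _)).
Qed.

Lemma ltrans_of_dual (x x' a v : A) (f : x ~> x') (u : a ~> x ⊗ v) :
  ltrans_of (lev x') ((f ⊠ id v) ∘ u) = ltrans_of (lev x) u ∘ (ldualm f ⊠ id a).
Proof.
have L := lev_ldualm f.
rewrite /ltrans_of; strictify.
strict_of L L'; hat_nat_of (ldualm f) N.
by rewrite -N (post2 (L' _)); rassoc.
Qed.

Section OneCentraliser.
Variables (Z : Functor A A) (c : Centraliser T Z).

Lemma cstrE (x y : A) : cstr c x y = ltrans_of (lev (T y)) (ucoact c x y).
Proof. by rewrite /ucoact (ltransK (lzag (T y))). Qed.

Lemma ucoact_natr (x y y' : A) (f : y ~> y') :
  (fmap T f ⊠ id (Z x)) ∘ ucoact c x y = ucoact c x y' ∘ (id x ⊠ f).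
Proof.
apply: (ltrans_inj (lzig (T y'))); rewrite ltrans_of_dual -cstrE.
have := ltrans_ofE (id (Z x)) (ucoact c x y') (id x ⊠ f).
rewrite tensm_id !comp_idl => ->; rewrite -cstrE.
have := coend_cowedge (cstr_coend c x) f; rewrite /= fmap_id ldualm_id tensm_id.
by [].
Qed.

Lemma ucoact_natl (x x' y : A) (f : x ~> x') :
  (id (T y) ⊠ fmap Z f) ∘ ucoact c x y = ucoact c x' y ∘ (f ⊠ id y).
Proof.
apply: (ltrans_inj (lzig (T y))).
have := ltrans_ofE (id (Z x')) (ucoact c x' y) (f ⊠ id y).
rewrite tensm_id !comp_idl => ->.
have := ltrans_ofE (fmap Z f) (ucoact c x y) (id _).
rewrite tensm_id !comp_idr => ->.
by rewrite -!cstrE cstr_nat.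
Qed.

Lemma ltrans_of_ucoact (x y v : A) (u : Z x ~> v) :
  ltrans_of (lev (T y)) ((id (T y) ⊠ u) ∘ ucoact c x y) = u ∘ cstr c x y.
Proof.
by have := ltrans_ofE u (ucoact c x y) (id _); rewrite tensm_id !comp_idr -cstrE.
Qed.

Lemma cstr_ext (x v : A) (u u' : Z x ~> v) :
  (forall y, u ∘ cstr c x y = u' ∘ cstr c x y) -> u = u'.
Proof.
move=> E.
have cw : @is_cowedge A A (integrand T x) v (fun y => u' ∘ cstr c x y).
  by move=> y y' f; rewrite -!compA (coend_cowedge (cstr_coend c x)).
have [w [_ uniq]] := coend_univ (cstr_coend c x) cw.
by rewrite -(uniq u E) -(uniq u').
Qed.

Lemma ucoact_ext (x v : A) (u u' : Z x ~> v) :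
  (forall y, (id (T y) ⊠ u) ∘ ucoact c x y = (id (T y) ⊠ u') ∘ ucoact c x y) -> u = u'.
Proof. by move=> E; apply: cstr_ext => y; rewrite -!ltrans_of_ucoact E. Qed.

Lemma cstr_lift (x v : A) (j : forall y, ldual (T y) ⊗ (x ⊗ y) ~> v) :
  (forall y y' (f : y ~> y'),
     j y ∘ (ldualm (fmap T f) ⊠ id _) = j y' ∘ (id _ ⊠ (id x ⊠ f))) ->
  exists u : Z x ~> v, forall y, u ∘ cstr c x y = j y.
Proof.
move=> N.
have cw : @is_cowedge A A (integrand T x) v j.
  by move=> y y' f; have := N y y' f; rewrite /= fmap_id ldualm_id tensm_id.
by have [u [E _]] := coend_univ (cstr_coend c x) cw; exists u.
Qed.

(** Transposition turns natural families [x ⊗ y ~> T y ⊗ v] into cowedges, so the coend property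
    applies. *)
Lemma ucoact_lift (x v : A) (j : forall y, x ⊗ y ~> T y ⊗ v) :
  (forall y y' (f : y ~> y'), (fmap T f ⊠ id v) ∘ j y = j y' ∘ (id x ⊠ f)) ->
  exists u : Z x ~> v, forall y, (id (T y) ⊠ u) ∘ ucoact c x y = j y.
Proof.
move=> N; have [y y' f|u E] := @cstr_lift x v (fun y => ltrans_of (lev (T y)) (j y)).
  rewrite -ltrans_of_dual N.
  by have := ltrans_ofE (id v) (j y') (id x ⊠ f); rewrite tensm_id !comp_idl.
by exists u => y; apply: (ltrans_inj (lzig (T y))); rewrite ltrans_of_ucoact E.
Qed.

End OneCentraliser.
End CentraliserTheory.

(** * Modules over the centraliser of the double dual *)

Definition is_epi (B : Category) (x y : B) (e : x ~> y) : Prop :=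
  forall v (u u' : y ~> v), u ∘ e = u' ∘ e -> u = u'.

(** Factorisations are data because [centraliser_fac] uses one for every object [y] at once. *)
Record Coequaliser (B : Category) (x0 x x' : B) (p q : x0 ~> x) (e : x ~> x') := {
  coeq_eq : e ∘ p = e ∘ q;
  coeq_fac : forall v (u : x ~> v), u ∘ p = u ∘ q -> x' ~> v;
  coeq_facE : forall v (u : x ~> v) (E : u ∘ p = u ∘ q), coeq_fac E ∘ e = u;
  coeq_epi : is_epi e
}.

(** * Centralisers preserve epimorphisms and coequalisers *)

Section Coequalisers.
Variable A : RigidCat.

Lemma rtrans_comp (d z a a' v : A) (co : 𝟙 ~> z ⊗ d) (u : a ⊗ z ~> v) (k : a' ~> a) :
  rtrans co (u ∘ (k ⊠ id z)) = rtrans co u ∘ k.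
Proof.
rewrite /rtrans; strictify.
hat_nat_of k N.
by rewrite N.
Qed.

Lemma rtrans_of_comp (d z a a' v : A) (ev : d ⊗ z ~> 𝟙) (u : a ~> v ⊗ d) (k : a' ~> a) :
  rtrans_of ev (u ∘ k) = rtrans_of ev u ∘ (k ⊠ id z).
Proof. by rewrite /rtrans_of tl_comp !compA. Qed.

(** [- ⊗ y] is left adjoint to [- ⊗ ldual y]. The same adjunction gives [coeq_tens]. *)
Lemma epi_tens (x x' : A) (e : x ~> x') (y : A) : is_epi e -> is_epi (e ⊠ id y).
Proof.
move=> K v u u' E; rewrite -(rtransK (lzig y) u) -(rtransK (lzig y) u').
by congr rtrans_of; apply: K; rewrite -!rtrans_comp E.
Qed.

Lemma centraliser_epi (T Z : Functor A A) (c : Centraliser T Z) (x x' : A) (e : x ~> x') :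
  is_epi e -> is_epi (fmap Z e).
Proof.
move=> K v u u' E; apply: (ucoact_ext (c := c)) => y; apply: (epi_tens K).
rassoc; rewrite -!ucoact_natl !compA -!tr_comp.
by rewrite E.
Qed.

Variables (x0 x x' : A) (p q : x0 ~> x) (e : x ~> x').
Hypothesis K : Coequaliser p q e.

Definition coeq_tens (y : A) : Coequaliser (p ⊠ id y) (q ⊠ id y) (e ⊠ id y).
Proof.
have F : forall v (u : x ⊗ y ~> v), u ∘ (p ⊠ id y) = u ∘ (q ⊠ id y) ->
    rtrans (lcoev y) u ∘ p = rtrans (lcoev y) u ∘ q.
  by move=> v u E; rewrite -!rtrans_comp E.
refine {| coeq_fac := fun v u E => rtrans_of (lev y) (coeq_fac K (F v u E)) |}.
- by rewrite -!tl_comp (coeq_eq K).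
- by move=> v u E; rewrite -rtrans_of_comp coeq_facE (rtransK (lzig y)).
- exact: epi_tens (coeq_epi K).
Defined.

Variables (T Z : Functor A A) (c : Centraliser T Z).

(** Each composite of [u] with a universal coaction factors through [e ⊠ id y]; the factorisations
    are natural in [y] and so assemble to a map out of [Z x']. *)
Lemma centraliser_fac v (u : Z x ~> v) :
  u ∘ fmap Z p = u ∘ fmap Z q -> exists t : Z x' ~> v, t ∘ fmap Z e = u.
Proof.
move=> E.
have F : forall y, ((id (T y) ⊠ u) ∘ ucoact c x y) ∘ (p ⊠ id y)
      = ((id (T y) ⊠ u) ∘ ucoact c x y) ∘ (q ⊠ id y).
  by move=> y;  rassoc; rewrite -!ucoact_natl !compA -!tr_comp E.
have [y y' f|t tE] :=
  @ucoact_lift A T Z c x' v (fun y => coeq_fac (coeq_tens y) (F y)).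
  apply: (coeq_epi (coeq_tens y)).
  rewrite -(compA _ _ (e ⊠ id y)) (coeq_facE (coeq_tens y)).
  rewrite -(compA _ _ (e ⊠ id y)) trl -(tlr e f) [RHS]compA (coeq_facE (coeq_tens y')).
  rewrite compA tlr -(trl _ u); rassoc.
  by rewrite ucoact_natr.
exists t; apply: (ucoact_ext (c := c)) => y.
rewrite tr_comp -compA ucoact_natl compA tE.
exact: (coeq_facE (coeq_tens y)).
Qed.

End Coequalisers.

(** * Actions of the centraliser and half-braidings *)

Section HalfBraidingModules.
Variables (A : RigidCat) (D : DrinfeldBimonad A) (Q : AntiDrinfeldMonad D) (b : A).

Notation xi := (ucoact (qcent Q)).

Definition module_braiding (a : Q b ~> b) (y : A) : b ⊗ y ~> ldual (ldual y) ⊗ b :=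
  (id (DoubleDual A y) ⊠ a) ∘ xi b y.

Lemma module_braiding_unit (a : Q b ~> b) :
  lun b ∘ (dd0 ⊠ id b) ∘ module_braiding a 𝟙 ∘ runi b = a ∘ eta Q b.
Proof.
rewrite (qcent_unit Q b) /module_braiding.
 rassoc; rewrite (post2 (tlr _ _)) -(trl dd0 a); rassoc.
by rewrite (post2 (lun_nat _)); rassoc.
Qed.

(** Together with [module_braiding_act], exhibits the two sides of the hexagon as [a ∘ mu Q b] and
    [a ∘ fmap Q a] behind the same iterated coaction; associativity of [a] thus corresponds to
    [hb_tens]. *)
Lemma module_braiding_mu (a : Q b ~> b) (y z : A) :
  asc _ _ _ ∘ (dd2 y z ⊠ id b) ∘ module_braiding a (y ⊗ z) ∘ asc b y z
  = (id (DoubleDual A y) ⊠ (id (DoubleDual A z) ⊠ (a ∘ mu Q b)))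
    ∘ (id (DoubleDual A y) ⊠ xi (Q b) z) ∘ asc _ _ _ ∘ (xi b y ⊠ id z).
Proof.
have M := qcent_mult Q b y z; rewrite /module_braiding.
move: (ucoact (qcent Q)) M => x M.
transitivity ((id (DoubleDual A y) ⊠ (id (DoubleDual A z) ⊠ a))
  ∘ (asc _ _ _ ∘ (dd2 y z ⊠ id (Q b)) ∘ x b (y ⊗ z) ∘ asc b y z)); last first.
  by rewrite -!compA in M; rewrite !tr_comp -!compA M.
rewrite !compA -asc_nat tensm_id; congr (_ ∘ _).
rewrite -!compA; congr (_ ∘ _); rewrite !compA; congr (_ ∘ _).
exact: (eq_trans (tlr _ _) (eq_sym (trl _ _))).
Qed.

Lemma module_braiding_act (a : Q b ~> b) (y z : A) :
  (id _ ⊠ module_braiding a z) ∘ asc _ _ _ ∘ (module_braiding a y ⊠ id z)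
  = (id (DoubleDual A y) ⊠ (id (DoubleDual A z) ⊠ (a ∘ fmap Q a)))
    ∘ (id (DoubleDual A y) ⊠ xi (Q b) z) ∘ asc _ _ _ ∘ (xi b y ⊠ id z).
Proof.
have N := ucoact_natl (qcent Q) z a; rewrite /module_braiding.
move: (ucoact (qcent Q)) N => x N.
rewrite tl_comp -!compA (post2 (asc_nat _ _ _)) -!compA.
rewrite !compA; congr (_ ∘ _ ∘ _).
rewrite -!tr_comp; congr (_ ⊠ _).
rewrite tr_comp -!compA; congr (_ ∘ _).
exact: (eq_sym N).
Qed.

(** [ucoact_ext] applied twice: after the first use the source is [Q b ⊗ z], and transposing [z] to
    the other side leaves [Q b] for the second. *)
Lemma ucoact_ext2 v (u u' : Q (Q b) ~> v) :
  (forall y z : A,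
    (id (DoubleDual A y) ⊠ (id (DoubleDual A z) ⊠ u))
      ∘ (id (DoubleDual A y) ⊠ xi (Q b) z) ∘ asc _ _ _ ∘ (xi b y ⊠ id z)
    = (id (DoubleDual A y) ⊠ (id (DoubleDual A z) ⊠ u'))
      ∘ (id (DoubleDual A y) ⊠ xi (Q b) z) ∘ asc _ _ _ ∘ (xi b y ⊠ id z)) ->
  u = u'.
Proof.
move=> E; apply: (ucoact_ext (c := qcent Q)) => z.
rewrite -[LHS](rtransK (lzig z)) -[RHS](rtransK (lzig z)); congr rtrans_of.
apply: (ucoact_ext (c := qcent Q)) => y.
have R : forall t : Q b ⊗ z ~> DoubleDual A z ⊗ v,
    (id _ ⊠ rtrans (lcoev z) t) ∘ xi b y
    = asc _ _ _ ∘ rtrans (lcoev z) ((id _ ⊠ t) ∘ asc _ _ _ ∘ (xi b y ⊠ id z)).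
  move=> t; rewrite /rtrans.
  move: (DoubleDual A z) (DoubleDual A y) (xi b y) t => Tz Ty x t; strictify.
  by hat_nat_of x N; rewrite N.
rewrite !R (tr_comp _ (_ ⊠ u)) (tr_comp _ (_ ⊠ u')).
by rewrite E.
Qed.

Lemma module_halfbraiding (a : ModuleOn Q b) : IsHalfBraiding (module_braiding a).
Proof.
split.
- move=> y y' f; have N := ucoact_natr (qcent Q) b f; rewrite /module_braiding.
  move: (ucoact (qcent Q) b) N => x N.
  rewrite -compA -N !compA; congr (_ ∘ _).
  exact: eq_trans (trl _ _) (eq_sym (tlr _ _)).
- have E := module_braiding_unit a; rewrite act_eta in E.
  move: (module_braiding a 𝟙) E => m E.
  rewrite -[LHS]comp_idl -(luniK b) -[LHS]comp_idr -(runiK b).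
  by rewrite -!compA; congr (_ ∘ _); rewrite !compA E comp_idl.
- by move=> y z; rewrite module_braiding_mu act_mu -module_braiding_act.
Qed.

Lemma halfbraiding_module (s : forall y : A, b ⊗ y ~> ldual (ldual y) ⊗ b) :
  IsHalfBraiding s -> exists a : ModuleOn Q b, forall y, module_braiding a y = s y.
Proof.
move=> hb; have [y y' f|a E] := @ucoact_lift A (DoubleDual A) Q (qcent Q) b b s.
  by rewrite -(hb_nat hb).
have E' : forall y, module_braiding a y = s y := E.
have am : a ∘ mu Q b = a ∘ fmap Q a.
  apply: ucoact_ext2 => y z.
  by rewrite -module_braiding_mu -module_braiding_act !E' (hb_tens hb).
have ae : a ∘ eta Q b = id b.
  rewrite -module_braiding_unit E' -(compA (lun b)) (hb_unit hb).
  by rewrite compA lunKi comp_idl runKi.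
by exists {| act := a : mfun Q b ~> b; act_mu := am; act_eta := ae |}.
Qed.

Variable a : ModuleOn Q b.

Definition module_coact (x : A) : Q (b ⊗ x) ~> b ⊗ D x :=
  (a ⊠ id (D x)) ∘ coact Q b x.

(** On the components of the two coends, [module_coact] is given by the mate [hb_inv], so its
    invertibility comes from that of the half-braiding. *)
Lemma module_coact_cstr (x y : A) :
  module_coact x ∘ cstr (qcent Q) (b ⊗ x) y
  = (id b ⊠ cstr (dcent D) x y) ∘ asc _ _ _
    ∘ (hb_inv (module_braiding a) y ⊠ id (x ⊗ y)) ∘ asci _ _ _
    ∘ (id _ ⊠ asc b x y).
Proof.
have E : (id (DoubleDual A y) ⊠ module_coact x) ∘ xi (b ⊗ x) y
   = asc _ _ _ ∘ (module_braiding a y ⊠ id (D x)) ∘ asci _ _ _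
     ∘ (id b ⊠ ucoact (dcent D) x y) ∘ asc _ _ _.
  have X := qcent_coact Q b x y; rewrite /module_coact /module_braiding.
  move: (ucoact (qcent Q)) (ucoact (dcent D)) X => u v X.
  rewrite tr_comp -(compA (id _ ⊠ (a ⊠ _))) X !compA; congr (_ ∘ _ ∘ _ ∘ _).
  rewrite tl_comp !compA; congr (_ ∘ _).
  exact: eq_sym (asc_nat _ _ _).
rewrite -ltrans_of_ucoact E cstrE /=.
have P := hb_invE (module_braiding a) y; rewrite /hb_slide in P.
rewrite /ltrans_of.
move: (hb_inv (module_braiding a) y) P => t P.
move: (module_braiding a y) P => s P.
change (fobj (IdFunctor A) y) with (y : Obj A).
change (fobj (DoubleDual A) y) with (ldual (ldual y) : Obj A).
move: (ucoact (dcent D) x y : x ⊗ y ~> y ⊗ D x) => u.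
strictify.
strict_of P P'; hat_nat_of t N.
by rewrite -N (post2 (P' _)); rassoc.
Qed.

Lemma ltrans_of_comp (d z a1 a2 v : A) (ev : d ⊗ z ~> 𝟙) (u : a1 ~> z ⊗ v) (k : a2 ~> a1) :
  ltrans_of ev (u ∘ k) = ltrans_of ev u ∘ (id d ⊠ k).
Proof. by rewrite /ltrans_of tr_comp !compA. Qed.

Lemma ltrans_comp (d z a1 a2 v : A) (co : 𝟙 ~> z ⊗ d) (u : d ⊗ a1 ~> v) (k : a2 ~> a1) :
  ltrans co (u ∘ (id d ⊠ k)) = ltrans co u ∘ k.
Proof.
rewrite /ltrans; strictify.
hat_nat_of co N.
by rewrite -N.
Qed.

Lemma module_coact_iso (x : A) :
  exists k : b ⊗ D x ~> Q (b ⊗ x),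
    k ∘ module_coact x = id _ /\ module_coact x ∘ k = id _.
Proof.
have hb := module_halfbraiding a.
have st := hb_Kinv hb; have ts := hb_invK hb; have N := hb_nat hb.
have G := module_coact_cstr x.
move: (module_coact x) G => g G.
move: (module_braiding a) (hb_inv (module_braiding a)) N st ts G => {hb} s t N st ts G.
have W y y' (f : y ~> y') : _ = _ := coend_cowedge (cstr_coend (qcent Q) (b ⊗ x)) f.
have XQ := @cstr_ext _ _ _ (qcent Q) (b ⊗ x).
have XD := @cstr_ext _ _ _ (dcent D) x.
have LD := @cstr_lift _ _ _ (dcent D) x.
move: (cstr (qcent Q) (b ⊗ x) : forall y : A, ldual (ldual (ldual y)) ⊗ ((b ⊗ x) ⊗ y) ~> Q (b ⊗ x))
  (cstr (dcent D) x : forall y : A, ldual y ⊗ (x ⊗ y) ~> D x) G W XQ XD LD => c d G W XQ XD LD.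
have {}G (y : A) : g ∘ c y = (id b ⊠ d y) ∘ asc b (ldual y) (x ⊗ y)
  ∘ (t y ⊠ id (x ⊗ y)) ∘ asci (ldual (ldual (ldual y))) b (x ⊗ y)
  ∘ (id (ldual (ldual (ldual y))) ⊠ asc b x y) := G y.
have {}W (y y' : A) (f : y ~> y') :
    c y ∘ (ldualm (ldualm (ldualm f)) ⊠ id ((b ⊗ x) ⊗ y))
    = c y' ∘ (id _ ⊠ (id (b ⊗ x) ⊠ f)).
  by have := W y y' f; rewrite /= !ldualm_id !tensm_id.
(* The components of the inverse: [s (ldual y)] undoes the mate found in [module_coact_cstr]. *)
pose kk (y : A) : b ⊗ (ldual y ⊗ (x ⊗ y)) ~> Q (b ⊗ x) :=
  c y ∘ (id _ ⊠ asci b x y) ∘ asc _ _ _ ∘ (s (ldual y) ⊠ id (x ⊗ y)) ∘ asci _ _ _.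
have kk_nat (y y' : A) (f : y ~> y') :
    kk y ∘ (id b ⊠ (ldualm f ⊠ id _)) = kk y' ∘ (id b ⊠ (id _ ⊠ (id x ⊠ f))).
  have Nf := N _ _ (ldualm f); have Wf := W _ _ f; rewrite /kk; strictify.
  strict_of Wf W'; strict_of Nf N'; hat_nat_of (s (ldual y')) Ns.
  by rewrite N' (post2 (W' _)) Ns; rassoc.
(* [b ⊗ -] is left adjoint to [rdual b ⊗ -]: transposing [kk] gives a cowedge on the coend [D x]
   itself, without [b] in front. *)
have [y y' f|u uE] := LD _ (fun y => ltrans (rcoev b) (kk y)).
  by have := kk_nat y y' f; rewrite -!ltrans_comp => <-.
pose k := ltrans_of (rev b) u.
have kE y : k ∘ (id b ⊠ d y) = kk y.
  rewrite /k -ltrans_of_comp uE; exact: (ltransK (rzig b)).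
exists k; split.
- apply: XQ => y; rewrite -compA G !compA kE comp_idl /kk.
  have S := st y; strictify; strict_of S S'.
  by rewrite S' comp_idr.
- rewrite -[g ∘ k](ltransK (rzig b)) -[RHS](ltransK (rzig b)); congr ltrans_of.
  apply: XD => y; rewrite -!ltrans_comp -compA kE comp_idl; congr ltrans.
  rewrite /kk; rewrite !compA G.
  have S := ts y; strictify; strict_of S S'.
  by rewrite S' comp_idr.
Qed.

End HalfBraidingModules.

(** * Modules over a pushed monad *)

Section PushedModules.
Variables (C : Category) (H : Monad C).

Section CounitCoequaliser.
Variables (M N : EM H) (u : F H (U H M) ~> N).
Hypothesis E : u ∘ counit (F H (U H M)) = u ∘ fmap (F H) (fmap (U H) (counit M)).

Lemma em_coeq_facE : (em_map u ∘ eta H (em_obj M)) ∘ em_act M = em_map u.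
Proof.
have E' : em_map u ∘ mu H _ = em_map u ∘ fmap H (em_act M) := f_equal (@em_map _ _ _ _) E.
by rewrite -compA eta_nat compA -E' -compA mu_eta comp_idr.
Qed.

Lemma em_coeq_fac_lin :
  (em_map u ∘ eta H (em_obj M)) ∘ em_act M
  = em_act N ∘ fmap H (em_map u ∘ eta H (em_obj M)).
Proof.
rewrite em_coeq_facE -[LHS]comp_idr -(mu_fmap_eta H) compA fmap_comp compA.
by rewrite (em_lin u).
Qed.

Definition em_coeq_fac : M ~> N :=
  {| em_map := em_map u ∘ eta H (em_obj M); em_lin := em_coeq_fac_lin |} : EMHom M N.

End CounitCoequaliser.

(** The canonical presentation of a module by free ones. It splits in [C] through [eta H], so the
    factor is [em_map u ∘ eta H], which is shown to be linear. *)
Definition em_coequaliser (M : EM H) :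
  Coequaliser (counit (F H (U H M))) (fmap (F H) (fmap (U H) (counit M))) (counit M).
Proof.
refine {| coeq_fac := fun N u E => em_coeq_fac E |}.
- apply: EMHom_eq; exact: act_mu.
- move=> N u E; apply: EMHom_eq; exact: em_coeq_facE.
- move=> N u u' E; apply: EMHom_eq.
  have E' : em_map u ∘ em_act M = em_map u' ∘ em_act M := f_equal (@em_map _ _ _ _) E.
  rewrite -[LHS]comp_idr -[RHS]comp_idr -(act_eta (em_act M)) !compA.
  by congr (_ ∘ _).
Defined.

Variable T : Monad (EM H).

Lemma push_mu_eta (x : C) :
  push_mu T x ∘ eta T (F H (push_functor T x)) = counit (T (F H x)).
Proof. by rewrite /push_mu -compA -eta_nat compA mu_eta comp_idl. Qed.

Definition pushed_module (M : EM H) (a : ModuleOn T M) :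
  ModuleOn (push_monad T) (em_obj M).
Proof.
refine ({| act := fmap (U H) (a ∘ fmap T (counit M)) : push_monad T (em_obj M) ~> em_obj M |}
  : ModuleOn (push_monad T) (em_obj M)).
- apply: (f_equal (fmap (U H)) (_ : (a ∘ fmap T (counit M)) ∘ push_mu T (U H M)
    = (a ∘ fmap T (counit M))
      ∘ fmap T (fmap (F H) (fmap (U H) (a ∘ fmap T (counit M)))))).
  rewrite -[RHS]compA -fmap_comp counit_nat /push_mu.
  rewrite -!compA (compA (fmap T (counit M))) -mu_nat -!compA !fmap_comp.
  by rewrite !compA act_mu.
- have E : (a ∘ fmap T (counit M)) ∘ eta T (F H (U H M)) = counit M.
    by rewrite -compA -eta_nat compA act_eta comp_idl.
  rewrite [LHS]compA [X in X ∘ _](f_equal (fmap (U H)) E).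
  exact: (act_eta (em_act M)).
Defined.

Variables (x : C) (a : ModuleOn (push_monad T) x).

(** Restriction of [a] along the monad morphism from [H] to the pushed monad given by the unit of
    [T]. *)
Definition base_map : H x ~> x := a ∘ fmap (U H) (eta T (F H x)).

Lemma push_act_lin : a ∘ em_act (T (F H x)) = base_map ∘ fmap H a.
Proof.
have E : fmap (U H) (push_mu T x) ∘ fmap (U H) (eta T (F H (push_functor T x)))
    = em_act (T (F H x)).
  exact: (f_equal (fmap (U H)) (push_mu_eta x)).
have M : a ∘ fmap (U H) (push_mu T x)
    = a ∘ fmap (U H) (fmap T (fmap (F H) a)) := act_mu a.
rewrite -E compA M -compA /base_map -[RHS]compA; congr (_ ∘ _).
exact: (f_equal (fmap (U H)) (eq_sym (eta_nat T (fmap (F H) a)))).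
Qed.

Definition base_act : ModuleOn H x.
Proof.
exists base_map.
- rewrite fmap_comp compA -push_act_lin -compA /base_map -[RHS]compA; congr (_ ∘ _).
  exact: (em_lin (eta T (F H x))).
- by have := act_eta a; rewrite /= compA.
Defined.

Definition base_module : EM H := {| em_act := base_act |} : EMObj H.

Definition act_EM : T (F H x) ~> base_module :=
  {| em_map := a : em_obj (T (F H x)) ~> em_obj base_module; em_lin := push_act_lin |}
  : EMHom (T (F H x)) base_module.

Lemma act_EM_mu : act_EM ∘ push_mu T x = act_EM ∘ fmap T (fmap (F H) a).
Proof. apply: EMHom_eq; exact: (act_mu a). Qed.

Lemma act_EM_eta : act_EM ∘ eta T (F H x) = counit base_module.
Proof. exact: EMHom_eq. Qed.

(** The counit of [base_module] is [a] restricted along [eta T], so associativity of [a] produces a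
    [mu T] that cancels this unit. This is the condition for [act_EM] to descend to
    [base_module]. *)
Lemma act_EM_fork :
  act_EM ∘ fmap T (counit (F H x))
  = act_EM ∘ fmap T (fmap (F H) (fmap (U H) (counit base_module))).
Proof.
have -> : fmap (U H) (counit base_module) = a ∘ fmap (U H) (eta T (F H x)) by [].
rewrite (fmap_comp (F H)) (fmap_comp T) [RHS]compA -act_EM_mu -[RHS]compA.
rewrite push_mu_nat.
by rewrite (fmap_comp T) (compA (mu T _)) mu_fmap_eta comp_idl.
Qed.

End PushedModules.

(** * Descent of an action to its base module *)

Section PushedModulesRigid.
Variables (C : RigidCat) (H : HopfMonad C).
Variables (T : Functor (EM_rig H) (EM_rig H)) (Z : Monad (EM H)).
Variable c : @Centraliser (EM_rig H) T Z.
Variables (x : C) (a : ModuleOn (push_monad Z) x).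

Let M := base_module a.

Lemma centraliser_epi_EM (N P : EM H) (e : N ~> P) : is_epi e -> is_epi (fmap Z e).
Proof. exact: (@centraliser_epi (EM_rig H) T Z c N P e). Qed.

Lemma counit_epi (N : EM H) : is_epi (counit N).
Proof. exact: coeq_epi (em_coequaliser N). Qed.

(** By [centraliser_fac] the map [act_EM a] factors through [fmap Z (counit M)]. The module axioms
    of the factor hold after composition with counits and their images under [Z], which are
    epimorphisms. *)
Lemma pushed_moduleP : exists a' : ModuleOn Z M, a' ∘ fmap Z (counit M) = act_EM a.
Proof.
have [t tE] := @centraliser_fac (EM_rig H) _ _ _ _ _ _ (em_coequaliser M) T Z c M
                 (act_EM a) (act_EM_fork a).
have {}tE : t ∘ fmap Z (counit M) = act_EM a := tE.
have t_mu : t ∘ mu Z M = t ∘ fmap Z t.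
  apply: (centraliser_epi_EM (centraliser_epi_EM (@counit_epi M))).
  rewrite -!compA mu_nat -fmap_comp compA tE.
  apply: (centraliser_epi_EM (@counit_epi (Z (F H x)))).
  rewrite -!compA -fmap_comp (act_EM_mu a : _ = _).
  by rewrite -counit_nat fmap_comp compA tE.
have t_eta : t ∘ eta Z M = id M.
  apply: (@counit_epi M).
  by rewrite -compA eta_nat compA tE act_EM_eta comp_idl.
by exists {| act := t : mfun Z M ~> M; act_mu := t_mu; act_eta := t_eta |}.
Qed.

End PushedModulesRigid.

(** * The comodule morphism defined by an action on the unit *)

Section ModuleMorphism.
Variables (C : MonCat) (B : Bimonad C) (T : ComoduleMonad B) (a : ModuleOn T 𝟙).

Definition module_mor (x : C) : T x ~> B x :=
  lun (B x) ∘ (a ⊠ id (B x)) ∘ coact T 𝟙 x ∘ fmap T (luni x).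

Lemma module_mor_nat : is_natural module_mor.
Proof.
move=> x y f; rewrite /module_mor -!compA -fmap_comp -luni_nat fmap_comp.
rewrite (post2 (coact_nat T _ _)) fmap_id -!compA (post2 (tlr _ _)).
by rewrite -(trl a) -!compA (post2 (lun_nat _)) -!compA.
Qed.

Lemma module_mor_mu (x : C) :
  module_mor x ∘ mu T x = mu B x ∘ fmap B (module_mor x) ∘ module_mor (T x).
Proof.
rewrite -compA -module_mor_nat /module_mor.
rewrite -!compA -mu_nat (post2 (coact_mu T _ _)) -!compA -!fmap_comp.
rewrite (post2 (luniK _)) comp_idl (fmap_comp T (a ⊠ _)) (post2 (coact_nat T _ _)).
rewrite fmap_id -!compA (post2 (eq_sym (tl_comp _ _ _))) -act_mu.
rewrite [RHS]compA -lun_nat -!compA; congr (_ ∘ _).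
by rewrite !compA -!tensm_comp !comp_idl comp_idr.
Qed.

Lemma module_mor_eta (x : C) : module_mor x ∘ eta T x = eta B x.
Proof.
rewrite /module_mor -!compA -eta_nat (post2 (coact_eta T _ _)).
rewrite (post2 (eq_sym (tensm_comp _ _ _ _))) comp_idl act_eta.
by rewrite luni_nat (post2 (lunKi _)) comp_idl.
Qed.

Lemma module_mor_coact (x y : C) :
  comul B x y ∘ module_mor (x ⊗ y) = (module_mor x ⊠ id (B y)) ∘ coact T x y.
Proof.
have X := coactA T 𝟙 x y.
rewrite /module_mor.
have E : fmap T (luni (x ⊗ y)) = fmap T (asc 𝟙 x y) ∘ fmap T (luni x ⊠ id y).
  by rewrite -fmap_comp -luni_tens compA ascKi comp_idl.
rewrite E !compA -lun_nat -!(compA _ (id 𝟙 ⊠ _)) trl -(tlr a (comul B x y)).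
rewrite !compA -(compA _ _ (coact T 𝟙 _)) -(compA _ (_ ∘ coact T 𝟙 _)).
rewrite -X !tl_comp -!compA coact_nat fmap_id !compA; congr (_ ∘ _ ∘ _).
by rewrite -tensm_id -(compA _ (_ ⊠ (_ ⊠ _))) -asc_nat !compA lun_tens.
Qed.

Definition module_monad_mor : MonadMorphism T B :=
  {| mor := {| nt := module_mor : forall x, T x ~> B x; nt_natural := module_mor_nat |};
     mor_mu := module_mor_mu; mor_eta := module_mor_eta |}.

Definition module_comodule_mor : ComoduleMonadMorphism T (regular_comodule B) :=
  {| cmor := module_monad_mor : MonadMorphism T (regular_comodule B);
     cmor_coact := module_mor_coact |}.

End ModuleMorphism.

Section InverseMorphism.
Variables (C : MonCat) (B : Bimonad C) (T G : ComoduleMonad B).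
Variables (f : ComoduleMonadMorphism T G) (g : forall x, G x ~> T x).
Hypothesis (gf : forall x, g x ∘ f x = id _) (fg : forall x, f x ∘ g x = id _).

Lemma inverse_comodule_mor : exists h : ComoduleMonadMorphism G T,
  forall x, inhabited (IsIso (h x)).
Proof.
have mono x v (u u' : v ~> T x) : f x ∘ u = f x ∘ u' -> u = u'.
  by move=> E; rewrite -[u]comp_idl -[u']comp_idl -(gf x) -!compA E.
have nat : is_natural g.
  by move=> x y h; apply: (mono y); rewrite compA fg comp_idl compA nt_natural -compA fg comp_idr.
have gm x : g x ∘ mu G x = mu T x ∘ fmap T (g x) ∘ g (G x).
  apply: (mono x); rewrite compA fg comp_idl -compA compA mor_mu -!compA.
  rewrite (post2 (nt_natural f _)) -!compA fg comp_idr -fmap_comp fg fmap_id comp_idr.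
  by [].
have ge x : g x ∘ eta G x = eta T x.
  by apply: (mono x); rewrite compA fg comp_idl mor_eta.
have gc x y : coact T x y ∘ g (x ⊗ y) = (g x ⊠ id (B y)) ∘ coact G x y.
  rewrite -[LHS]comp_idl -tensm_id -(gf x) tl_comp -!compA.
  by rewrite (post2 (eq_sym (cmor_coact f _ _))) -!compA fg comp_idr.
pose h : MonadMorphism G T :=
  {| mor := {| nt := g : forall x, G x ~> T x; nt_natural := nat |};
     mor_mu := gm; mor_eta := ge |}.
exists {| cmor := h; cmor_coact := gc |} => x; split.
by exists (f x).
Qed.

End InverseMorphism.

(** The counit makes [𝟙] a module over [B]; it is restricted along the inverse isomorphism. *)
Lemma unit_lifts_of_iso (C : MonCat) (B : Bimonad C) (T : Monad C) :
  isomorphic_monads B T -> unit_lifts T.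
Proof.
move=> [f fiso]; have [[g gf fg]] := fiso 𝟙; have [[k kf fk]] := fiso (T 𝟙).
have gm : couni B ∘ g ∘ mu T 𝟙 = couni B ∘ g ∘ fmap T (couni B ∘ g).
  have e : forall u u' : T (T 𝟙) ~> 𝟙, u ∘ f (T 𝟙) = u' ∘ f (T 𝟙) -> u = u'.
    by move=> u u' E; rewrite -[u]comp_idr -[u']comp_idr -fk !compA E.
  apply: e; rewrite -[RHS]compA -nt_natural fmap_comp.
  rewrite !compA -(compA _ g (f 𝟙)) gf comp_idr -couni_mu -!compA; congr (_ ∘ _).
  have M := mor_mu f 𝟙.
  have -> : mu T 𝟙 ∘ f (T 𝟙) = f 𝟙 ∘ mu B 𝟙 ∘ fmap B g.
    rewrite M -!compA nt_natural (post2 (eq_sym (fmap_comp T _ _))) fg fmap_id.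
    by rewrite comp_idl.
  by rewrite !compA gf comp_idl.
have ge : couni B ∘ g ∘ eta T 𝟙 = id 𝟙.
  by rewrite -(mor_eta f) compA -(compA _ g) gf comp_idr couni_eta.
by split; exact: {| act := couni B ∘ g : T 𝟙 ~> 𝟙; act_mu := gm; act_eta := ge |}.
Qed.

(** * The isomorphism of the double and the anti-double *)

Section DoublesFromModule.
Variables (C : RigidCat) (H : HopfMonad C).
Variables (D : DrinfeldBimonad (EM_rig H)) (Q : AntiDrinfeldMonad D).
Variable a : ModuleOn (anti_double Q) (𝟙 : C).

Let M : EM_rig H := base_module (T := Q) a.

(** The fusion map [lfus M x], seen as an [H]-linear map out of a free module. *)
Definition lfus_EM (x : C) : F H (𝟙 ⊗ x) ~> M ⊗ F H x :=
  (counit M ⊠ id (F H x)) ∘ F2 H 𝟙 x.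

Lemma lfus_EM_iso (x : C) : exists k : M ⊗ F H x ~> F H (𝟙 ⊗ x),
  k ∘ lfus_EM x = id _ /\ lfus_EM x ∘ k = id _.
Proof.
have K := lfusK x M; have K' := lfus_invK x M.
pose k : M ⊗ F H x ~> F H (𝟙 ⊗ x) :=
  {| em_map := lfus_inv M x : em_obj (M ⊗ F H x) ~> em_obj (F H (𝟙 ⊗ x));
     em_lin := @inverse_linear _ H (F H (𝟙 ⊗ x)) (M ⊗ F H x) _ _ K K' (em_lin (lfus_EM x)) |}
  : EMHom (M ⊗ F H x) (F H (𝟙 ⊗ x)).
by exists k; split; apply: EMHom_eq.
Qed.

(** Up to unitors the morphism is [module_coact], for the descended action, after [Q] of the fusion
    isomorphism; both are invertible. *)
Lemma module_mor_iso (x : C) : exists k : double D x ~> anti_double Q x,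
  k ∘ module_mor (T := anti_double Q) a x = id _
  /\ module_mor (T := anti_double Q) a x ∘ k = id _.
Proof.
have [a' aE] := pushed_moduleP (qcent Q) (a : ModuleOn (push_monad Q) 𝟙).
have [k [kg gk]] := module_coact_iso (a' : ModuleOn Q M) (F H x).
have [l [lf fl]] := lfus_EM_iso x.
pose m := module_coact (a' : ModuleOn Q M) (F H x) ∘ fmap Q (lfus_EM x).
pose n := fmap Q l ∘ k.
have nm : n ∘ m = id _.
  by rewrite /n /m -compA (compA k) kg comp_idl -fmap_comp lf fmap_id.
have mn : m ∘ n = id _.
  by rewrite /n /m -compA (compA (fmap Q _)) -fmap_comp fl fmap_id comp_idl gk.
have mE : m = (act_EM (T := Q) a ⊠ id (D (F H x)) : Q (F H 𝟙) ⊗ D (F H x) ~> M ⊗ D (F H x))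
      ∘ push_coact_EM Q 𝟙 x.
  rewrite -aE /m /module_coact /lfus_EM /push_coact_EM tl_comp fmap_comp.
  have N := coact_nat Q (counit M) (id (F H x)); rewrite fmap_id in N.
  by rewrite -!compA (post2 N) -!compA.
have mC : module_mor (T := anti_double Q) a x
    = lun (double D x) ∘ em_map m ∘ fmap (anti_double Q) (luni x).
  rewrite mE; congr (_ ∘ _); exact: (eq_sym (compA _ _ _)).
have nmC : em_map n ∘ em_map m = id _ := f_equal (@em_map _ _ _ _) nm.
have mnC : em_map m ∘ em_map n = id _ := f_equal (@em_map _ _ _ _) mn.
rewrite mC; move: (em_map m) (em_map n) nmC mnC => {nm mn mE mC} {}m {}n nm mn.
exists (fmap (anti_double Q) (lun x) ∘ n ∘ luni (double D x)); split.
- rewrite -!compA (compA (luni _)) luniK comp_idl (compA n) nm comp_idl.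
  by rewrite -fmap_comp lunKi fmap_id.
- rewrite -!compA (compA (fmap _ (luni x))) -fmap_comp luniK fmap_id comp_idl.
  by rewrite (compA m) mn comp_idl lunKi.
Qed.

Lemma iso_of_unit_lifts :
  isomorphic_comodule_monads (regular_comodule (double D)) (anti_double Q).
Proof.
pose f := module_comodule_mor (T := anti_double Q) a.
(* Inverses are unique, so definite description turns their mere existence into a family. *)
have inv x : {k : double D x ~> anti_double Q x | k ∘ f x = id _ /\ f x ∘ k = id _}.
  apply: constructive_definite_description.
  have [k [kf fk]] := module_mor_iso x; exists k; split=> // k' [kf' fk'].
  by rewrite -[k]comp_idr -fk' compA kf comp_idl.
exact: (inverse_comodule_mor (f := f) (fun x => proj1 (proj2_sig (inv x)))
         (fun x => proj2 (proj2_sig (inv x)))).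
Qed.

End DoublesFromModule.

(** * Characters, the square of the antipode, group-likes *)

Section CharacterTwist.
Variables (C : MonCat) (H : Bimonad C).
Implicit Types (b c : H 𝟙 ~> (𝟙 : C)) (x y : C).

(** In Sweedler notation [h ↦ b(h1) h2]; [rtwist] is [h ↦ h1 b(h2)], and [convol] is the convolution
    of functionals on [H 𝟙]. *)
Definition ltwist b x : H x ~> H x :=
  lun (H x) ∘ (b ⊠ id (H x)) ∘ comul H 𝟙 x ∘ fmap H (luni x).

Definition rtwist b x : H x ~> H x :=
  run (H x) ∘ (id (H x) ⊠ b) ∘ comul H x 𝟙 ∘ fmap H (runi x).

Definition convol b c : H 𝟙 ~> (𝟙 : C) :=
  lun 𝟙 ∘ (b ⊠ c) ∘ comul H 𝟙 𝟙 ∘ fmap H (luni 𝟙).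

Lemma ltwist_nat b x y (f : x ~> y) : ltwist b y ∘ fmap H f = fmap H f ∘ ltwist b x.
Proof.
rewrite /ltwist -!compA -fmap_comp -luni_nat fmap_comp (post2 (comul_nat _ _ _)) fmap_id.
by rewrite -!compA (post2 (tlr _ _)) -(trl b) -!compA (post2 (lun_nat _)) -!compA.
Qed.

Lemma rtwist_nat b x y (f : x ~> y) : rtwist b y ∘ fmap H f = fmap H f ∘ rtwist b x.
Proof.
rewrite /rtwist -!compA -fmap_comp -runi_nat fmap_comp (post2 (comul_nat _ _ _)) fmap_id.
by rewrite -!compA (post2 (trl _ _)) -(tlr _ b) -!compA (post2 (run_nat _)) -!compA.
Qed.

Lemma ltwist_couni x : ltwist (couni H) x = id _.
Proof. by rewrite /ltwist couni_l -fmap_comp lunKi fmap_id. Qed.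

Lemma luni1_runi1 : luni (𝟙 : C) = runi 𝟙.
Proof. by rewrite -[LHS]comp_idr -(runKi 𝟙) -lun1_run1 compA luniK comp_idl. Qed.

(** By the right counit law; a functional is thus determined by its twist. *)
Lemma couni_ltwist b : couni H ∘ ltwist b 𝟙 = b.
Proof.
have E := couni_r H 𝟙.
have U : fmap H (run 𝟙) ∘ fmap H (luni 𝟙) = id (H 𝟙).
  by rewrite luni1_runi1 -fmap_comp runKi fmap_id.
rewrite /ltwist; strictify.
strict_of E E'; strict_of U U'; hat_nat_of b N.
rewrite -(post (N _ _ _)).
by rewrite (post2 (E' _)) U' comp_idr.
Qed.

Lemma ltwist_mul b c x : ltwist b x ∘ ltwist c x = ltwist (convol c b) x.
Proof.
have X := comulA H 𝟙 𝟙 x.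
have N := comul_nat H (luni 𝟙) (id x).
have N' := comul_nat H (id 𝟙) (luni x).
have E : fmap H (asc 𝟙 𝟙 x) ∘ fmap H (luni 𝟙 ⊠ id x) = fmap H (id 𝟙 ⊠ luni x).
  by rewrite -fmap_comp luni1_runi1 triangle_i.
rewrite fmap_id in N; rewrite fmap_id in N'.
rewrite /ltwist /convol; strictify.
strict_of X X'; strict_of N NN; strict_of N' NN'; strict_of E E'.
hat_nat_of c Nc.
rewrite -!(post (Nc _ _ _)) -(post (NN _)) (post23 (X' _)).
by rewrite (post2 (E' _)) (post (NN' _)).
Qed.

(** By coassociativity at [𝟙], [x], [𝟙]: the two twists consume opposite outer legs of the iterated
    comultiplication. *)
Lemma twist_comm b c x : ltwist b x ∘ rtwist c x = rtwist c x ∘ ltwist b x.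
Proof.
have X := comulA H 𝟙 x 𝟙.
have N := comul_nat H (luni x) (id 𝟙).
have N' := comul_nat H (id 𝟙) (runi x).
have E : fmap H (asc 𝟙 x 𝟙) ∘ fmap H (luni x ⊠ id 𝟙) ∘ fmap H (runi x)
    = fmap H (id 𝟙 ⊠ runi x) ∘ fmap H (luni x).
  rewrite -!fmap_comp; congr (fmap H _).
  by rewrite -runi_tens -!compA runi_nat.
rewrite fmap_id in N; rewrite fmap_id in N'.
rewrite /rtwist /ltwist; strictify.
strict_of X X'; strict_of N NN; strict_of N' NN'; strict_of E E'.
hat_nat_of (comul H 𝟙 x) Nx; hat_nat_of (fmap H (luni x)) Ni.
hat_nat_of b Nb.
rewrite (post (Ni _ _ _)) (post (Nx _ _ _)) (post (Nb _ _ _)) -!(post (Nb _ _ _)).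
by rewrite -(post (NN _)) (post23 (X' _)) (E' _) (post (NN' _)).
Qed.

Lemma character_adjointE b c x :
  lun (H x) ∘ run (𝟙 ⊗ H x) ∘ ((b ⊠ id (H x)) ⊠ c) ∘ comul3 H 𝟙 x 𝟙
    ∘ fmap H (runi (𝟙 ⊗ x) ∘ luni x)
  = ltwist b x ∘ rtwist c x.
Proof.
have N := comul_nat H (luni x) (id 𝟙).
have E : fmap H (runi (𝟙 ⊗ x) ∘ luni x) = fmap H (luni x ⊠ id 𝟙) ∘ fmap H (runi x).
  by rewrite -!fmap_comp runi_nat.
rewrite fmap_id in N.
rewrite E /rtwist /ltwist /comul3; strictify.
strict_of N NN.
hat_nat_of (comul H 𝟙 x) Nx; hat_nat_of (fmap H (luni x)) Ni.
by rewrite (post (NN _)) [in RHS](post (Ni _ _ _)) (post (Nx _ _ _)).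
Qed.

End CharacterTwist.

(** * The dual of a character as its convolution inverse *)

Section DualCharacter.
Variables (C : RigidCat) (H : HopfMonad C).
Implicit Types b : ModuleOn H (𝟙 : C).

Lemma lev_unit_from : lun 𝟙 ∘ (ldual_unit_from ⊠ id 𝟙) = lev (𝟙 : C).
Proof. by rewrite /ldual_unit_from; strictify. Qed.

Lemma lcoev_unit_to : (id 𝟙 ⊠ ldual_unit_to) ∘ luni 𝟙 = lcoev (𝟙 : C).
Proof. by rewrite /ldual_unit_to; strictify. Qed.

Definition character b : EM_rig H := {| em_obj := 𝟙 : C; em_act := b |} : EMObj H.

(** This is linearity of the evaluation of [character b]; linearity of the coevaluation gives the
    other side. *)
Lemma convol_dual_l b : convol (dual_character_act b) b = couni H.
Proof.
have L := em_lin (EM_lev (character b)).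
have N := comul_nat H ldual_unit_to (id (𝟙 : C)).
rewrite fmap_id in N.
rewrite /convol /dual_character_act.
have -> : (ldual_unit_from ∘ em_act (ldual (character b)) ∘ fmap H ldual_unit_to) ⊠ b
   = (ldual_unit_from ⊠ id 𝟙) ∘ (em_act (ldual (character b)) ⊠ b)
     ∘ (fmap H ldual_unit_to ⊠ id (H 𝟙)).
  by rewrite -!tensm_comp !comp_idl comp_idr.
rewrite !compA lev_unit_from -!compA (post2 (eq_sym N)) -!compA -fmap_comp.
rewrite (post3 L) -!compA -fmap_comp.
have -> : em_map (EM_lev (character b)) ∘ (ldual_unit_to ⊠ id 𝟙 ∘ luni 𝟙) = id 𝟙.
  rewrite /= -lev_unit_from -compA (compA (_ ⊠ _)) -tl_comp ldual_unit_toK.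
  by rewrite tensm_id comp_idl lunKi.
by rewrite fmap_id comp_idr.
Qed.

Lemma convol_dual_r b : convol b (dual_character_act b) = couni H.
Proof.
have L := em_lin (EM_lcoev (character b)).
have N := comul_nat H (id (𝟙 : C)) ldual_unit_to.
rewrite fmap_id in N.
rewrite /convol /dual_character_act.
have -> : b ⊠ (ldual_unit_from ∘ em_act (ldual (character b)) ∘ fmap H ldual_unit_to)
   = (id 𝟙 ⊠ ldual_unit_from) ∘ (b ⊠ em_act (ldual (character b)))
     ∘ (id (H 𝟙) ⊠ fmap H ldual_unit_to).
  by rewrite -!tensm_comp !comp_idl comp_idr.
rewrite -!compA (post2 (eq_sym N)) -!compA -fmap_comp lcoev_unit_to.
rewrite (compA (b ⊠ _)).
have -> : (b ⊠ em_act (ldual (character b))) ∘ comul H 𝟙 (ldual 𝟙) ∘ fmap H (lcoev 𝟙)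
   = lcoev 𝟙 ∘ couni H := eq_sym L.
rewrite -lcoev_unit_to !compA -(compA (lun _)) -tr_comp ldual_unit_toK tensm_id comp_idr.
by rewrite lunKi comp_idl.
Qed.

Section Transport.
Variables (M : EM H) (x : C) (i : x ~> em_obj M) (j : em_obj M ~> x).
Hypotheses (ji : j ∘ i = id _) (ij : i ∘ j = id _).

Definition transport_act : ModuleOn H x.
Proof.
exists (j ∘ em_act M ∘ fmap H i).
- rewrite !fmap_comp -!compA -mu_nat (post2 (act_mu _)) -!compA.
  by rewrite (compA (fmap H i)) -(fmap_comp H i j) ij fmap_id comp_idl.
- by rewrite -compA -eta_nat -compA (compA (em_act M)) act_eta comp_idl.
Defined.

End Transport.

Definition dual_character b : ModuleOn H (𝟙 : C) :=
  transport_act (M := EM_ldual (character b)) ldual_unit_toK ldual_unit_fromK.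

Lemma dual_characterE b : dual_character b = dual_character_act b :> (_ ~> _).
Proof. by []. Qed.

Lemma ltwist_dualK b x :
  ltwist (dual_character_act b) x ∘ ltwist b x = id _
  /\ ltwist b x ∘ ltwist (dual_character_act b) x = id _.
Proof. by rewrite !ltwist_mul convol_dual_l convol_dual_r ltwist_couni. Qed.

(** Convolution inverses are unique, which is seen on twists because these compose. *)
Lemma dual_dual_character b :
  dual_character_act (dual_character b) = b :> (_ ~> _).
Proof.
have [E1 _] := ltwist_dualK (dual_character b) 𝟙; have [E2 _] := ltwist_dualK b 𝟙.
rewrite dual_characterE in E1.
rewrite -[LHS]couni_ltwist -[RHS]couni_ltwist; congr (_ ∘ _).
by rewrite -[LHS]comp_idr -E2 compA E1 comp_idl.
Qed.

End DualCharacter.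

(** * The square of the antipode and the double dual of a module *)

Section AntipodeSquare.
Variables (C : RigidCat) (H : HopfMonad C) (phi : PivotalStructure C).

Notation S2 := (@antipode_square C H phi).
Definition piv_mor (x : C) : x ~> ldual (ldual x) := phi x.
Definition piv_inv (x : C) : ldual (ldual x) ~> x := iso_inv (piv_iso phi x).

Lemma antipode_squareE x :
  S2 x = piv_inv (H x) ∘ left_antipode H (ldual (H x))
    ∘ fmap H (ldualm (left_antipode H x)) ∘ fmap H (piv_mor x).
Proof. by []. Qed.

Lemma piv_morK x : piv_inv x ∘ piv_mor x = id _.
Proof. exact: iso_invK. Qed.

Lemma piv_mor_Kinv x : piv_mor x ∘ piv_inv x = id _.
Proof. exact: iso_Kinv. Qed.

Lemma piv_mor_nat (x y : C) (f : x ~> y) : piv_mor y ∘ f = ldualm (ldualm f) ∘ piv_mor x.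
Proof. exact: (nt_natural phi f). Qed.

Lemma piv_inv_nat (x y : C) (f : x ~> y) : piv_inv y ∘ ldualm (ldualm f) = f ∘ piv_inv x.
Proof.
transitivity (piv_inv y ∘ (ldualm (ldualm f) ∘ piv_mor x) ∘ piv_inv x).
  by rewrite -compA -(compA _ (piv_mor x)) piv_mor_Kinv comp_idr.
by rewrite -piv_mor_nat compA piv_morK comp_idl.
Qed.

Lemma antipode_square_nat (x y : C) (f : x ~> y) : S2 y ∘ fmap H f = fmap H f ∘ S2 x.
Proof.
have N1 := left_antipode_nat H f.
have N2 := left_antipode_nat H (ldualm (fmap H f)).
have N3 : ldualm (left_antipode H y) ∘ ldualm (ldualm f)
    = ldualm (fmap H (ldualm (fmap H f))) ∘ ldualm (left_antipode H x).
  by rewrite -!ldualm_comp N1.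
have N4 := piv_inv_nat (fmap H f); have N5 := piv_mor_nat f.
rewrite !antipode_squareE.
move: (left_antipode H) (ldualm (ldualm f)) piv_mor piv_inv N1 N2 N3 N4 N5 => s ddf p pi N1 N2 N3 N4 N5.
rewrite -compA -fmap_comp N5 fmap_comp; rassoc.
rewrite (compA (fmap H (ldualm _)) (fmap H ddf)) -fmap_comp N3 fmap_comp; rassoc.
rewrite (compA (s (ldual (H y)))) -N2; rassoc.
by rewrite (compA (pi (H y))) N4; rassoc.
Qed.

(** Two uses of [left_antipodeE] express the action on the double dual through the antipode: [S2]
    measures the failure of the pivotal structure to be [H]-linear. *)
Lemma antipode_square_act (M : EM_rig H) :
  piv_mor (em_obj M) ∘ em_act M ∘ S2 (em_obj M)
  = em_act (ldual (ldual M)) ∘ fmap H (piv_mor (em_obj M)).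
Proof.
set x := em_obj M.
have E1 : em_act (ldual (ldual M)) = left_antipode H (ldual x)
    ∘ fmap H (ldualm (left_antipode H x ∘ fmap H (ldualm (em_act M)))) :> (_ ~> _).
  by rewrite (left_antipodeE (ldual M)) (left_antipodeE M).
have N := left_antipode_nat H (ldualm (em_act M)).
have N4 := piv_inv_nat (em_act M).
rewrite !antipode_squareE E1 -/x.
have P := piv_mor_Kinv x.
move: (left_antipode H) piv_mor piv_inv N N4 P => s p pi N N4 P.
rewrite ldualm_comp fmap_comp; rassoc.
rewrite (compA (s (ldual x))) -N.
rewrite (compA (em_act M : _ ~> _)) -N4; rassoc.
rewrite (compA (p _)) P comp_idl.
by [].
Qed.

Lemma piv_mor_tens (x y : C) : dd2 x y ∘ piv_mor (x ⊗ y) = piv_mor x ⊠ piv_mor y.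
Proof. exact: piv_tens. Qed.

Lemma piv_mor_unit : dd0 ∘ piv_mor 𝟙 = id 𝟙.
Proof. exact: piv_unit. Qed.

(** Stated for arbitrary morphisms, as the two readings of [^∨∨M] (in [C] and in [EM H]) agree
    only up to conversion. *)
Lemma descend_tens (B : Bimonad C) (m n m2 n2 k : C)
    (pm : m ~> m2) (qm : m2 ~> m) (pn : n ~> n2) (qn : n2 ~> n) (p : m ⊗ n ~> k)
    (d : k ~> m2 ⊗ n2) (am : B m ~> m) (an : B n ~> n) (am2 : B m2 ~> m2)
    (an2 : B n2 ~> n2) (ak : B k ~> k) (sm : B m ~> B m) (sn : B n ~> B n)
    (s : B (m ⊗ n) ~> B (m ⊗ n)) :
  d ∘ p = pm ⊠ pn -> p ∘ ((am ⊠ an) ∘ comul B m n) ∘ s = ak ∘ fmap B p ->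
  d ∘ ak = (am2 ⊠ an2) ∘ comul B m2 n2 ∘ fmap B d ->
  pm ∘ am ∘ sm = am2 ∘ fmap B pm -> pn ∘ an ∘ sn = an2 ∘ fmap B pn ->
  qm ∘ pm = id _ -> qn ∘ pn = id _ ->
  (am ⊠ an) ∘ comul B m n ∘ s = ((am ∘ sm) ⊠ (an ∘ sn)) ∘ comul B m n.
Proof.
move=> dp E L Em En qpm qpn.
have K : (pm ⊠ pn) ∘ ((am ⊠ an) ∘ comul B m n ∘ s)
    = (pm ⊠ pn) ∘ (((am ∘ sm) ⊠ (an ∘ sn)) ∘ comul B m n).
  rewrite -{1}dp -compA (compA p) E compA L -compA -fmap_comp dp -compA comul_nat.
  by rewrite !compA -!tensm_comp !compA Em En.
rewrite -[LHS]comp_idl -[RHS]comp_idl -tensm_id -qpm -qpn tensm_comp -!compA.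
by rewrite -!compA in K; rewrite K.
Qed.

(** Since [dd2] is [H]-linear and the pivotal structure is monoidal, [antipode_square_act] for
    [M ⊗ N] splits into those for [M] and [N]. *)
Lemma antipode_square_tens (M N : EM_rig H) :
  (em_act M ⊠ em_act N) ∘ comul H _ _ ∘ S2 (em_obj M ⊗ em_obj N)
  = ((em_act M ∘ S2 (em_obj M)) ⊠ (em_act N ∘ S2 (em_obj N))) ∘ comul H _ _.
Proof.
exact: (descend_tens (B := H) (piv_mor_tens _ _) (antipode_square_act (M ⊗ N))
  (em_lin (dd2 M N)) (antipode_square_act M) (antipode_square_act N) (piv_morK _) (piv_morK _)).
Qed.

(** Monoidality makes the pivotal structure at [𝟙] the canonical comparison with the double dual, so
    [S2] turns [b] into its double dual character, which is [b] again. *)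
Lemma antipode_square_character (b : ModuleOn H (𝟙 : C)) : b ∘ S2 𝟙 = b.
Proof.
have lin : ldual_unit_to ∘ dual_character b
    = em_act (EM_ldual (character b)) ∘ fmap H ldual_unit_to.
  rewrite dual_characterE /dual_character_act -(compA ldual_unit_from) (compA ldual_unit_to).
  by rewrite ldual_unit_fromK comp_idl.
pose w : character (dual_character b) ~> (ldual (character b) : EM_rig H) :=
  {| em_map := ldual_unit_to : em_obj (character (dual_character b)) ~> em_obj (EM_ldual (character b));
     em_lin := lin |} : EMHom (character (dual_character b)) (EM_ldual (character b)).
have A : piv_mor 𝟙 ∘ b ∘ S2 𝟙 = em_act (ldual (ldual (character b))) ∘ fmap H (piv_mor 𝟙)
  := antipode_square_act (character b).
have B : ldualm ldual_unit_to ∘ em_act (ldual (ldual (character b)))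
    = em_act (ldual (character (dual_character b))) ∘ fmap H (ldualm ldual_unit_to)
  := em_lin (ldualm w).
have P : ldualm ldual_unit_to ∘ piv_mor 𝟙 = ldual_unit_to.
  have := piv_mor_unit; rewrite /dd0 => E.
  rewrite -[RHS]comp_idr -E -(compA ldual_unit_from) (compA ldual_unit_to).
  by rewrite ldual_unit_fromK comp_idl.
rewrite -[RHS]dual_dual_character /dual_character_act -[in RHS]P fmap_comp.
rewrite -(compA ldual_unit_from) (compA (em_act _ : _ ~> _)) -B.
transitivity (dd0 ∘ (piv_mor 𝟙 ∘ b ∘ S2 𝟙)); last first.
  by rewrite A /dd0 -(compA ldual_unit_from) (compA (ldualm ldual_unit_to)).
by rewrite -(compA (piv_mor 𝟙)) compA piv_mor_unit comp_idl.
Qed.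

(** This is [antipode_square_tens] for [character b] and a free module, where [b] is fixed by
    [S2]. *)
Lemma ltwist_antipode_square (b : ModuleOn H (𝟙 : C)) (x : C) :
  ltwist b x ∘ S2 x = S2 x ∘ ltwist b x.
Proof.
have T : (b ⊠ mu H x) ∘ comul H 𝟙 (H x) ∘ S2 (𝟙 ⊗ H x)
    = ((b ∘ S2 𝟙) ⊠ (mu H x ∘ S2 (H x))) ∘ comul H 𝟙 (H x)
  := antipode_square_tens (character b) (F H x).
rewrite antipode_square_character in T.
have N := antipode_square_nat (id 𝟙 ⊠ eta H x); have N' := antipode_square_nat (eta H x).
have N1 := antipode_square_nat (luni x).
move: S2 T N N' N1 => s T N N' N1.
have K : (b ⊠ id (H x)) ∘ comul H 𝟙 x ∘ s (𝟙 ⊗ x) = (b ⊠ s x) ∘ comul H 𝟙 x.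
  transitivity ((b ⊠ mu H x) ∘ comul H 𝟙 (H x) ∘ s (𝟙 ⊗ H x) ∘ fmap H (id 𝟙 ⊠ eta H x)).
    rewrite -[RHS]compA N [RHS]compA -(compA _ _ (fmap H _)) comul_nat fmap_id compA.
    by rewrite -tensm_comp mu_fmap_eta comp_idr.
  rewrite T -compA comul_nat fmap_id compA -tensm_comp comp_idr -compA N' compA.
  by rewrite mu_fmap_eta comp_idl.
rewrite /ltwist -!compA -N1 !compA -(compA (lun _)) -(compA (lun _)) K.
by rewrite -(trl b (s x)) !compA lun_nat.
Qed.

Lemma rtwist_antipode_square (b : ModuleOn H (𝟙 : C)) (x : C) :
  rtwist b x ∘ S2 x = S2 x ∘ rtwist b x.
Proof.
have T : (mu H x ⊠ b) ∘ comul H (H x) 𝟙 ∘ S2 (H x ⊗ 𝟙)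
    = ((mu H x ∘ S2 (H x)) ⊠ (b ∘ S2 𝟙)) ∘ comul H (H x) 𝟙
  := antipode_square_tens (F H x) (character b).
rewrite antipode_square_character in T.
have N := antipode_square_nat (eta H x ⊠ id 𝟙); have N' := antipode_square_nat (eta H x).
have N1 := antipode_square_nat (runi x).
move: S2 T N N' N1 => s T N N' N1.
have K : (id (H x) ⊠ b) ∘ comul H x 𝟙 ∘ s (x ⊗ 𝟙) = (s x ⊠ b) ∘ comul H x 𝟙.
  transitivity ((mu H x ⊠ b) ∘ comul H (H x) 𝟙 ∘ s (H x ⊗ 𝟙) ∘ fmap H (eta H x ⊠ id 𝟙)).
    rewrite -[RHS]compA N [RHS]compA -(compA _ _ (fmap H _)) comul_nat fmap_id compA.
    by rewrite -tensm_comp mu_fmap_eta comp_idr.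
  rewrite T -compA comul_nat fmap_id compA -tensm_comp comp_idr -compA N' compA.
  by rewrite mu_fmap_eta comp_idl.
rewrite /rtwist -!compA -N1 !compA -(compA (run _)) -(compA (run _)) K.
by rewrite -(tlr (s x) b) !compA run_nat.
Qed.

End AntipodeSquare.

Section GroupLikes.
Variables (C : MonCat) (H : Bimonad C).
Implicit Types g h : GroupLike H.

Lemma gl_nat g (x y : C) (f : x ~> y) : g y ∘ f = fmap H f ∘ g x.
Proof. exact: (nt_natural (gl g) f). Qed.

Lemma gl_left_right g h (x : C) :
  gl_left g x ∘ gl_right h x = gl_right h x ∘ gl_left g x.
Proof.
transitivity (mu H x ∘ fmap H (mu H x) ∘ fmap H (fmap H (h x)) ∘ g (H x)).
  by rewrite /gl_left /gl_right -!compA (compA (g (H x))) gl_nat -!compA gl_nat.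
by rewrite -mu_mu -(compA (mu H x)) mu_nat /gl_left /gl_right -!compA.
Qed.

Lemma gl_right_inv g h (x : C) :
  mu H x ∘ g (H x) ∘ h x = eta H x -> gl_right h x ∘ gl_right g x = id _.
Proof.
move=> gh; rewrite -(mu_fmap_eta H x) -gh -(compA (mu H x)) gl_nat !fmap_comp !compA.
by rewrite -mu_mu -(compA (mu H x)) mu_nat /gl_right -!compA.
Qed.

End GroupLikes.

(** * Half-braidings on characters *)

Section UnitBraiding.
Variable C : MonCat.
Implicit Types m n k : C.

(** A half-braiding on a character lives over [𝟙], so it is a family of maps [m ~> k]; the lemmas
    below translate each axiom. *)
Definition unit_braid m k (t : m ~> k) : 𝟙 ⊗ m ~> k ⊗ 𝟙 := runi k ∘ t ∘ lun m.
Definition unit_unbraid m k (s : 𝟙 ⊗ m ~> k ⊗ 𝟙) : m ~> k := run k ∘ s ∘ luni m.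

Lemma unit_unbraidK m k (s : 𝟙 ⊗ m ~> k ⊗ 𝟙) : unit_braid (unit_unbraid s) = s.
Proof.
rewrite /unit_braid /unit_unbraid !compA runiK comp_idl -compA luniK.
exact: comp_idr.
Qed.

Lemma unit_braid_nat m m' k k' (t : m ~> k) (t' : m' ~> k') (f : m ~> m') (h : k ~> k') :
  unit_braid t' ∘ (id 𝟙 ⊠ f) = (h ⊠ id 𝟙) ∘ unit_braid t <-> t' ∘ f = h ∘ t.
Proof.
rewrite /unit_braid; split=> E; strictify; strict_of E E'; exact: E'.
Qed.

Lemma unit_braid_unit k (t : 𝟙 ~> k) (d : k ~> 𝟙) :
  (d ⊠ id 𝟙) ∘ unit_braid t = luni 𝟙 ∘ run 𝟙 <-> d ∘ t = id 𝟙.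
Proof.
rewrite /unit_braid; split=> E; strictify; strict_of E E'; exact: E'.
Qed.

Lemma unit_braid_tens m n k l j (t : m ~> k) (u : n ~> l) (v : m ⊗ n ~> j) (d : j ~> k ⊗ l) :
  asc k l 𝟙 ∘ (d ⊠ id 𝟙) ∘ unit_braid v ∘ asc 𝟙 m n
    = (id k ⊠ unit_braid u) ∘ asc k 𝟙 n ∘ (unit_braid t ⊠ id n)
  <-> d ∘ v = t ⊠ u.
Proof.
rewrite /unit_braid; split=> E; strictify; strict_of E E'; rewrite E'; hat_nat_of t N.
- by rewrite N.
- by rewrite N.
Qed.

(** A left twist appears on one side and a right twist on the other because [b] stands first in the
    source and last in the target. *)
Lemma unit_braid_lin (B : Bimonad C) (b : B 𝟙 ~> 𝟙) m k (am : B m ~> m) (ak : B k ~> k)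
    (t : m ~> k) :
  unit_braid t ∘ ((b ⊠ am) ∘ comul B 𝟙 m)
    = (ak ⊠ b) ∘ comul B k 𝟙 ∘ fmap B (unit_braid t)
  <-> t ∘ am ∘ ltwist b m = ak ∘ rtwist b k ∘ fmap B t.
Proof.
have EL : am ∘ ltwist b m = lun m ∘ ((b ⊠ am) ∘ comul B 𝟙 m) ∘ fmap B (luni m).
  by rewrite /ltwist !compA -lun_nat -(compA (lun m)) trl.
have ER : ak ∘ rtwist b k = run k ∘ ((ak ⊠ b) ∘ comul B k 𝟙) ∘ fmap B (runi k).
  by rewrite /rtwist !compA -run_nat -(compA (run k)) tlr.
rewrite -(compA t) EL ER; move: ((b ⊠ am) ∘ _) ((ak ⊠ b) ∘ _) => p q.
have Lm : fmap B (luni m) ∘ fmap B (lun m) = id _ by rewrite -fmap_comp luniK fmap_id.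
have Lm' : fmap B (lun m) ∘ fmap B (luni m) = id _ by rewrite -fmap_comp lunKi fmap_id.
rewrite /unit_braid !fmap_comp; split=> E.
- transitivity (run k ∘ (runi k ∘ t ∘ lun m ∘ p) ∘ fmap B (luni m)).
    by rewrite !compA runKi comp_idl.
  by rewrite E -!compA Lm' comp_idr.
- transitivity (runi k ∘ (t ∘ (lun m ∘ p ∘ fmap B (luni m))) ∘ fmap B (lun m)).
    by rewrite -!compA Lm comp_idr.
  by rewrite E !compA runiK comp_idl.
Qed.

End UnitBraiding.

Section Cancellation.
Variable C : MonCat.

(** Transfers monoidality from maps into double duals to their composites with the inverse pivotal
    structure. *)
Lemma cancel_tens (m n k l j : C) (p : m ~> k) (p' : k ~> m) (q : n ~> l) (q' : l ~> n)
    (r : m ⊗ n ~> j) (r' : j ~> m ⊗ n) (d : j ~> k ⊗ l)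
    (t : m ~> k) (u : n ~> l) (v : m ⊗ n ~> j) :
  p' ∘ p = id m -> q' ∘ q = id n -> r ∘ r' = id j -> d ∘ r = p ⊠ q -> d ∘ v = t ⊠ u ->
  r' ∘ v = (p' ∘ t) ⊠ (q' ∘ u).
Proof.
move=> pp qq rr dr dv; rewrite tensm_comp -dv -[v in RHS]comp_idl -rr.
rewrite -(compA r) (compA d) dr compA -tensm_comp pp qq tensm_id.
by rewrite comp_idl.
Qed.

Lemma cancel_unit (m k : C) (p : m ~> k) (p' : k ~> m) (d : k ~> m) (t : m ~> k) :
  p ∘ p' = id k -> d ∘ p = id m -> d ∘ t = id m -> p' ∘ t = id m.
Proof.
move=> pp dp dt; rewrite -[RHS]dt; congr (_ ∘ _).
by rewrite -[p']comp_idl -dp -compA pp comp_idr.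
Qed.

End Cancellation.

(** * Half-braidings on a character as automorphisms of the forgetful functor *)

Section Twist.
Variables (C : RigidCat) (H : HopfMonad C) (phi : PivotalStructure C).
Variable b : ModuleOn H (𝟙 : C).

(** Through [phi], a half-braiding on [(1, b)] amounts to a monoidal automorphism of
    the forgetful functor satisfying [twist_lin]. *)
Record IsTwist (th : forall M : EM H, em_obj M ~> em_obj M) : Prop := {
  twist_nat : forall (M N : EM H) (f : M ~> N), th N ∘ em_map f = em_map f ∘ th M;
  twist_unit : th (EM_unit H) = id 𝟙;
  twist_tens : forall M N : EM H, th (EM_tens M N) = th M ⊠ th N;
  twist_lin : forall M : EM H,
    th M ∘ em_act M ∘ ltwist b (em_obj M)
    = em_act M ∘ antipode_square H phi (em_obj M) ∘ rtwist b (em_obj M) ∘ fmap H (th M)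
}.

Notation piv_mor := (piv_mor phi).
Notation piv_inv := (piv_inv phi).

(** [antipode_square_act] trades the action on the double dual for [S2], and the pivotal map
    cancels. *)
Lemma twist_linE (M : EM_rig H) (t : em_obj M ~> em_obj M) :
  t ∘ em_act M ∘ ltwist b (em_obj M)
    = em_act M ∘ antipode_square H phi (em_obj M) ∘ rtwist b (em_obj M) ∘ fmap H t
  <-> (piv_mor (em_obj M) ∘ t) ∘ em_act M ∘ ltwist b (em_obj M)
    = em_act (ldual (ldual M)) ∘ rtwist b (ldual (ldual (em_obj M))) ∘ fmap H (piv_mor (em_obj M) ∘ t).
Proof.
have E := antipode_square_act phi M.
have N : rtwist b (ldual (ldual (em_obj M))) ∘ fmap H (piv_mor (em_obj M))
   = fmap H (piv_mor (em_obj M)) ∘ rtwist b (em_obj M) := rtwist_nat b (piv_mor (em_obj M)).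
have P := piv_morK phi (em_obj M).
have -> : em_act (ldual (ldual M)) ∘ rtwist b (ldual (ldual (em_obj M))) ∘ fmap H (piv_mor (em_obj M) ∘ t)
  = piv_mor (em_obj M) ∘ (em_act M ∘ antipode_square H phi (em_obj M)
      ∘ rtwist b (em_obj M) ∘ fmap H t).
  rewrite fmap_comp -compA (compA (rtwist _ _)) N.
  transitivity (em_act (ldual (ldual M)) ∘ fmap H (piv_mor (em_obj M))
     ∘ rtwist b (em_obj M) ∘ fmap H t).
    by rewrite -!compA.
  by rewrite -E; rassoc.
move: (antipode_square H phi (em_obj M)) (ltwist _ _) (rtwist _ _) => s l r.
rewrite -!(compA (piv_mor _)); split=> [->//|K].
by rewrite -[LHS]comp_idl -[RHS]comp_idl -P -!(compA (piv_inv _)) K.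
Qed.

Lemma twist_of_halfbraiding
    (s : forall M : EM_rig H, (character b : EM_rig H) ⊗ M ~> ldual (ldual M) ⊗ character b) :
  IsHalfBraiding s ->
  IsTwist (fun M : EM H => piv_inv (em_obj M) ∘ unit_unbraid (em_map (s M))).
Proof.
move=> hb.
pose t (M : EM_rig H) : em_obj M ~> ldual (ldual (em_obj M)) := unit_unbraid (em_map (s M)).
have tE (M : EM_rig H) : em_map (s M) = unit_braid (t M) by rewrite unit_unbraidK.
have t_nat (M N : EM_rig H) (f : M ~> N) :
    t N ∘ em_map f = ldualm (ldualm (em_map f)) ∘ t M.
  apply/unit_braid_nat; rewrite -!tE; exact: (f_equal (@em_map _ _ _ _) (hb_nat hb f)).
have t_unit : dd0 ∘ t 𝟙 = id 𝟙.
  apply/unit_braid_unit.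
  have E : (dd0 ⊠ id 𝟙) ∘ em_map (s 𝟙) = luni 𝟙 ∘ run 𝟙
    := f_equal (@em_map _ _ _ _) (hb_unit hb).
  exact: (eq_trans (f_equal (comp _) (eq_sym (tE 𝟙))) E).
have t_tens (M N : EM_rig H) : dd2 _ _ ∘ t (M ⊗ N) = t M ⊠ t N.
  apply/unit_braid_tens; rewrite -(tE M) -(tE N).
  have E := f_equal (@em_map _ _ _ _) (hb_tens hb M N).
  apply: eq_trans E; apply: (f_equal (fun h => h ∘ _)).
  exact: (f_equal (comp _) (eq_sym (tE (M ⊗ N)))).
have t_lin (M : EM_rig H) : t M ∘ em_act M ∘ ltwist b (em_obj M)
    = em_act (ldual (ldual M)) ∘ rtwist b (ldual (ldual (em_obj M))) ∘ fmap H (t M).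
  apply/unit_braid_lin; rewrite -tE; exact: (em_lin (s M)).
split.
- move=> M N f; change (piv_inv (em_obj N) ∘ t N ∘ em_map f = em_map f ∘ (piv_inv (em_obj M) ∘ t M)).
  rewrite -compA t_nat; move: (t M) => u; rewrite [LHS]compA [RHS]compA.
  exact: (f_equal (fun h => h ∘ u) (piv_inv_nat phi (em_map f))).
- exact: (cancel_unit (piv_mor_Kinv phi 𝟙) (piv_mor_unit phi) t_unit).
- move=> M N.
  exact: (cancel_tens (piv_morK phi _) (piv_morK phi _) (piv_mor_Kinv phi _) (piv_mor_tens phi _ _) (t_tens M N)).
- move=> M; apply/(@twist_linE M).
  have -> : piv_mor (em_obj M) ∘ (piv_inv (em_obj M) ∘ unit_unbraid (em_map (s M))) = t M.
    by rewrite compA piv_mor_Kinv comp_idl.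
  exact: t_lin.
Qed.

Lemma halfbraiding_of_twist (th : forall M : EM H, em_obj M ~> em_obj M) :
  IsTwist th ->
  exists s : forall M : EM_rig H,
      (character b : EM_rig H) ⊗ M ~> ldual (ldual M) ⊗ character b,
    IsHalfBraiding s.
Proof.
move=> tw.
pose t (M : EM_rig H) : em_obj M ~> ldual (ldual (em_obj M)) := piv_mor (em_obj M) ∘ th M.
have t_lin (M : EM_rig H) :
   unit_braid (t M) ∘ ((b ⊠ em_act M) ∘ comul H 𝟙 (em_obj M))
    = (em_act (ldual (ldual M)) ⊠ b) ∘ comul H (ldual (ldual (em_obj M))) 𝟙
      ∘ fmap H (unit_braid (t M)).
  apply/unit_braid_lin; apply/(@twist_linE M); exact: (twist_lin tw M).
pose s (M : EM_rig H) : (character b : EM_rig H) ⊗ M ~> ldual (ldual M) ⊗ character b :=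
  {| em_map := unit_braid (t M) : em_obj (EM_tens (character b) M)
       ~> em_obj (EM_tens (ldual (ldual M)) (character b));
     em_lin := t_lin M |} : EMHom _ _.
exists s; split.
- move=> M N f; apply: EMHom_eq.
  apply/(@unit_braid_nat C _ _ _ _ (t M) (t N) (em_map f) (ldualm (ldualm (em_map f)))).
  by rewrite /t -compA (twist_nat tw) compA piv_mor_nat -compA.
- apply: EMHom_eq; apply/(@unit_braid_unit C _ (t 𝟙) dd0).
  change (dd0 ∘ (piv_mor 𝟙 ∘ th (EM_unit H)) = id 𝟙).
  by rewrite (twist_unit tw) comp_idr piv_mor_unit.
- move=> M N; apply: EMHom_eq.
  apply/(@unit_braid_tens C _ _ _ _ _ (t M) (t N) (t (M ⊗ N)) (dd2 _ _)).
  change (dd2 (em_obj M) (em_obj N) ∘ (piv_mor (em_obj M ⊗ em_obj N) ∘ th (EM_tens M N))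
    = (piv_mor (em_obj M) ∘ th M) ⊠ (piv_mor (em_obj N) ∘ th N)).
  by rewrite (twist_tens tw) compA piv_mor_tens -tensm_comp.
Qed.

End Twist.

(** * Pairs in involution *)

Section GroupLikeOfAutomorphism.
Variables (C : MonCat) (H : Bimonad C).
Variable th : forall M : EM H, em_obj M ~> em_obj M.
Hypothesis th_nat : forall (M N : EM H) (f : M ~> N), th N ∘ em_map f = em_map f ∘ th M.
Hypothesis th_unit : th (EM_unit H) = id 𝟙.
Hypothesis th_tens : forall M N : EM H, th (EM_tens M N) = th M ⊠ th N.

(** Tannaka reconstruction: an endomorphism of the forgetful functor is determined by its values on
    free modules and acts as this element, see [gl_map_act]. *)
Definition gl_map (x : C) : x ~> H x := th (F H x) ∘ eta H x.

Lemma gl_map_act (M : EM H) : em_act M ∘ gl_map (em_obj M) = th M.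
Proof.
have N : th M ∘ em_act M = em_act M ∘ th (F H (em_obj M)) := th_nat (counit M).
by rewrite /gl_map compA -N -compA act_eta comp_idr.
Qed.

Lemma gl_map_nat (x y : C) (f : x ~> y) : gl_map y ∘ f = fmap H f ∘ gl_map x.
Proof.
have N : th (F H y) ∘ fmap H f = fmap H f ∘ th (F H x) := th_nat (fmap (F H) f).
by rewrite /gl_map -compA eta_nat compA N -compA.
Qed.

Lemma gl_map_tens (x y : C) : comul H x y ∘ gl_map (x ⊗ y) = gl_map x ⊠ gl_map y.
Proof.
have N : th (EM_tens (F H x) (F H y)) ∘ comul H x y = comul H x y ∘ th (F H (x ⊗ y))
  := th_nat (F2 H x y).
by rewrite /gl_map compA -N th_tens -compA comul_eta tensm_comp.
Qed.

Lemma gl_map_unit : couni H ∘ gl_map 𝟙 = id 𝟙.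
Proof.
have N : th (EM_unit H) ∘ couni H = couni H ∘ th (F H 𝟙) := th_nat (F0 H).
by rewrite /gl_map compA -N th_unit comp_idl couni_eta.
Qed.

Definition gl_of : GroupLike H :=
  {| gl := {| nt := gl_map : forall x, IdFunctor C x ~> H x; nt_natural := gl_map_nat |};
     gl_tens := gl_map_tens; gl_unit := gl_map_unit |}.

Lemma gl_of_left (x : C) : gl_left gl_of x = th (F H x).
Proof. exact: (gl_map_act (F H x)). Qed.

End GroupLikeOfAutomorphism.

Section Involution.
Variables (C : RigidCat) (H : HopfMonad C) (phi : PivotalStructure C).

Notation S2 := (antipode_square H phi).

(** Composing with [gl_right g] on the left and with the twist by the dual character on the right
    passes from one form to the other, because the twists commute with each other and with [S2]. *)
Lemma pair_in_involutionE (g g' : GroupLike H) (b : ModuleOn H 𝟙) (x : C) :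
  gl_inverse g g' ->
  gl_left g x ∘ gl_right g' x = character_adjoint b x ∘ S2 x
  <-> gl_left g x ∘ ltwist (dual_character b) x
      = gl_right g x ∘ S2 x ∘ rtwist (dual_character b) x.
Proof.
move=> /(_ x) [gg' g'g].
have R := gl_right_inv gg'; have R' := gl_right_inv g'g.
have [L' L] := ltwist_dualK b x.
have -> : character_adjoint b x = ltwist b x ∘ rtwist (dual_character b) x.
  exact: character_adjointE.
rewrite gl_left_right.
have Sl := ltwist_antipode_square phi b x.
have Sr := rtwist_antipode_square phi (dual_character b) x.
have T := twist_comm b (dual_character b) x.
rewrite -dual_characterE in L L'.
move: (gl_left g x) (gl_right g x) (gl_right g' x) (ltwist b x)
  (ltwist (dual_character b) x) (rtwist _ x) (S2 x) R R' L L' Sl Sr T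
  => l r r' lb lc rc s R R' L L' Sl Sr T.
split=> E.
- rewrite -[l]comp_idl -R' -(compA r) E -!compA.
  by rewrite (compA rc s) Sr -!compA (compA lb s) Sl -!compA (compA lb rc) T -!compA L comp_idr.
- rewrite -[l]comp_idr -L' (compA l) E -!compA (compA r') R comp_idl.
  by rewrite -T (compA s) -Sl -compA -Sr compA.
Qed.

(** Linearity at [M] reduces to [pair_in_involutionE] at its underlying object, because [em_act M]
    absorbs the multiplications of [H]. *)
Lemma twist_of_pair (g g' : GroupLike H) (b : ModuleOn H 𝟙) :
  gl_inverse g g' ->
  (forall x, gl_left g x ∘ gl_right g' x = character_adjoint b x ∘ S2 x) ->
  IsTwist phi (dual_character b) (fun M : EM H => em_act M ∘ g (em_obj M)).
Proof.
move=> inv pair; split.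
- move=> M N f; rewrite -compA gl_nat compA -(em_lin f) compA.
  by [].
- exact: gl_unit g.
- by move=> M N; rewrite /= -compA gl_tens -tensm_comp.
- move=> M; pose m : C := em_obj M; pose gm : m ~> H m := g m.
  have E := proj1 (pair_in_involutionE b m inv) (pair m).
  have N : _ = _ := rtwist_nat (dual_character b) (em_act M : H m ~> m).
  have N' := rtwist_nat (dual_character b) gm.
  have A := @antipode_square_nat _ H phi _ _ (em_act M : H m ~> m).
  have A' := @antipode_square_nat _ H phi _ _ gm.
  have G : gm ∘ em_act M = fmap H (em_act M) ∘ g (H m) := gl_nat g (em_act M : H m ~> m).
  have K := act_mu (em_act M).
  rewrite /gl_left /gl_right -/gm in E.
  change (em_act M ∘ gm ∘ em_act M ∘ ltwist (dual_character b) m =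
    em_act M ∘ S2 m ∘ rtwist (dual_character b) m ∘ fmap H (em_act M ∘ gm)).
  move: (em_act M : H m ~> m) (ltwist (dual_character b) m) (rtwist (dual_character b)) S2 gm
    K E N N' A A' G => a l r s gm K E N N' A A' G.
  rewrite -(compA a) G compA -K -!compA (compA (mu H m)) E.
  rewrite fmap_comp (compA (r m)) N -!compA N' (compA (s m)) A -!compA (compA (s (H m))) A'.
  by rewrite -!compA (compA a (fmap H a)) -K -!compA.
Qed.

(** Linearity on a free module, restricted along [eta H], is the identity of [pair_in_involutionE].
    The pair carries the dual of [b], as dualising twice returns [b]. *)
Lemma pair_of_twist (b : ModuleOn H 𝟙) (th th' : forall M : EM H, em_obj M ~> em_obj M) :
  IsTwist phi b th ->
  (forall M, th' M ∘ th M = id _) -> (forall M, th M ∘ th' M = id _) ->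
  exists g : GroupLike H, pair_in_involution phi g (dual_character b).
Proof.
move=> [nat unit tens lin] th'K thK'.
have mono M v (u u' : v ~> em_obj M) : th M ∘ u = th M ∘ u' -> u = u'.
  by move=> E; rewrite -[u]comp_idl -[u']comp_idl -(th'K M) -!compA E.
have nat' (M N : EM H) (f : M ~> N) : th' N ∘ em_map f = em_map f ∘ th' M.
  by apply: (mono N); rewrite !compA thK' nat -compA thK' comp_idl comp_idr.
have unit' : th' (EM_unit H) = id 𝟙.
  by apply: (mono (EM_unit H)); rewrite thK' unit comp_idl.
have tens' M N : th' (EM_tens M N) = th' M ⊠ th' N.
  by apply: (mono (EM_tens M N)); rewrite thK' tens -tensm_comp !thK' tensm_id.
pose g := gl_of nat unit tens; pose g' := gl_of nat' unit' tens'.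
have inv : gl_inverse g g'.
  move=> x; split.
    by have := gl_of_left nat unit tens x; rewrite /gl_left => ->; rewrite /= /gl_map compA thK' comp_idl.
  by have := gl_of_left nat' unit' tens' x; rewrite /gl_left => ->; rewrite /= /gl_map compA th'K comp_idl.
exists g, g'; split=> // x; apply/(pair_in_involutionE _ _ inv).
have D : dual_character (dual_character b) = b :> (_ ~> _) := dual_dual_character b.
rewrite D /g gl_of_left.
have L : th (F H x) ∘ mu H x ∘ ltwist b (H x)
    = mu H x ∘ S2 (H x) ∘ rtwist b (H x) ∘ fmap H (th (F H x)) := lin (F H x).
pose gm : x ~> H x := gl_map th x.
have A := @antipode_square_nat _ H phi _ _ gm.
have R := rtwist_nat b gm; have R' := ltwist_nat b (eta H x).
change (th (F H x) ∘ ltwist b x = mu H x ∘ fmap H gm ∘ S2 x ∘ rtwist b x).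
move: (ltwist b) (rtwist b) R R' L => l r R R' L.
transitivity (th (F H x) ∘ mu H x ∘ l (H x) ∘ fmap H (eta H x)).
  by rewrite -!compA R' (compA (mu H x)) mu_fmap_eta comp_idl.
rewrite L -[LHS]compA -fmap_comp -/(gl_map th x) -/gm.
move: S2 A => s A.
by rewrite -!compA R (compA (s _)) A -!compA.
Qed.

End Involution.

(** * Actions on the unit and pairs in involution *)

Section Main.
Variables (C : RigidCat) (H : HopfMonad C) (phi : PivotalStructure C).
Variables (D : DrinfeldBimonad (EM_rig H)) (Q : AntiDrinfeldMonad D).

Lemma pair_of_halfbraiding (b : ModuleOn H (𝟙 : C))
    (s : forall M : EM_rig H, (character b : EM_rig H) ⊗ M ~> ldual (ldual M) ⊗ character b) :
  IsHalfBraiding s ->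
  exists g : GroupLike H, pair_in_involution phi g (dual_character b).
Proof.
move=> hb; have tw := twist_of_halfbraiding phi hb.
pose th (M : EM H) := piv_inv phi (em_obj M) ∘ unit_unbraid (em_map (s M)).
(* The twist is invertible: [hb_iso] inverts the half-braiding, and the pivotal map inverts the
   rest. *)
have inv (M : EM H) : {r : em_obj M ~> em_obj M | r ∘ th M = id _ /\ th M ∘ r = id _}.
  apply: constructive_definite_description.
  have [r [rs sr]] := hb_iso hb M.
  have rsC : em_map r ∘ em_map (s M) = id (𝟙 ⊗ em_obj M) := f_equal (@em_map _ _ _ _) rs.
  have srC : em_map (s M) ∘ em_map r = id (ldual (ldual (em_obj M)) ⊗ 𝟙)
    := f_equal (@em_map _ _ _ _) sr.
  have P := piv_morK phi (em_obj M); have P' := piv_mor_Kinv phi (em_obj M).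
  rewrite /th.
  move: (em_map r : ldual (ldual (em_obj M)) ⊗ 𝟙 ~> 𝟙 ⊗ em_obj M)
    (em_map (s M) : 𝟙 ⊗ em_obj M ~> ldual (ldual (em_obj M)) ⊗ 𝟙)
    (piv_mor phi (em_obj M)) (piv_inv phi (em_obj M)) rsC srC P P' => t u p q tu ut qp pq.
  rewrite /unit_unbraid.
  have K : (lun _ ∘ t ∘ runi _ ∘ p) ∘ (q ∘ (run _ ∘ u ∘ luni _)) = id (em_obj M).
    rewrite -!compA (compA p) pq comp_idl (compA (runi _)) runiK comp_idl (compA t) tu.
    by rewrite comp_idl lunKi.
  have K' : (q ∘ (run _ ∘ u ∘ luni _)) ∘ (lun _ ∘ t ∘ runi _ ∘ p) = id (em_obj M).
    rewrite -!compA (compA (luni _)) luniK comp_idl (compA u) ut comp_idl.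
    by rewrite (compA (run _)) runKi comp_idl.
  exists (lun _ ∘ t ∘ runi _ ∘ p); split=> // v [vE _].
  by rewrite -[v]comp_idr -K' compA vE comp_idl.
exact: (pair_of_twist tw (fun M => proj1 (proj2_sig (inv M)))
  (fun M => proj2 (proj2_sig (inv M)))).
Qed.

Lemma pair_of_unit_lifts :
  unit_lifts (anti_double Q) ->
  exists (g : GroupLike H) (b : ModuleOn H 𝟙), pair_in_involution phi g b.
Proof.
move=> [a].
have [a' _] := pushed_moduleP (qcent Q) (a : ModuleOn (push_monad Q) 𝟙).
pose b : ModuleOn H (𝟙 : C) := base_act (T := Q) a.
have [g gP] := pair_of_halfbraiding (b := b) (@module_halfbraiding _ _ Q (character b) a').
by exists g, (dual_character b).
Qed.

(** The half-braiding of the pair is an action of [Q] on a character; pushed down to [C] it acts on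
    the underlying object [𝟙]. *)
Lemma unit_lifts_of_pair (g : GroupLike H) (b : ModuleOn H 𝟙) :
  pair_in_involution phi g b -> unit_lifts (anti_double Q).
Proof.
move=> [g' [inv pair]].
have [s hb] := halfbraiding_of_twist (twist_of_pair inv pair).
have [a _] := @halfbraiding_module _ _ Q _ _ hb.
split; exact: (pushed_module (T := Q) a).
Qed.

End Main.

Theorem theorem6p44 (C : RigidCat) (H : HopfMonad C)
    (hD : admits_double H) (hQ : admits_anti_double H)
    (D : DrinfeldBimonad (EM_rig H)) (Q : AntiDrinfeldMonad D) :
  (unit_lifts (anti_double Q)
     <-> isomorphic_comodule_monads (regular_comodule (double D)) (anti_double Q))
  /\ (isomorphic_comodule_monads (regular_comodule (double D)) (anti_double Q)
        <-> isomorphic_monads (double D) (anti_double Q))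
  /\ (forall phi : PivotalStructure C,
        (unit_lifts (anti_double Q)
           <-> exists (g : GroupLike H) (b : ModuleOn H munit), pair_in_involution phi g b)
        /\ (isomorphic_comodule_monads (regular_comodule (double D)) (anti_double Q)
           <-> exists (g : GroupLike H) (b : ModuleOn H munit), pair_in_involution phi g b)
        /\ (isomorphic_monads (double D) (anti_double Q)
           <-> exists (g : GroupLike H) (b : ModuleOn H munit), pair_in_involution phi g b)).
Proof.
have i_ii : unit_lifts (anti_double Q) ->
    isomorphic_comodule_monads (regular_comodule (double D)) (anti_double Q).
  by move=> [a]; apply: iso_of_unit_lifts.
have ii_iii : isomorphic_comodule_monads (regular_comodule (double D)) (anti_double Q) ->
    isomorphic_monads (double D) (anti_double Q).
  by move=> [f fiso]; exists f.
have iii_i : isomorphic_monads (double D) (anti_double Q) -> unit_lifts (anti_double Q).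
  exact: unit_lifts_of_iso.
have pairP (phi : PivotalStructure C) : unit_lifts (anti_double Q)
    <-> exists (g : GroupLike H) (b : ModuleOn H munit), pair_in_involution phi g b.
  split; first exact: pair_of_unit_lifts.
  by move=> [g [b gb]]; apply: unit_lifts_of_pair gb.
by split; [split | split; [split | move=> phi; move: (pairP phi)]]; tauto.
Qed.
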